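(* Let $N$ be either (a) a renewal Poisson cluster process such that $(X,K_A)$ is regularly varying with index $\alpha>1$ and non-null Radon measure $\mu$; or (b) a Hawkes process with $\mathbb{E}[\kappa_A]<1$ such that $(X,\kappa_A)$ is regularly varying with index $\alpha>1$ and non-null Radon measure $\mu$; and in either case suppose $\mu(\{(x_1,x_2)\in[0,\infty)^2\setminus\{(0,0)\}:x_1>1\})>0$. Let $N_T$ be the number of events of $N$ in $[0,T]$ and let $X_1,\dots,X_{N_T}$ be the transformed marks of these events. Then, for any $\gamma>0$, $$\lim_{T\to\infty}\ \sup_{x\ge\gamma\nu T}\left|\frac{\mathbb{P}\left(\max_{1\le i\le N_T}X_i>x\right)}{\mathbb{E}[N_T]\,\mathbb{P}(X>x)}-1\right|=0 .$$
   Context: Immigrants: a marked homogeneous Poisson process $\sum_{i\ge1}\varepsilon_{(\Gamma_i,A_{i0})}$ on $[0,\infty)\times\mathbb{A}$ with mean measure $\nu\,\mathrm{Leb}\otimes F$, $\nu>0$ ($\varepsilon$ denotes a Dirac measure, $F$ the common mark distribution on a measurable space $\mathbb{A}$). Each immigrant starts a cluster, independently of the others; $f:\mathbb{A}\to[0,\infty)$ is a measurable transformation, the transformed mark of an event with mark $a$ is $f(a)$, and $X=f(A)$ with $A\sim F$ a generic mark. The process $N$ consists of all immigrants and all their offspring (direct and indirect), with their marks. Renewal Poisson cluster process: immigrant $i$ has $K_{A_{i0}}\in\{0,1,2,\dots\}$ offspring, at times $\Gamma_i+T_{ij}$ with marks $A_{ij}$, $1\le j\le K_{A_{i0}}$,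 where $T_{ij}=W_{i1}+\dots+W_{ij}$ with $W_{ij}\ge0$. The sequence $(K_{A_{i0}},(W_{ij})_{j\ge1},(A_{ij})_{j\ge0})_{i\geq 1}$ is i.i.d. and independent of $(\Gamma_i)$; for each $i$, $(A_{ij})_{j\ge0}$ is i.i.d. with law $F$, and $(A_{ij})_{j\ge1}$ is independent of $(A_{i0},K_{A_{i0}},(W_{ij})_{j\ge1})$ ($A_{i0}$ may be dependent with $K_{A_{i0}}$ and $(W_{ij})_j$). Offspring do not generate further events. $(X,K_A)$ denotes a generic copy of $(f(A_{i0}),K_{A_{i0}})$. Hawkes process: with a fertility function $h:(0,\infty)\times\mathbb{A}\to[0,\infty)$, every event (immigrant or offspring) at time $t$ with mark $a$ independently generates direct offspring forming a marked Poisson process with mean measure $h(s-t,a)\,ds\otimes F$ on $(t,\infty)\times\mathbb{A}$, and each offspring reproduces in the same way. $\kappa_a=\int_0^\infty h(t,a)\,dt$, and $(X,\kappa_A)=(f(A),\kappa_A)$. Regular variation: a nonnegative random variable $Z$ is regularly varying with index $\alpha>0$ if $\mathbb{P}(Z>x)=x^{-\alpha}L(x)$ with $L$ slowly varying at infinity. A random vector $\mathbf{X}$ in $\mathbb{R}^2$ is regularly varying with index $\alpha>0$ and non-null Radon measure $\mu$ if (for some norm $|\cdot|$) $|\mathbf{X}|$ is regularly varying with index $\alpha$ and, for a sequence $(a_n)$ with $n\mathbb{P}(|\mathbf{X}|>a_n)\to1$, the measures $n\mathbb{P}(a_n^{-1}\mathbf{X}\in\cdot)$ converge vaguely to $\mu$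 on $\mathbb{R}^2\setminus\{(0,0)\}$, where $\mu$ is a non-null Radon measure (finite on Borel sets bounded away from the origin). *)

(* Defs.v *)
From HB Require Import structures.
From mathcomp Require Import all_boot all_order all_algebra.
From mathcomp Require Import all_classical all_reals all_analysis.

Set Implicit Arguments.
Unset Strict Implicit.
Unset Printing Implicit Defensive.

Import Order.TTheory GRing.Theory Num.Theory.
Import numFieldNormedType.Exports.

Local Open Scope classical_set_scope.
Local Open Scope ring_scope.

Definition independent_systems {d} {T : measurableType d} {R : realType}
    (P : probability T R) (G H : set_system T) : Prop :=
  forall E1 E2, G E1 -> H E2 -> P (E1 `&` E2) = (P E1 * P E2)%E.

Definition mutually_independent {d} {T : measurableType d} {R : realType}
    (P : probability T R) {I : choiceType} (G : I -> set_system T) : Prop :=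
  forall (J : seq I) (E : I -> set T), uniq J ->
    (forall i, i \in J -> G i (E i)) ->
    P (\bigcap_(i in [set` J]) E i) = (\prod_(i <- J) P (E i))%E.

Definition sigma_join {T I : Type} (G : I -> set_system T) : set_system T :=
  <<s \bigcup_i G i >>.

Definition slowly_varying {R : realType} (L : R -> R) : Prop :=
  [/\ measurable_fun [set x : R | 0 < x] L,
      \forall x \near +oo, 0 < L x
    & forall c : R, 0 < c -> L (c * x) / L x @[x --> +oo] --> (1 : R)].

Definition regularly_varying {d} {T : measurableType d} {R : realType}
    (P : probability T R) (Z : T -> R) (alpha : R) : Prop :=
  0 < alpha /\
  exists2 L : R -> R, slowly_varying L
    & forall x, 0 < x -> P [set w | x < Z w] = (x `^ (- alpha) * L x)%:E.

Definition is_norm2 {R : realType} (nrm : R * R -> R) : Prop :=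
  [/\ forall z, nrm z = 0 -> z = (0, 0),
      forall (c : R) (z : R * R), nrm (c * z.1, c * z.2) = `|c| * nrm z
    & forall y z : R * R, nrm (y.1 + z.1, y.2 + z.2) <= nrm y + nrm z].

(* A Radon measure on the punctured plane is encoded as a measure on the plane
   that does not charge the origin. *)
Definition punctured_radon {R : realType}
    (mu : {measure set (R * R) -> \bar R}) : Prop :=
  mu [set (0, 0)] = 0%E /\
  forall B : set (R * R), measurable B ->
    (exists2 e : R, 0 < e & B `<=` [set z | e <= `|z|]) -> (mu B < +oo)%E.

(* Vague convergence on the punctured plane, whose bounded sets are those
   bounded away from the origin, is tested on bounded continuous functions
   vanishing on a neighbourhood of the origin. *)
Definition regularly_varying2 {d} {T : measurableType d} {R : realType}
    (P : probability T R) (Z : T -> R * R) (alpha : R)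
    (mu : {measure set (R * R) -> \bar R}) : Prop :=
  [/\ punctured_radon mu, mu setT <> 0%E
    & exists nrm : R * R -> R,
      [/\ is_norm2 nrm, regularly_varying P (nrm \o Z) alpha
        & exists a : R^nat,
          (n%:R%:E * P [set w | (a n < nrm (Z w))%R])%E @[n --> \oo] --> 1%E /\
          forall g : R * R -> R, continuous g ->
            (exists M : R, forall z, `|g z| <= M) ->
            (exists2 e : R, 0 < e & forall z, `|z| < e -> g z = 0) ->
            (n%:R%:E * \int[P]_w (g ((a n)^-1 * (Z w).1, (a n)^-1 * (Z w).2)%R)%:E)%E
              @[n --> \oo] --> (\int[mu]_z (g z)%:E)%E]].

(* A point process on R x A (time, mark) is given by a labelled family of
   optional points; the label u carries no point at w when N u w = None. *)
Definition count {dA} {A : measurableType dA} {R : realType} {Omega : Type}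
    {I : choiceType} (N : I -> Omega -> option (R * A)) (B : set (R * A))
    (w : Omega) : \bar R :=
  \esum_(u in [set: I]) (if N u w is Some p then \d_p B else 0%E).

(* Mass at k of the Poisson law of mean m; the law of mean +oo is carried by
   +oo.  The library's poisson_pmf is 1 at every k when the rate is 0. *)
Definition poisson_mass {R : realType} (m : \bar R) (k : nat) : R :=
  if m is r%:E then r ^+ k / k`!%:R * expR (- r) else 0.

Definition poisson_process {d} {Omega : measurableType d} {R : realType}
    (P : probability Omega R) {dA} {A : measurableType dA} {I : choiceType}
    (N : I -> Omega -> option (R * A)) (Lambda : set (R * A) -> \bar R) : Prop :=
  forall (n : nat) (B : 'I_n -> set (R * A)) (c : 'I_n -> nat),
    (forall j, measurable (B j)) -> trivIset setT B ->
    P [set w | forall j, count N (B j) w = (c j)%:R%:E] =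
      (\prod_(j < n) poisson_mass (Lambda (B j)) (c j))%:E.

Definition immigrant_intensity {R : realType} {dA} {A : measurableType dA}
    (F : probability A R) (nu : R) (B : set (R * A)) : \bar R :=
  (nu%:E * (@lebesgue_measure R \x F) (B `&` (`[0%R, +oo[%classic `*` setT)))%E.

Definition immigrants {d} {Omega : measurableType d} {R : realType}
    (P : probability Omega R) {dA} {A : measurableType dA}
    (F : probability A R) (nu : R)
    (Gamma : nat -> Omega -> R) (A0 : nat -> Omega -> A) : Prop :=
  [/\ forall i, measurable_fun setT (Gamma i),
      forall i, measurable_fun setT (A0 i)
    & poisson_process P (fun i w => Some (Gamma i w, A0 i w))
        (immigrant_intensity F nu)].

(* In both cluster processes below, events carry genealogical labels: [:: i] is
   the i-th immigrant, rcons u j is the j-th direct offspring of u, and the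
   empty label carries no event.  All indices start at 0, except that M i 0 is
   the mark of immigrant i and M i j.+1 that of its offspring number j. *)

Definition renewal_events {R : realType} {dA} {A : measurableType dA}
    {Omega : Type} (Gamma : nat -> Omega -> R) (K : nat -> Omega -> nat)
    (W : nat -> nat -> Omega -> R) (M : nat -> nat -> Omega -> A)
    (u : seq nat) (w : Omega) : option (R * A) :=
  match u with
  | [:: i] => Some (Gamma i w, M i 0%N w)
  | [:: i; j] =>
      if (j < K i w)%N
      then Some (Gamma i w + \sum_(l < j.+1) W i l w, M i j.+1 w)
      else None
  | _ => None
  end.

Section renewal.
Context {d} {Omega : measurableType d} {R : realType} (P : probability Omega R).
Context {dA} {A : measurableType dA} (F : probability A R) (nu : R).
Variables (Gamma : nat -> Omega -> R) (K : nat -> Omega -> nat).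
Variables (W : nat -> nat -> Omega -> R) (M : nat -> nat -> Omega -> A).

Definition sigma_Gamma : set_system Omega :=
  sigma_join (fun i => g_sigma_algebra_preimage (Gamma i)).

Definition sigma_W (i : nat) : set_system Omega :=
  sigma_join (fun j => g_sigma_algebra_preimage (W i j)).

Definition sigma_immigrant (i : nat) : set_system Omega :=
  <<s g_sigma_algebra_preimage (M i 0%N) `|` g_sigma_algebra_preimage (K i)
      `|` sigma_W i >>.

Definition sigma_offspring_marks (i : nat) : set_system Omega :=
  sigma_join (fun j => g_sigma_algebra_preimage (M i j.+1)).

Definition sigma_cluster (i : nat) : set_system Omega :=
  <<s sigma_immigrant i `|` sigma_offspring_marks i >>.

Definition cluster_cylinder (i : nat) (BK : set nat) (BW : nat -> set R)
    (BM : nat -> set A) : set Omega :=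
  [set w | [/\ BK (K i w), forall j, BW j (W i j w)
             & forall j, BM j (M i j w)]].

Definition renewal_cluster : Prop :=
  [/\ immigrants P F nu Gamma (fun i => M i 0%N),
      [/\ forall i, measurable_fun setT (K i),
          forall i j, measurable_fun setT (W i j),
          forall i j, measurable_fun setT (M i j)
        & forall i j w, 0 <= W i j w],
      [/\ mutually_independent P sigma_cluster,
          forall i BK BW BM, (forall j, measurable (BW j)) ->
            (forall j, measurable (BM j)) ->
            P (cluster_cylinder i BK BW BM) = P (cluster_cylinder 0 BK BW BM)
        & independent_systems P sigma_Gamma (sigma_join sigma_cluster)]
    & [/\ forall i, mutually_independent P
            (fun j => g_sigma_algebra_preimage (M i j)),
          forall i j B, measurable B -> P (M i j @^-1` B) = F B
        & forall i, independent_systems P (sigma_offspring_marks i)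
            (sigma_immigrant i)]].

End renewal.

Definition kappa {R : realType} {dA} {A : measurableType dA} (h : R * A -> R)
    (a : A) : \bar R :=
  (\int[lebesgue_measure]_(t in `]0%R, +oo[) (h (t, a))%:E)%E.

Section hawkes.
Context {d} {Omega : measurableType d} {R : realType} (P : probability Omega R).
Context {dA} {A : measurableType dA} (F : probability A R) (nu : R).
Variables (h : R * A -> R) (N : seq nat -> Omega -> option (R * A)).

(* Mean measure of the direct offspring of an event; a label without event has
   no offspring. *)
Definition offspring_intensity (e : option (R * A)) (B : set (R * A)) : \bar R :=
  if e is Some (t, a) then
    (\int[lebesgue_measure \x F]_(p in B `&` (`]t, +oo[%classic `*` setT))
       (h (p.1 - t, a))%:E)%E
  else 0%E.

Definition hits (u : seq nat) (B : set (R * A)) : set Omega :=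
  [set w | exists2 p, N u w = Some p & B p].

(* Generation n consists of the labels of size n.+1. *)
Definition history (n : nat) : set_system Omega :=
  <<s [set E | exists u B, [/\ (size u <= n.+1)%N, measurable B & E = hits u B]] >>.

(* Given the generations up to n, the direct offspring of the events of
   generation n are independent Poisson processes with the mean measures above. *)
Definition conditionally_poisson_offspring : Prop :=
  forall (n : nat) (E : set Omega) (us : seq (seq nat)) (m : nat)
    (B : seq nat -> 'I_m -> set (R * A)) (c : seq nat -> 'I_m -> nat),
    history n E -> uniq us -> {in us, forall u, size u = n.+1} ->
    (forall u j, measurable (B u j)) -> (forall u, trivIset setT (B u)) ->
    P (E `&` [set w | {in us, forall u, forall j,
         count (fun k => N (rcons u k)) (B u j) w = (c u j)%:R%:E}]) =
      (\int[P]_(w in E) (\prod_(u <- us) \prod_(j < m)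
         poisson_mass (offspring_intensity (N u w) (B u j)) (c u j))%:E)%E.

Definition hawkes : Prop :=
  [/\ measurable_fun [set p : R * A | 0 < p.1] h
        /\ (forall t a, 0 < t -> 0 <= h (t, a)),
      forall w, N [::] w = None,
      forall u B, measurable B -> measurable (hits u B),
      exists Gamma A0, immigrants P F nu Gamma A0 /\
        forall i w, N [:: i] w = Some (Gamma i w, A0 i w)
    & conditionally_poisson_offspring].

End hawkes.

Section events.
Context {d} {Omega : measurableType d} {R : realType}.
Context {dA} {A : measurableType dA} {I : choiceType}.
Variable N : I -> Omega -> option (R * A).

Definition nb_events (T : R) (w : Omega) : \bar R :=
  count N (`[0, T]%classic `*` setT) w.

(* The maximum over an empty set of events is -oo. *)
Definition max_mark (f : A -> R) (T : R) (w : Omega) : \bar R :=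
  ereal_sup [set (f p.2)%:E | p in
    [set p : R * A | exists2 u, N u w = Some p & 0 <= p.1 <= T]].

End events.

(* Main.v *)
Require Import Defs.
From HB Require Import structures.
From mathcomp Require Import finmap.
From mathcomp Require Import all_boot all_order all_algebra.
From mathcomp Require Import all_classical all_reals all_analysis.
From mathcomp Require Import measurable_realfun ring lra.

Set Implicit Arguments.
Unset Strict Implicit.
Unset Printing Implicit Defensive.

Import Order.TTheory GRing.Theory Num.Theory.
Import numFieldNormedType.Exports.

Local Open Scope classical_set_scope.
Local Open Scope ring_scope.

(** Fix [x] and write [p = F {f > x}]. The mark of an event is independent of its
    existence and of its time, so the mean number of events in [0, T] with a
    transformed mark above [x] is exactly [E N_T * p]. The maximum exceeds [x] when
    there is at least one such event, and the union bound gives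
    [P (max > x) <= E N_T * p] for all [x] and [T]. What has to be proved is the
    reverse inequality up to an error [eps * p * T], for all [T >= 1] and all
    [x] such that [p * T] is small. This is enough: the immigrants alone give
    [E N_T >= nu * T], so the error is relatively small, and [p * T] is small for
    [x >= gamma * nu * T] and [T] large because [T * F {f > c * T}] tends to [0] when
    [alpha > 1] ([uniform_ratio], [rv2_tail1_little_o]). The hypothesis on [mu] is
    used to know that [p] never vanishes ([rv2_tail1_positive]).

    Renewal clusters ([renewal_lower]). Keep only the first [k] offspring of each
    immigrant. Bonferroni's inequality bounds the loss in the union bound by the mean
    number of pairs of events with large marks. Distinct marks are independent of each
    other and of the arrival times, so this is at most
    [p ^ 2 * (k + 1) ^ 2 * E (A_T ^ 2)], where [A_T] is the number of arrivals, a
    Poisson variable of mean [nu * T]: a quantity of order [(p * T) ^ 2]. The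
    discarded offspring have a mean number of at most
    [nu * T * \sum_(j >= k) P (K > j)], and this series converges because [alpha > 1].

    Hawkes processes ([hawkes_lower]). The generation [k + 1] is, given the earlier
    ones, a Poisson process; let [L_k] be its conditional mean on [0, T]. The number of
    its events with large marks is then Poisson of mean [p * L_k], so the first large
    mark appears at this generation with probability
    [E (1 - exp (- p * L_k) ; no earlier large mark)]. These probabilities telescope,
    and have to be compared with [p * E L_k]. Both the curvature of the exponential and
    the restriction to the absence of an earlier large mark (an event of probability
    close to [1]) cost little provided that [L_k / T] is uniformly integrable; this
    holds for each [k] by induction, since [L_(k + 1)] is at most the sum of [kappa]
    over the events of generation [k + 1], with [kappa] integrable
    ([uniformly_linear_outer_rate]). The generations beyond [n] contain at
    most [nu * T * m ^ n / (1 - m)] events on average, with [m = E kappa < 1].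

    The conditional Poisson laws are exploited through the identity
    [E (exp (- t * N) ; E) = E (exp (- (1 - exp (- t)) * L) ; E)] for the count [N] of a
    generation, its conditional mean [L] and an event [E] of the past
    ([level_laplace]). Small [t] gives means ([laplace_mean]), large [t] gives void
    probabilities ([laplace_void]), and uniform integrability is itself formulated
    with such Laplace transforms ([uniformly_linear]). *)

(** * Countable sums *)

Section tools.
Local Open Scope ereal_scope.

(** Turns a family over a countable type into a sequence, so that its sum becomes a
    series, for which monotone convergence is available. *)
Definition along_pickle {I : countType} {V : Type} (v0 : V) (a : I -> V) (k : nat) : V :=
  if pickle_inv k is Some i then a i else v0.

Lemma esum_countable (R : realType) (I : countType) (S : set I) (a : I -> \bar R) :
  (forall i, 0 <= a i) ->
  \esum_(i in S) a i =
  \sum_(k <oo) along_pickle 0 (fun i => if i \in S then a i else 0) k.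
Proof.
move=> a0; set b := along_pickle _ _.
have b0 k : 0 <= b k by rewrite /b /along_pickle; case: pickle_inv => // i; case: ifP.
rewrite nneseries_esumT//.
transitivity (\esum_(k in pickle @` S) b k).
  rewrite (esum_image S pickle); last by move=> ? ? _ _; exact: (pcan_inj pickleK).
  apply: eq_esum => i Si; rewrite /b /along_pickle.
  by rewrite pickleK_inv mem_set.
rewrite esum_mkcond; apply: eq_esum => k _; case: ifPn => //.
rewrite notin_setE => kS; rewrite /b /along_pickle.
case E : (pickle_inv k) => [i|//].
case: ifPn => // /set_mem Si; exfalso; apply: kS; exists i => //.
by have := @pickle_invK I k; rewrite E.
Qed.

Lemma integral_esum d (T : measurableType d) (R : realType)
    (mu : {measure set T -> \bar R}) (D : set T) (I : countType) (S : set I)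
    (f : I -> T -> \bar R) :
  measurable D -> (forall i, measurable_fun D (f i)) -> (forall i x, 0 <= f i x) ->
  \int[mu]_(x in D) (\esum_(i in S) f i x) = \esum_(i in S) \int[mu]_(x in D) f i x.
Proof.
move=> mD mf f0.
under eq_integral do rewrite esum_countable//.
rewrite integral_nneseries//.
- rewrite esum_countable; last by move=> i; exact: integral_ge0.
  apply: eq_eseriesr => k _.
  rewrite /along_pickle; case: pickle_inv => [i|]; last by rewrite integral0.
  by case: (i \in S) => //; rewrite integral0.
- move=> k; rewrite /along_pickle; case: pickle_inv => [i|]; last exact: measurable_cst.
  by case: (i \in S) => //; exact: measurable_cst.
- by move=> k x _; rewrite /along_pickle; case: pickle_inv => // i; case: ifP.
Qed.

Lemma measurable_esum d (T : measurableType d) (R : realType)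
    (D : set T) (I : countType) (S : set I) (f : I -> T -> \bar R) :
  (forall i, measurable_fun D (f i)) -> (forall i x, 0 <= f i x) ->
  measurable_fun D (fun x => \esum_(i in S) f i x).
Proof.
move=> mf f0; under eq_fun do rewrite esum_countable//.
apply: ge0_emeasurable_sum.
- by move=> k x _ _; rewrite /along_pickle; case: pickle_inv => // i; case: ifP.
- move=> k _; rewrite /along_pickle; case: pickle_inv => [i|]; last exact: measurable_cst.
  by case: (i \in S) => //; exact: measurable_cst.
Qed.

Lemma measurable_bigcup d (T : measurableType d) (I : countType) (S : set I)
    (E : I -> set T) :
  (forall i, measurable (E i)) -> measurable (\bigcup_(i in S) E i).
Proof.
move=> mE; rewrite bigcup_mkcond; apply: countable_bigcupT_measurable => //.
by move=> i; case: ifP.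
Qed.

(** At a point of [E i], the terms of the left-hand sum other than [i] are matched by
    the pairs [(i, j)] of the right-hand one. *)
Lemma bonferroni d (T : measurableType d) (R : realType) (P : probability T R)
    (I : countType) (S : set I) (E : I -> set T) :
  (forall i, measurable (E i)) ->
  \esum_(i in S) P (E i) <= P (\bigcup_(i in S) E i) +
    \esum_(p in [set p : I * I | [/\ S p.1, S p.2 & p.1 <> p.2]]) P (E p.1 `&` E p.2).
Proof.
move=> mE; set U := \bigcup_(i in S) E i; set S2 := [set p | _].
have mU : measurable U by exact: measurable_bigcup.
have PE A : measurable A -> P A = \int[P]_w (\1_A w)%:E.
  by move=> mA; rewrite integral_indic// setIT.
rewrite (@eq_esum _ _ S (fun i => P (E i)) (fun i => \int[P]_w (\1_(E i) w)%:E)); last first.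
  by move=> i _; exact: PE.
rewrite (@eq_esum _ _ S2 (fun p => P (E p.1 `&` E p.2))
  (fun p => \int[P]_w (\1_(E p.1 `&` E p.2) w)%:E)); last first.
  by move=> p _; apply: PE; exact: measurableI.
rewrite PE//.
have mI A : measurable A -> measurable_fun setT (fun w : T => (\1_A w)%:E : \bar R).
  by move=> mA; apply/measurable_EFinP.
have mI2 (p : I * I) : measurable_fun setT (fun w : T => (\1_(E p.1 `&` E p.2) w)%:E : \bar R).
  by apply: mI; exact: measurableI.
have i0 A (w : T) : 0 <= ((\1_A w)%:E : \bar R) by rewrite lee_fin.
rewrite -!integral_esum//; last by move=> i; exact: mI.
rewrite -ge0_integralD//; first last.
- exact: measurable_esum.
- by move=> w _; apply: esum_ge0.
- exact: mI.
apply: ge0_le_integral => //.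
- by move=> w _; apply: esum_ge0.
- by apply: measurable_esum => // i; exact: mI.
- apply: emeasurable_funD; [exact: mI|exact: measurable_esum].
move=> w _.
have [[i Si Eiw]|nU] := pselect (U w); last first.
  rewrite esum1; last first.
    move=> i Si; rewrite indicE memNset// => Eiw; apply: nU; exists i => //.
  by apply: adde_ge0 => //; apply: esum_ge0.
rewrite {1}indicE mem_set; last by exists i.
rewrite (esumID [set i]); last by move=> *.
apply: leeD.
  rewrite (_ : S `&` [set i] = [set i]); last by apply/seteqP; split => [j []|j ->].
  rewrite esum_set1// indicE mem_set//.
rewrite [leLHS](_ : _ = \esum_(j in S `&` ~` [set i]) (\1_(E i `&` E j) w)%:E); last first.
  by apply: eq_esum => j _; rewrite indicI/= [X in (X * _)%R]indicE mem_set// mul1r.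
rewrite -(esum_image (S `&` ~` [set i]) (fun j => (i, j))
  (fun p => (\1_(E p.1 `&` E p.2) w)%:E))//=; last by move=> j k _ _ [].
rewrite esum_mkcond [leRHS]esum_mkcond; apply: le_esum => p _.
case: ifPn => [/set_mem[j [Sj ji] <-]|_]; last by case: ifP.
by rewrite mem_set//; split => //= /esym.
Qed.

End tools.

Lemma le_esum_subset (R : realType) (I : choiceType) (S1 S2 : set I) (a : I -> \bar R) :
  S1 `<=` S2 -> (forall i, 0 <= a i)%E -> (\esum_(i in S1) a i <= \esum_(i in S2) a i)%E.
Proof.
move=> S12 a0; rewrite esum_mkcond [leRHS]esum_mkcond; apply: le_esum => i _.
case: ifPn => [/set_mem/S12 Hi|_]; first by rewrite mem_set.
by case: ifP.
Qed.

Lemma esumZl (R : realType) (I : countType) (S : set I) (x : R) (a : I -> \bar R) :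
  0 <= x -> (forall i, 0 <= a i)%E ->
  (\esum_(i in S) (x%:E * a i) = x%:E * \esum_(i in S) a i)%E.
Proof.
move=> x0 a0; rewrite !esum_countable//; last by move=> i; rewrite mule_ge0.
rewrite -nneseriesZl; last first.
  by move=> k _; rewrite /along_pickle; case: pickle_inv => // i; case: ifP.
apply: eq_eseriesr => k _; rewrite /along_pickle; case: pickle_inv => [i|].
  by case: ifP => // _; rewrite mule0.
by rewrite mule0.
Qed.

Lemma esum_strip (R : realType) (k : nat) (b : nat -> \bar R) : (forall i, 0 <= b i)%E ->
  (\esum_(q in [set q : nat * nat | (q.2 <= k)%N]) b q.1 =
   k.+1%:R%:E * \esum_(i in [set: nat]) b i)%E.
Proof.
move=> b0; transitivity (\esum_(p in `I_k.+1 `*`` (fun=> [set: nat])) b p.2)%E.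
  apply: (@reindex_esum _ _ _ _ _ (fun p : nat * nat => (p.2, p.1))); split.
  - by move=> [j i] [/= jk _]; rewrite -ltnS.
  - by move=> [j i] [j' i'] _ _ [-> ->].
  - by move=> [i j] /= jk; exists (j, i).
rewrite -(esum_esum (a := fun _ i => b i))//.
rewrite esum_fset//; last by move=> j _; exact: esum_ge0.
rewrite -fsbig_ord /=; set x := (\esum_(j in _) b j)%E.
rewrite (eq_bigr (fun=> 1%:E * x)%E); last by move=> j _; rewrite mul1e.
by rewrite -ge0_sume_distrl// sumEFin sumr_const card_ord.
Qed.

Lemma union_bound d (T : measurableType d) (R : realType) (P : probability T R)
    (I : countType) (S : set I) (E : I -> set T) : (forall i, measurable (E i)) ->
  (P (\bigcup_(i in S) E i) <= \esum_(i in S) P (E i))%E.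
Proof.
move=> mE; have mU : measurable (\bigcup_(i in S) E i) by exact: measurable_bigcup.
have m1 i : measurable_fun setT (fun w => (\1_(E i) w)%:E : \bar R).
  by apply/measurable_EFinP; exact: measurable_indic.
rewrite -[X in P X]setIT -integral_indic//.
have -> : (\esum_(i in S) P (E i) = \int[P]_w \esum_(i in S) (\1_(E i) w)%:E)%E.
  by rewrite integral_esum//; apply: eq_esum => i _; rewrite integral_indic ?setIT//.
apply: ge0_le_integral => //.
- by apply/measurable_EFinP; exact: measurable_indic.
- exact: measurable_esum.
- move=> w _; rewrite indicE; case: (boolP (w \in _)) => [/set_mem[i Si Ei]|_]; last exact: esum_ge0.
  rewrite (esumID [set i])// (_ : S `&` [set i] = [set i]); last first.
    by apply/seteqP; split => j /=; [case|move=> ->].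
  by rewrite esum_set1// indicE mem_set// leeDl//; exact: esum_ge0.
Qed.

(** * The exponential of an extended real *)

Section nexp.
Context {R : realType}.
Implicit Types x y a b : \bar R.

(** [exp (- y)] for counts and intensities that may be infinite; with the value [0] at
    [+oo] it stays continuous along nondecreasing sequences. *)
Definition nexp y : R := if y is r%:E then expR (- r) else 0.

Lemma nexp0 : nexp 0%E = 1. Proof. by rewrite /nexp -[RHS]expR0 -[in RHS]oppr0. Qed.

Lemma nexp_ge0 y : 0 <= nexp y.
Proof. by case: y => //= r; exact: expR_ge0. Qed.

Lemma nexp_le1 y : (0 <= y)%E -> nexp y <= 1.
Proof. by case: y => [r||]//=; rewrite ?ler01// lee_fin => r0; rewrite expR_le1 oppr_le0. Qed.

Lemma nexpD x y : (0 <= x)%E -> (0 <= y)%E -> nexp (x + y)%E = nexp x * nexp y.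
Proof.
case: x => [r||]//; case: y => [s||]//= _ _; rewrite ?mulr0 ?mul0r//.
by rewrite opprD expRD.
Qed.

Lemma le_nexp x y : (0 <= x)%E -> (x <= y)%E -> nexp y <= nexp x.
Proof.
case: x => [r||]//; case: y => [s||]//= _; rewrite ?expR_ge0//.
by rewrite lee_fin ler_expR lerN2.
Qed.

Lemma measurable_nexp : measurable_fun setT nexp.
Proof.
rewrite (_ : nexp = (fun y => expR (- fine y) * \1_(~` [set +oo; -oo]%E) y)).
  apply: measurable_funM.
    by apply: measurableT_comp => //; apply: measurableT_comp.
  apply: measurable_indic; apply: measurableC; apply: measurableU; exact: emeasurable_set1.
apply/funext => -[r||]; rewrite indicE.
- by rewrite mem_set ?mulr1//; case.
- by rewrite memNset ?mulr0//; apply; left.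
- by rewrite memNset ?mulr0//; apply; right.
Qed.

Lemma one_sub_nexp_le y : (0 <= y)%E -> ((1 - nexp y)%:E <= y)%E.
Proof.
case: y => [r||]//= r0; rewrite ?leey// lee_fin.
by have := expR_ge1Dx (- r); lra.
Qed.

(** The function [y - (1 - exp (- y))] is nondecreasing and 1-Lipschitz; the terms are
    distributed on both sides to avoid differences of infinite values. *)
Lemma le_sub_one_sub_nexp y a b : (0 <= y)%E -> (0 <= a)%E -> (0 <= b)%E ->
  (y <= a + b)%E -> (y + (1 - nexp a)%:E <= a + b + (1 - nexp y)%:E)%E.
Proof.
case: a => [a||]// y0 a0; case: b => [b||]// b0; rewrite ?leey// => yab.
case: y y0 yab => [y||]// y0; rewrite /= !lee_fin => yab.
rewrite lee_fin in y0; rewrite lee_fin in a0; rewrite lee_fin in b0.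
have [ya|/ltW ya] := leP a y.
  have : expR (- y) <= expR (- a) by rewrite ler_expR lerN2.
  lra.
have e1 : expR (- y) <= 1 by rewrite expR_le1 oppr_le0.
have : expR (- y) * (1 + (y - a)) <= expR (- a).
  have -> : expR (- a) = expR (- y) * expR (y - a) by rewrite -expRD; congr expR; ring.
  by rewrite ler_wpM2l ?expR_ge0// expR_ge1Dx.
nra.
Qed.

Lemma nexp_cvg (u : nat -> \bar R) l : (forall n, 0 <= u n)%E ->
  nondecreasing_seq u -> u @ \oo --> l -> nexp (u n) @[n --> \oo] --> nexp l.
Proof.
move=> u0 ndu ul.
have ule n : (u n <= l)%E.
  rewrite -(cvg_lim (@ereal_hausdorff R) ul) (cvg_lim _ (ereal_nondecreasing_cvgn ndu))//.
  by apply: ereal_sup_ubound; exists n.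
case: l ul ule => [l|ul _|/= ul ule].
- move=> ul ule; have uE : u = EFin \o (fine \o u).
    apply/funext => n /=; rewrite fineK// ge0_fin_numE//.
    by rewrite (le_lt_trans (ule n))// ltry.
  have -> : (fun n => nexp (u n)) = (fun n => expR (- (fine \o u) n)).
    by apply/funext => n; rewrite uE.
  rewrite /nexp; apply: continuous_cvg; first exact: continuous_expR.
  by apply: cvgN; exact: fine_cvg.
- apply/cvgrPdist_le => e e0; near=> n; rewrite /= sub0r normrN.
  rewrite ger0_norm ?nexp_ge0//.
  have : (`|ln e|%:E <= u n)%E.
    by near: n; move/cvgeyPge : ul; apply.
  move=> leu; apply: le_trans (le_nexp _ leu) _; first by rewrite lee_fin.
  rewrite /nexp -[leRHS]lnK ?posrE// ler_expR.
  by rewrite lerNl; have := ler_norm (- ln e); rewrite normrN.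
- by have := ule 0%N; have := u0 0%N; case: (u 0%N).
Unshelve. all: by end_near. Qed.

End nexp.

(** * Means and void probabilities from Laplace transforms *)

Section laplace.
Context d (T : measurableType d) (R : realType) (P : probability T R).
Implicit Types (E : set T) (Y N L : T -> \bar R).

Lemma bounded_convergence E (f_ : nat -> T -> R) (f : T -> R) :
  measurable E -> (forall n, measurable_fun setT (f_ n)) -> measurable_fun setT f ->
  (forall n x, 0 <= f_ n x <= 1) ->
  (forall x, f_ n x @[n --> \oo] --> f x) ->
  (\int[P]_(x in E) (f_ n x)%:E @[n --> \oo] --> \int[P]_(x in E) (f x)%:E)%E.
Proof.
move=> mE mf_ mf f01 ff.
have [] // := @dominated_convergence _ _ _ P E mE (fun n x => (f_ n x)%:E)
  (fun x => (f x)%:E) (cst 1%E).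
- by move=> n; apply: measurable_funTS; apply/measurable_EFinP.
- by apply: measurable_funTS; apply/measurable_EFinP.
- by apply: aeW => x _; apply: cvg_EFin; [exact: nearW|exact: ff].
- by apply: finite_measure_integrable_cst.
- apply: aeW => x n _; rewrite abse_EFin lee_fin ger0_norm.
    by case/andP: (f01 n x).
  by case/andP: (f01 n x).
Qed.

(** With [u = exp (- y / 2 ^ (k + 1))] this is [1 - u ^ 2 <= 2 * (1 - u)]. As the
    sequence increases to [y], means are recovered from Laplace transforms by monotone
    convergence, whether they are finite or not. *)
Lemma nexp_halving (y : \bar R) : (0 <= y)%E ->
  nondecreasing_seq (fun k => (2 ^+ k)%:E * (1 - nexp ((2 ^- k)%:E * y))%:E)%E.
Proof.
move=> y0; apply/nondecreasing_seqP => k.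
set z := ((2 ^- k.+1)%:E * y)%E.
have z0 : (0 <= z)%E by rewrite mule_ge0// lee_fin invr_ge0 exprn_ge0.
have -> : ((2 ^- k)%:E * y = z + z)%E.
  have k0 : (0 <= (2 ^- k.+1 : R)%:E)%E by rewrite lee_fin invr_ge0 exprn_ge0.
  rewrite /z -(ge0_muleDl _ k0 k0); congr (_ * _)%E; rewrite -EFinD; congr (_%:E).
  by rewrite exprS; field; rewrite expf_neq0.
rewrite nexpD// -!EFinM lee_fin exprS.
have := nexp_le1 z0; have := nexp_ge0 z; set u := nexp z => u0 u1.
have : 0 < 2 ^+ k :> R by rewrite exprn_gt0.
set p := 2 ^+ k => p0; have := mulr_ge0 (ltW p0) (sqr_ge0 (1 - u)); nra.
Qed.

Lemma one_sub_expR_ge (x : R) : 0 <= x -> x / (1 + x) <= 1 - expR (- x).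
Proof.
move=> x0; rewrite ler_pdivrMr; last by lra.
have := expR_ge1Dx x; have := expR_gt0 x.
have : expR (- x) * expR x = 1 by rewrite -expRD addNr expR0.
have := expR_gt0 (- x).
set a := expR _; set b := expR _; nra.
Qed.

Lemma nexp_halving_cvg (y : \bar R) : (0 <= y)%E ->
  ((2 ^+ k)%:E * (1 - nexp ((2 ^- k)%:E * y))%:E)%E @[k --> \oo] --> y.
Proof.
have p2 k : 0 < 2 ^+ k :> R by rewrite exprn_gt0.
have c2 : (2 ^- k : R) @[k --> \oo] --> 0.
  rewrite (_ : (fun k => _) = (fun k => (2^-1 : R) ^+ k)); last first.
    by apply/funext => k; rewrite exprVn.
  by apply: cvg_expr; rewrite ger0_norm// invf_lt1// ltr1n.
case: y => [r||]// r0.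
- rewrite lee_fin in r0; apply: cvg_EFin; first exact: nearW.
  rewrite /comp /=.
  apply: (@squeeze_cvgr _ _ _ _ (fun k => r / (1 + 2 ^- k * r)) (fun=> r)).
  + near=> k; have k0 : 0 <= 2 ^- k :> R by rewrite invr_ge0 ltW.
    apply/andP; split.
      rewrite -ler_pdivrMl//; apply: le_trans (one_sub_expR_ge (mulr_ge0 k0 r0)).
      by rewrite mulrA.
    have := expR_ge1Dx (- (2 ^- k * r)).
    rewrite -ler_pdivlMl// => ?; lra.
  + rewrite -[X in _ --> X]divr1; apply: cvgM; first exact: cvg_cst.
    apply: cvgV; first exact: oner_neq0.
    rewrite -[X in _ --> X]addr0; apply: cvgD; first exact: cvg_cst.
    rewrite -[X in _ --> X](mul0r r); apply: cvgM => //; exact: cvg_cst.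
  + exact: cvg_cst.
- rewrite (_ : (fun k => _) = (fun k => (2 ^+ k : R)%:E)); last first.
    apply/funext => k; rewrite gt0_muley ?lte_fin ?invr_gt0//.
    by rewrite /= subr0 mule1.
  apply/cvgeryP; apply/cvgryPge => A; near=> k.
  apply: (@le_trans _ _ k%:R); first by near: k; exact: nbhs_infty_ger.
  by rewrite -natrX ler_nat ltnW// ltn_expl.
Unshelve. all: by end_near. Qed.

Section mean.
Variables (E : set T) (N L : T -> \bar R).
Hypotheses (mE : measurable E) (mN : measurable_fun setT N) (mL : measurable_fun setT L).
Hypotheses (N0 : forall w, (0 <= N w)%E) (L0 : forall w, (0 <= L w)%E).

Lemma measurable_nexpM (c : R) Y : measurable_fun setT Y ->
  measurable_fun setT (fun w => nexp (c%:E * Y w)).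
Proof.
move=> mY; apply: (measurableT_comp measurable_nexp).
exact: measurable_funeM.
Qed.

Lemma integral_nexp_halving_cvg Y : measurable_fun setT Y -> (forall w, (0 <= Y w)%E) ->
  ((2 ^+ k)%:E * \int[P]_(w in E) (1 - nexp ((2 ^- k)%:E * Y w))%:E @[k --> \oo]
     --> \int[P]_(w in E) Y w)%E.
Proof.
move=> mY Y0.
have mk k : measurable_fun setT (fun w => (1 - nexp ((2 ^- k)%:E * Y w))%:E).
  by apply/measurable_EFinP; apply: measurable_funB => //; exact: measurable_nexpM.
have k0 k w : (0 <= (1 - nexp ((2 ^- k)%:E * Y w))%:E)%E.
  by rewrite lee_fin subr_ge0 nexp_le1// mule_ge0// lee_fin invr_ge0 exprn_ge0.
rewrite (_ : (fun k => _) = (fun k => \int[P]_(w in E)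
    ((2 ^+ k)%:E * (1 - nexp ((2 ^- k)%:E * Y w))%:E))%E); last first.
  apply/funext => k; rewrite ge0_integralZl// ?lee_fin ?exprn_ge0//.
  exact: measurable_funTS.
rewrite (_ : (\int[P]_(w in E) Y w = \int[P]_(w in E)
    (limn (fun k => (2 ^+ k)%:E * (1 - nexp ((2 ^- k)%:E * Y w))%:E)))%E); last first.
  by apply: eq_integral => w _; apply/esym/cvg_lim => //; exact: nexp_halving_cvg.
apply: cvg_monotone_convergence => //.
- by move=> k; apply: measurable_funTS; exact: measurable_funeM.
- by move=> k w _; rewrite mule_ge0// lee_fin exprn_ge0.
- by move=> w _ m n; exact: nexp_halving.
Qed.

Lemma integral_one_sub_nexp (c : R) Y : 0 <= c -> measurable_fun setT Y ->
  (forall w, (0 <= Y w)%E) ->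
  (\int[P]_(w in E) (1 - nexp (c%:E * Y w))%:E =
   P E - \int[P]_(w in E) (nexp (c%:E * Y w))%:E)%E.
Proof.
move=> c0 mY Y0.
have i1 : P.-integrable E (cst 1%E) by apply: finite_measure_integrable_cst.
have mn := measurable_nexpM c mY.
have inx : P.-integrable E (EFin \o (fun w => nexp (c%:E * Y w))).
  apply: le_integrable i1 => //; first by apply: measurable_funTS; exact/measurable_EFinP.
  move=> w _ /=; rewrite !ger0_norm ?nexp_ge0//.
  by rewrite lee_fin nexp_le1// mule_ge0.
transitivity (\int[P]_(w in E) (1 - (nexp (c%:E * Y w))%:E))%E.
  by apply: eq_integral.
rewrite integralB//; congr (_ - _)%E.
by rewrite integral_cst// mul1e.
Qed.

Hypothesis laplace : forall t : R, 0 < t ->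
  (\int[P]_(w in E) (nexp (t%:E * N w))%:E =
   \int[P]_(w in E) (nexp ((1 - expR (- t))%:E * L w))%:E)%E.

Lemma laplace_one_sub (t : R) : 0 < t ->
  (\int[P]_(w in E) (1 - nexp (t%:E * N w))%:E =
   \int[P]_(w in E) (1 - nexp ((1 - expR (- t))%:E * L w))%:E)%E.
Proof.
move=> t0; rewrite !integral_one_sub_nexp//; last exact: ltW.
  by rewrite laplace.
by rewrite subr_ge0 expR_le1 oppr_le0 ltW.
Qed.

Lemma le_integral_one_sub_nexp (c : R) Y : 0 <= c -> measurable_fun setT Y ->
  (forall w, (0 <= Y w)%E) ->
  (\int[P]_(w in E) (1 - nexp (c%:E * Y w))%:E <= c%:E * \int[P]_(w in E) Y w)%E.
Proof.
move=> c0 mY Y0; rewrite -ge0_integralZl//; last exact: measurable_funTS.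
have cY w : (0 <= c%:E * Y w)%E by rewrite mule_ge0.
apply: ge0_le_integral => //.
- by move=> w _; rewrite lee_fin subr_ge0 nexp_le1.
- apply: measurable_funTS; apply/measurable_EFinP; apply: measurable_funB => //.
  exact: measurable_nexpM.
- by apply: measurable_funTS; exact: measurable_funeM.
- by move=> w _; exact: one_sub_nexp_le.
Qed.

(** Both Laplace transforms are differentiated at [0]: along [t = 2 ^- k] for one
    inequality, along [1 - exp (- t) = 2 ^- k] for the other. *)
Lemma laplace_mean : (\int[P]_(w in E) N w = \int[P]_(w in E) L w)%E.
Proof.
have p2 k : 0 < 2 ^- k :> R by rewrite invr_gt0 exprn_gt0.
apply/eqP; rewrite eq_le; apply/andP; split.
- rewrite -(cvg_lim _ (integral_nexp_halving_cvg mN N0))//.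
  apply: lime_le; first exact: (cvgP _ (integral_nexp_halving_cvg mN N0)).
  apply: nearW => k; rewrite laplace_one_sub//.
  have e1 : 0 <= 1 - expR (- 2 ^- k) :> R by rewrite subr_ge0 expR_le1 oppr_le0 ltW.
  apply: (@le_trans _ _ ((2 ^+ k)%:E * ((2 ^- k)%:E * \int[P]_(w in E) L w))%E).
    apply: lee_wpmul2l; first by rewrite lee_fin exprn_ge0.
    apply: le_trans (le_integral_one_sub_nexp _ mL L0) _ => //.
    apply: lee_wpmul2r; first exact: integral_ge0.
    by rewrite lee_fin; have := expR_ge1Dx (- 2 ^- k : R); lra.
  by rewrite muleA -EFinM divff ?mul1e// expf_neq0.
- have [->|Nfin] := eqVneq (\int[P]_(w in E) N w)%E +oo%E; first exact: leey.
  have : (\int[P]_(w in E) N w)%E \is a fin_num.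
    by rewrite ge0_fin_numE ?integral_ge0// ltey.
  move/fineK <-; set n := fine _.
  have n0 : 0 <= n by rewrite fine_ge0// integral_ge0.
  have c2 : (2 ^- k : R) @[k --> \oo] --> 0.
    rewrite (_ : (fun k => _) = (fun k => (2^-1 : R) ^+ k)); last first.
      by apply/funext => k; rewrite exprVn.
    by apply: cvg_expr; rewrite ger0_norm// invf_lt1// ltr1n.
  have cn : ((1 - 2 ^- k)^-1 * n)%:E @[k --> \oo] --> n%:E.
    apply: cvg_EFin; first exact: nearW.
    rewrite -[X in _ --> X]mul1r /comp/=; apply: cvgM; last exact: cvg_cst.
    rewrite -[X in _ --> X]invr1; apply: cvgV; first exact: oner_neq0.
    rewrite -[X in _ --> X]subr0; apply: cvgB => //; exact: cvg_cst.
  rewrite -(cvg_lim _ cn)// -(cvg_lim _ (integral_nexp_halving_cvg mL L0))//.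
  apply: lee_lim.
  + exact: (cvgP _ (integral_nexp_halving_cvg mL L0)).
  + exact: (cvgP _ cn).
  + near=> k.
    have k0 : (0 < k)%N by near: k; exists 1%N.
    have t1 : 2 ^- k < 1 :> R.
      by rewrite invf_lt1 ?exprn_gt0// exprn_egt1 ?ltr1n// -lt0n.
    pose t : R := - ln (1 - 2 ^- k).
    have et : expR (- t) = 1 - 2 ^- k by rewrite opprK lnK// posrE subr_gt0.
    have t0 : 0 < t.
      by rewrite -oppr_lt0 -expR_lt1 et ltrBlDr ltrDl.
    have tE : 2 ^- k = 1 - expR (- t) by rewrite et subKr.
    rewrite [X in (_ * \int[P]_(w in E) (1 - nexp (X%:E * _))%:E)%E]tE.
    rewrite -laplace_one_sub//.
    apply: (@le_trans _ _ ((2 ^+ k)%:E * (t%:E * \int[P]_(w in E) N w))%E).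
      apply: lee_wpmul2l; first by rewrite lee_fin exprn_ge0.
      by apply: le_integral_one_sub_nexp => //; exact: ltW.
    have Nn : (\int[P]_(w in E) N w)%E = n%:E.
      by rewrite /n fineK// ge0_fin_numE ?integral_ge0// ltey.
    rewrite Nn -!EFinM lee_fin mulrA ler_wpM2r//.
    have : (1 + t) * expR (- t) <= 1.
      rewrite -[leRHS](expRxMexpNx_1 t) ler_wpM2r ?expR_ge0//; exact: expR_ge1Dx.
    rewrite et => h.
    have c0 : 0 < 1 - 2 ^- k :> R by rewrite subr_gt0.
    have p0 : 0 < 2 ^+ k :> R by rewrite exprn_gt0.
    rewrite -[leRHS]mul1r ler_pdivlMr//.
    have pp : 2 ^+ k * 2 ^- k = 1 :> R by rewrite divff// lt0r_neq0.
    nra.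
Unshelve. all: by end_near. Qed.

(** As [t] tends to infinity, [exp (- t * N)] tends to the indicator of [N = 0], since
    [N >= 1] elsewhere, and [1 - exp (- t)] tends to [1]. *)
Lemma laplace_void : (forall w, N w = 0%E \/ (1 <= N w)%E) ->
  (P (E `&` [set w | N w = 0%E]) = \int[P]_(w in E) (nexp (L w))%:E)%E.
Proof.
move=> Nint.
have mN0 : measurable [set w | N w = 0%E].
  by rewrite -[X in measurable X]setTI; exact: (mN measurableT (emeasurable_set1 0%E)).
have cN : (\int[P]_(w in E) (nexp (k.+1%:R%:E * N w))%:E @[k --> \oo] -->
    \int[P]_(w in E) (\1_[set w | N w = 0%E] w)%:E)%E.
  apply: bounded_convergence => //.
  - by move=> k; exact: measurable_nexpM.
  - move=> k w; rewrite nexp_ge0 nexp_le1// mule_ge0//.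
  - move=> w; rewrite indicE; have [N0w|N1] := Nint w.
      rewrite mem_set// (_ : (fun k => _) = cst 1); first exact: cvg_cst.
      by apply/funext => k; rewrite N0w mule0 nexp0.
    rewrite memNset; last by move=> /= N0w; move: N1; rewrite N0w lee_fin ler10.
    apply: (@squeeze_cvgr _ _ _ _ (cst 0) (fun k => expR (- k.+1%:R))).
    + near=> k; rewrite nexp_ge0/=.
      rewrite -[leRHS]/(nexp (k.+1%:R%:E)); apply: le_nexp; first by rewrite lee_fin.
      by rewrite -[leLHS]mule1 lee_pmul2l ?lte_fin// fin_numE.
    + exact: cvg_cst.
    + by have := (@cvgn_expR R); rewrite -(cvg_shiftS (fun k => expR (- k%:R))).
have cL : (\int[P]_(w in E) (nexp ((1 - expR (- k.+1%:R))%:E * L w))%:E @[k --> \oo] -->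
    \int[P]_(w in E) (nexp (L w))%:E)%E.
  have e1 k : 0 <= 1 - expR (- k.+1%:R) :> R by rewrite subr_ge0 expR_le1 oppr_le0.
  apply: bounded_convergence => //.
  - by move=> k; exact: measurable_nexpM.
  - exact: measurableT_comp measurable_nexp mL.
  - by move=> k w; rewrite nexp_ge0 nexp_le1// mule_ge0.
  - move=> w; apply: nexp_cvg.
    + by move=> n; rewrite mule_ge0.
    + move=> m n mn; apply: lee_wpmul2r => //; rewrite lee_fin lerD2l lerN2 ler_expR lerN2.
      by rewrite ler_nat.
    + case: (L w) (L0 w) => [r _||//].
        apply: cvg_EFin; first exact: nearW.
        rewrite -[X in _ --> X]mul1r /comp/=; apply: cvgM; last exact: cvg_cst.
        rewrite -[X in _ --> X]subr0; apply: cvgB; first exact: cvg_cst.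
        by have := (@cvgn_expR R); rewrite -(cvg_shiftS (fun k => expR (- k%:R))).
      rewrite (_ : (fun k => _) = cst +oo%E); first by move=> _; exact: cvg_cst.
      apply/funext => k; rewrite gt0_muley// lte_fin subr_gt0 expR_lt1 oppr_lt0//.
rewrite -(cvg_lim (@ereal_hausdorff R) cL).
under [in RHS]eq_fun do rewrite -laplace//.
rewrite (cvg_lim (@ereal_hausdorff R) cN).
by rewrite integral_indic// setIC.
Unshelve. all: by end_near. Qed.

End mean.
End laplace.

(** * Poisson series *)

Section poisson.
Context {R : realType}.
Local Open Scope ereal_scope.

Lemma exp_series (x : R) : (0 <= x)%R ->
  \sum_(c <oo) (x ^+ c / c`!%:R)%:E = (expR x)%:E.
Proof.
move=> x0; rewrite expRE -EFin_lim; last first.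
  rewrite /pseries/=; under eq_fun do rewrite mulrC.
  exact: is_cvg_series_exp_coeff.
apply/congr_lim/funext => n/=; rewrite /pseries/= /series/= -sumEFin//.
by under eq_bigr do rewrite mulrC.
Qed.

Lemma poisson_mass_ge0 (m : \bar R) k : 0 <= m -> (0 <= poisson_mass m k)%R.
Proof.
case: m => //= r; rewrite lee_fin => r0.
by rewrite mulr_ge0 ?expR_ge0// divr_ge0// exprn_ge0.
Qed.

Lemma poisson_massE (m : \bar R) k :
  poisson_mass m k = ((fine m) ^+ k / k`!%:R * nexp m)%R.
Proof. by case: m => /= [r||]//; rewrite mulr0. Qed.

Lemma measurable_poisson_mass k : measurable_fun setT (fun m : \bar R => poisson_mass m k).
Proof.
under eq_fun do rewrite poisson_massE.
apply: measurable_funM; last exact: measurable_nexp.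
by apply: measurable_funM => //; apply: measurable_funX; exact: fine_measurable.
Qed.

Lemma poisson_laplace (m : \bar R) (t : R) : 0 <= m -> (0 < t)%R ->
  \sum_(c <oo) (expR (- t * c%:R) * poisson_mass m c)%:E =
  (nexp ((1 - expR (- t))%:E * m))%:E.
Proof.
move=> m0 t0; case: m m0 => [r||]// r0; last first.
  rewrite gt0_muley//= ?lte_fin ?subr_gt0 ?expR_lt1 ?oppr_lt0//.
  by rewrite eseries0// => i _ _; rewrite mulr0.
rewrite lee_fin in r0.
transitivity (\sum_(c <oo) ((expR (- r))%:E * ((expR (- t) * r) ^+ c / c`!%:R)%:E)).
  apply: eq_eseriesr => c _ /=; rewrite expRM_natr exprMn -EFinM; congr _%:E.
  by ring.
rewrite nneseriesZl; last first.
  by move=> c _; rewrite lee_fin divr_ge0// exprn_ge0// mulr_ge0// expR_ge0.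
rewrite exp_series; last by rewrite mulr_ge0// expR_ge0.
by rewrite -EFinM -expRD /=; congr (expR _)%:E; ring.
Qed.

(** The factor [c] cancels in the factorial; applied twice, this gives the second
    moment of a Poisson law. *)
Lemma exp_series_shift (a : nat -> R) (x : R) : (0 <= x)%R -> (forall c, 0 <= a c)%R ->
  \sum_(c <oo) (a c * c%:R * (x ^+ c / c`!%:R))%:E =
  x%:E * \sum_(c <oo) (a c.+1 * (x ^+ c / c`!%:R))%:E.
Proof.
move=> x0 a0.
have b0 c : (0 <= x ^+ c / c`!%:R)%R by rewrite divr_ge0// exprn_ge0.
have f0 c : 0 <= (a c * c%:R * (x ^+ c / c`!%:R))%:E.
  by rewrite lee_fin; apply: mulr_ge0 => //; exact: mulr_ge0.
rewrite nneseries_recl//.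
rewrite mulr0 mul0r add0e -nneseries_addn//.
under eq_eseriesr do rewrite addn1.
rewrite -nneseriesZl; last by move=> c _; rewrite lee_fin; exact: mulr_ge0.
apply: eq_eseriesr => c _; rewrite -EFinM; congr _%:E.
rewrite exprS factS natrM; field.
by rewrite !pnatr_eq0 -lt0n fact_gt0 andTb //=.
Qed.

Lemma poisson_square (r : R) : (0 <= r)%R ->
  \sum_(c <oo) ((c%:R ^+ 2) * poisson_mass r%:E c)%:E = (r + r ^+ 2)%:E.
Proof.
move=> r0.
have b0 c : (0 <= r ^+ c / c`!%:R)%R by rewrite divr_ge0// exprn_ge0.
transitivity ((expR (- r))%:E * \sum_(c <oo) (c%:R * c%:R * (r ^+ c / c`!%:R))%:E).
  rewrite -nneseriesZl; last by move=> c _; rewrite lee_fin; apply: mulr_ge0 => //; exact: mulr_ge0.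
  by apply: eq_eseriesr => c _; rewrite -EFinM; congr _%:E => /=; ring.
rewrite exp_series_shift//.
rewrite (_ : \sum_(c <oo) _ = (expR r)%:E + r%:E * (expR r)%:E); last first.
  rewrite -{1}exp_series// -exp_series// -[X in r%:E * X](@eq_eseriesr _
    (fun c => (1 * (r ^+ c / c`!%:R))%:E)); last by move=> c _; rewrite mul1r.
  rewrite -(@exp_series_shift (cst 1%R))// -nneseriesD//; last 2 first.
  - by move=> c _ _; rewrite lee_fin.
  - by move=> c _ _; rewrite lee_fin; apply: mulr_ge0 => //; exact: mulr_ge0.
  apply: eq_eseriesr => c _; rewrite -EFinD; congr _%:E.
  by rewrite mul1r -natr1 mulrDl mul1r addrC.
rewrite -[X in _ * (_ + X)]EFinM -EFinD -EFinM; congr _%:E.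
have e1 := expRxMexpNx_1 r.
transitivity ((r + r ^+ 2) * (expR r * expR (- r)))%R; first by ring.
by rewrite e1 mulr1.
Qed.

End poisson.

Section counting.
Context (R : realType).
Local Open Scope ereal_scope.

Definition extended_nat (y : \bar R) := y = +oo \/ exists c : nat, y = c%:R%:E.

(** An infinite value contributes [0] on both sides, so that the probabilities of the
    finite values of a count determine its Laplace transform. *)
Lemma extended_nat_nexp (t : R) (y : \bar R) : (0 < t)%R -> extended_nat y ->
  \sum_(c <oo) (expR (- t * c%:R) * (y == c%:R%:E)%:R)%:E = (nexp (t%:E * y))%:E.
Proof.
move=> t0 [->|[c0 ->]].
  rewrite gt0_muley// eseries0// => i _ _.
  by rewrite (_ : (_ == _) = false) ?mulr0.
rewrite (nneseriesD1 (n := c0))//.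
rewrite eqxx mulr1 eseries0 ?adde0; last first.
  move=> i _ ic; rewrite (_ : (_ == _) = false) ?mulr0//.
  by apply/negbTE; rewrite eqe eqr_nat eq_sym.
by rewrite /= mulNr.
Qed.

End counting.

(** * The intensity of the offspring *)

Lemma lebesgue_measure_shift (R : realType) (t : R) (B : set R) : measurable B ->
  pushforward lebesgue_measure ((fun s => s - t) : measurableTypeR R -> measurableTypeR R) B
  = lebesgue_measure B.
Proof.
move=> mB; set sh := (fun s => s - t).
have msh : measurable_fun setT (sh : measurableTypeR R -> measurableTypeR R).
  exact: measurable_funB.
pose shm := isMeasurableFun.Build _ _ _ _ _ msh.
pose shf : {mfun measurableTypeR R >-> measurableTypeR R} := HB.pack sh shm.
apply/esym/(@lebesgue_measure_unique R (pushforward lebesgue_measure shf)) => //.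
move=> _ [[a b]] _ <-.
rewrite [RHS](_ : _ = lebesgue_measure `]a + t, b + t]%classic); last first.
  rewrite -[LHS]/(lebesgue_measure (sh @^-1` `]a, b])); congr lebesgue_measure.
  by apply/seteqP; split => s /=; rewrite !in_itv/= /sh ltrBrDr lerBlDr.
rewrite !lebesgue_measure_itv/= !lte_fin ltrD2r; case: ifP => // _.
by rewrite -!EFinD; congr _%:E; ring.
Qed.

Section intensity.
Context {R : realType} {dA} {A : measurableType dA} (F : probability A R) (h : R * A -> R).
Hypotheses (mh : measurable_fun [set p : R * A | 0 < p.1] h)
  (h0 : forall t a, 0 < t -> 0 <= h (t, a)).

(** The fertility is only known to be measurable at positive ages. Extended by [0] it
    is measurable everywhere, and the cut-off at the birth time of the parent becomes
    implicit. *)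
Let hp := h \_ [set p : R * A | 0 < p.1].

Let hp0 p : 0 <= hp p.
Proof.
rewrite /hp /patch; case: ifPn => // /set_mem; case: p => t a; exact: h0.
Qed.

Let mhp : measurable_fun setT hp.
Proof.
apply/(measurable_restrictT _ _).1 => //.
rewrite (_ : [set p | _] = fst @^-1` `]0, +oo[%classic); last first.
  by apply/seteqP; split => -[t a] /=; rewrite in_itv/= andbT.
by rewrite -[X in measurable X]setTI; exact: (@measurable_fst _ _ R A).
Qed.

Let rate (I : set R) (p : R * A) : \bar R :=
  (\int[@lebesgue_measure R]_s (\1_I s * hp (s - p.1, p.2))%:E)%E.

Let rate_ge0 I p : (0 <= rate I p)%E.
Proof. by apply: integral_ge0 => s _; rewrite lee_fin mulr_ge0. Qed.

Let measurable_rate I : measurable I -> measurable_fun setT (rate I).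
Proof.
move=> mI; apply: (measurable_fun_fubini_tonelli_F
  (fun q : (R * A) * measurableTypeR R =>
     (\1_I q.2 * hp (q.2 - q.1.1, q.1.2))%:E)) => [|q]; last by rewrite lee_fin mulr_ge0.
apply/measurable_EFinP; apply: measurable_funM.
  by apply: measurableT_comp => //; exact: measurable_indic.
apply: (measurableT_comp mhp); apply/measurable_fun_pairP; split => /=.
  apply: measurable_funB; first exact: measurable_snd.
  exact: (measurableT_comp (@measurable_fst _ _ R A) measurable_fst).
exact: (measurableT_comp (@measurable_snd _ _ R A) measurable_fst).
Qed.

(** The intensity on a rectangle factorizes since the marks of the offspring are
    drawn from [F] whatever their birth times. *)
Let offspringE (I : set R) (C : set A) p : measurable I -> measurable C ->
  (offspring_intensity F h (Some p) (I `*` C) = rate I p * F C)%E.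
Proof.
case: p => t a mI mC; rewrite /offspring_intensity integral_mkcond.
rewrite (_ : _ \_ _ =
    (fun q => (\1_(I `*` C) q * hp (q.1 - t, a))%:E)); last first.
  apply/funext => -[s b]; rewrite patchE /hp patchE indicE in_setI.
  case: (boolP (_ \in I `*` C)) => sB /=; last by rewrite mul0r.
  rewrite mul1r; have [ts|st] := ltP t s.
    by rewrite !mem_set//= ?subr_gt0//; split => //=; rewrite in_itv/= ts.
  rewrite !memNset//=; first by rewrite subr_gt0 ltNge st.
  by rewrite in_itv/= => -[]; rewrite ltNge st.
have mf : measurable_fun setT (fun s : measurableTypeR R => (\1_I s * hp (s - t, a))%:E).
  apply/measurable_EFinP; apply: measurable_funM; first exact: measurable_indic.
  apply: (measurableT_comp mhp); apply/measurable_fun_pairP; split; last exact: measurable_cst.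
  exact: measurable_funB.
apply: etrans (@fubini_tonelli1 _ _ (measurableTypeR R) A R lebesgue_measure F
  (fun q => (\1_(I `*` C) q * hp (q.1 - t, a))%:E) _ _) _.
- apply/measurable_EFinP; apply: measurable_funM.
    by apply: measurable_indic; exact: measurableX.
  apply: (measurableT_comp mhp); apply/measurable_fun_pairP; split; last exact: measurable_cst.
  by apply: measurable_funB => //; exact: measurable_fst.
- by move=> q; rewrite lee_fin mulr_ge0.
rewrite /rate -ge0_integralZr//; last by move=> s _; rewrite lee_fin mulr_ge0.
apply: eq_integral => s _; rewrite /fubini_F/=.
rewrite -[in RHS](setIT C) -integral_indic// -ge0_integralZl//.
- apply: eq_integral => b _; rewrite -EFinM; congr _%:E.
  rewrite !indicE in_setX/=; case: (s \in I); case: (b \in C) => /=; ring.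
- by apply/measurable_EFinP; exact: measurable_indic.
- by rewrite lee_fin mulr_ge0.
Qed.

Lemma measurable_offspring_intensity I C : measurable I -> measurable C ->
  measurable_fun setT (fun p : R * A => offspring_intensity F h (Some p) (I `*` C)).
Proof.
move=> mI mC; under eq_fun do rewrite offspringE//.
apply: emeasurable_funM => //; exact: measurable_rate.
Qed.

Lemma offspring_intensity_ge0 e I C : measurable I -> measurable C ->
  (0 <= offspring_intensity F h e (I `*` C))%E.
Proof. by case: e => // p mI mC; rewrite offspringE// mule_ge0. Qed.

Lemma le_offspring_intensity e I J C : measurable I -> measurable J -> measurable C ->
  I `<=` J ->
  (offspring_intensity F h e (I `*` C) <= offspring_intensity F h e (J `*` C))%E.
Proof.
case: e => // p mI mJ mC IJ; rewrite !offspringE//; apply: lee_wpmul2r => //.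
have mf (K : set R) : measurable K -> measurable_fun setT
    (fun s : measurableTypeR R => (\1_K s * hp (s - p.1, p.2))%:E).
  move=> mK; apply/measurable_EFinP; apply: measurable_funM; first exact: measurable_indic.
  apply: (measurableT_comp mhp); apply/measurable_fun_pairP; split; last exact: measurable_cst.
  exact: measurable_funB.
apply: ge0_le_integral => //.
- by move=> s _; rewrite lee_fin mulr_ge0.
- exact: mf.
- exact: mf.
- move=> s _; rewrite lee_fin ler_wpM2r// !indicE ler_nat.
  by case: (boolP (s \in I)) => // /set_mem /IJ ?; rewrite mem_set.
Qed.

Lemma offspring_intensity_setX e I C : measurable I -> measurable C ->
  (offspring_intensity F h e (I `*` C) = offspring_intensity F h e (I `*` setT) * F C)%E.
Proof.
case: e => [p|]; last by rewrite /= mul0e.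
by move=> mI mC; rewrite !offspringE// probability_setT mule1.
Qed.

Lemma kappaE a : kappa h a = (\int[@lebesgue_measure R]_s (hp (s, a))%:E)%E.
Proof.
rewrite /kappa integral_mkcond; apply: eq_integral => s _.
rewrite patchE /hp patchE; have [s0|s0] := ltP 0 s.
  by rewrite !mem_set//= in_itv/= s0.
by rewrite !memNset//=; rewrite ?in_itv/= ?andbT ltNge s0.
Qed.

Lemma kappa_ge0 a : (0 <= kappa h a)%E.
Proof. by rewrite kappaE; apply: integral_ge0 => s _; rewrite lee_fin. Qed.

Lemma measurable_kappa : measurable_fun setT (kappa h).
Proof.
rewrite (funext kappaE).
have mhps : measurable_fun setT (fun q : A * measurableTypeR R => (hp (q.2, q.1))%:E).
  apply/measurable_EFinP; apply: (measurableT_comp mhp).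
  by apply/measurable_fun_pairP; split; [exact: measurable_snd|exact: measurable_fst].
apply: (measurable_fun_fubini_tonelli_F
  (fun q : A * measurableTypeR R => (hp (q.2, q.1))%:E)) => // q.
by rewrite lee_fin.
Qed.

(** No offspring is born before its parent, and the mean total offspring number
    does not depend on the birth time of the parent. *)
Lemma offspring_intensity_le_kappa (T t : R) a :
  (offspring_intensity F h (Some (t, a)) (`]-oo, T]%classic `*` setT) <=
   kappa h a * (\1_(`]-oo, T]%classic) t)%:E)%E.
Proof.
have mI : measurable `]-oo, T]%classic by exact: measurable_itv.
have [tT|Tt] := leP t T; last first.
  rewrite [X in (X <= _)%E](_ : _ = 0%E).
    by rewrite mule_ge0// ?kappa_ge0// lee_fin.
  rewrite /offspring_intensity (_ : _ `&` _ = set0) ?integral_set0//.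
  apply/seteqP; split => -[s b]//= [] [] + _ [] + _.
  rewrite !in_itv/= andbT => sT ts.
  by have := lt_le_trans (lt_trans Tt ts) sT; rewrite ltxx.
rewrite indicE mem_set ?mule1; last by rewrite /= in_itv.
rewrite kappaE offspringE// probability_setT mule1.
have mhpa : measurable_fun setT (fun s : measurableTypeR R => (hp (s, a))%:E).
  apply/measurable_EFinP; apply: (measurableT_comp mhp).
  by apply/measurable_fun_pairP; split; [exact: measurable_id|exact: measurable_cst].
have msh : measurable_fun setT (fun s : measurableTypeR R => s - t : measurableTypeR R).
  exact: measurable_funB.
rewrite [leRHS](@eq_measure_integral _ _ _ _
  (pushforward lebesgue_measure (fun s => s - t : measurableTypeR R))); last first.
  by move=> B mB _; apply/esym; exact: lebesgue_measure_shift.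
rewrite ge0_integral_pushforward//; last by move=> s _; rewrite lee_fin.
rewrite preimage_setT; apply: ge0_le_integral => //.
- by move=> s _; rewrite lee_fin mulr_ge0.
- apply/measurable_EFinP; apply: measurable_funM; first exact: measurable_indic.
  apply: (measurableT_comp mhp); apply/measurable_fun_pairP; split; last exact: measurable_cst.
  exact: measurable_funB.
- exact: (measurableT_comp mhpa msh).
- by move=> s _; rewrite lee_fin ler_piMl// indicE lern1 leq_b1.
Qed.

End intensity.

(** * Counting labelled points *)

Section enumeration.
Local Open Scope ereal_scope.
Context (R : realType) (I : countType) (S : set I).

(** Finite exhaustion of a countable set of labels, for which the joint law of the
    offspring is only prescribed on finite families. *)
Definition enum_upto (K : nat) : seq I :=
  pmap (fun k => obind (fun i => if i \in S then Some i else None) (pickle_inv k))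
    (index_iota 0 K).

Lemma enum_upto_uniq K : uniq (enum_upto K).
Proof.
apply: (@pmap_uniq _ _ _ pickle); last exact: iota_uniq.
move=> k; rewrite /oapp; have := @pickle_invK I k.
by case: pickle_inv => //= i; case: ifP.
Qed.

Lemma enum_upto_sub K i : i \in enum_upto K -> S i.
Proof.
rewrite mem_pmap => /mapP[k _]; case: pickle_inv => //= j.
by case: ifPn => // /set_mem Sj [->].
Qed.

Lemma enum_upto_sum (a : I -> \bar R) K :
  \sum_(i <- enum_upto K) a i =
  \sum_(0 <= k < K) along_pickle 0 (fun i => if i \in S then a i else 0) k.
Proof.
rewrite big_pmap; apply: eq_bigr => k _; rewrite /along_pickle.
by case: pickle_inv => //= i; case: ifP.
Qed.

Lemma enum_upto_sum_nd (a : I -> \bar R) : (forall i, 0 <= a i) ->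
  nondecreasing_seq (fun K => \sum_(i <- enum_upto K) a i).
Proof.
move=> a0 m n mn; rewrite !enum_upto_sum; apply: lee_sum_nneg_natr => // k _ _.
by rewrite /along_pickle; case: pickle_inv => // i; case: ifP.
Qed.

Lemma enum_upto_sum_cvg (a : I -> \bar R) : (forall i, 0 <= a i) ->
  \sum_(i <- enum_upto K) a i @[K --> \oo] --> \esum_(i in S) a i.
Proof.
move=> a0; rewrite esum_countable//; under eq_fun do rewrite enum_upto_sum.
apply: is_cvg_nneseries => k _ _.
by rewrite /along_pickle; case: pickle_inv => // i; case: ifP.
Qed.

End enumeration.

Lemma nexp_sum (R : realType) (I : eqType) (s : seq I) (a : I -> \bar R) :
  (forall i, 0 <= a i)%E -> nexp (\sum_(i <- s) a i)%E = \prod_(i <- s) nexp (a i).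
Proof.
move=> a0; elim: s => [|i s IHs]; first by rewrite !big_nil nexp0.
by rewrite !big_cons nexpD ?IHs// sume_ge0.
Qed.

Section point_processes.
Context {d} {Omega : measurableType d} {R : realType} {dA} {A : measurableType dA}.

Lemma point_indic (e : option (R * A)) (B : set (R * A)) :
  ((if e is Some p then \d_p B else 0) =
   (if `[< exists2 p, e = Some p & B p >] then 1 else 0) :> \bar R)%E.
Proof.
case: e => [p|]; last by case: asboolP => // -[].
rewrite diracE; case: asboolP => [[_ [<-] Bp]|nB]; first by rewrite mem_set.
by rewrite memNset// => Bp; apply: nB; exists p.
Qed.

Variable N : seq nat -> Omega -> option (R * A).

Lemma hits_indic u B w :
  ((if N u w is Some p then \d_p B else 0) = (\1_(hits N u B) w)%:E :> \bar R)%E.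
Proof.
rewrite point_indic indicE; case: asboolP => H; first by rewrite mem_set.
by rewrite memNset.
Qed.

(** Level [k] consists of the labels of size [k]; the immigrants form level [1]. *)
Definition level_count (k : nat) (B : set (R * A)) (w : Omega) : \bar R :=
  (\esum_(u in [set u | size u = k]) (\1_(hits N u B) w)%:E)%E.

Lemma level_count_ge0 k B w : (0 <= level_count k B w)%E.
Proof. by apply: esum_ge0. Qed.

Lemma level_countS k B w : level_count k.+1 B w =
  (\esum_(u in [set u | size u = k]) Defs.count (fun j => N (rcons u j)) B w)%E.
Proof.
transitivity (\esum_(u in [set u | size u = k])
    \esum_(j in [set: nat]) (\1_(hits N (rcons u j) B) w)%:E : \bar R)%E; last first.
  by apply: eq_esum => u _; apply: eq_esum => j _; rewrite -hits_indic.
rewrite esum_esum//; apply: (@reindex_esum _ _ _ _ _ (fun p => rcons p.1 p.2)); split.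
- by move=> [u j] [/= uk _]; rewrite size_rcons uk.
- by move=> [u j] [v i] _ _ /= /rcons_inj[-> ->].
- move=> v /=; elim/last_ind: v => // v j _; rewrite size_rcons => -[vk].
  by exists (v, j) => //; split.
Qed.

Lemma extended_nat_sum (n : nat) (a : nat -> bool) :
  exists c : nat, (\sum_(0 <= k < n) ((a k)%:R%:E : \bar R) = c%:R%:E)%E.
Proof.
elim: n => [|n [c IH]]; first by exists 0%N; rewrite big_geq.
by exists (c + a n)%N; rewrite big_nat_recr//= IH -EFinD natrD.
Qed.

(** If the sum is finite, its partial sums are bounded integers, hence eventually
    constant. *)
Lemma extended_nat_esum (I : countType) (S : set I) (a : I -> bool) :
  extended_nat (\esum_(i in S) ((a i)%:R%:E : \bar R))%E.
Proof.
rewrite esum_countable//.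
set b := fun k => along_pickle false (fun i => (i \in S) && a i) k.
rewrite (_ : along_pickle _ _ = (fun k => (b k)%:R%:E)); last first.
  apply/funext => k; rewrite /b /along_pickle; case: pickle_inv => // i.
  by case: (i \in S).
have [->|sfin] := eqVneq (\sum_(k <oo) ((b k)%:R%:E : \bar R))%E +oo%E; first by left.
right.
have nds : nondecreasing_seq (fun n => \sum_(0 <= k < n) ((b k)%:R%:E : \bar R))%E.
  by move=> m n mn; apply: lee_sum_nneg_natr => // k _ _; rewrite lee_fin.
pose c n := xget 0%N [set c : nat | (\sum_(0 <= k < n) ((b k)%:R%:E : \bar R) = c%:R%:E)%E].
have cE n : (\sum_(0 <= k < n) ((b k)%:R%:E : \bar R) = (c n)%:R%:E)%E.
  rewrite /c; case: xgetP => [m _ //|nope].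
  by have [m /nope] := extended_nat_sum n b.
have sge n : (\sum_(0 <= k < n) ((b k)%:R%:E : \bar R) <= \sum_(k <oo) ((b k)%:R%:E))%E.
  by apply: nneseries_lim_ge => k _; rewrite lee_fin.
have [M cM] : exists M, forall n, (c n <= M)%N.
  have : (\sum_(k <oo) ((b k)%:R%:E : \bar R))%E \is a fin_num.
    by rewrite ge0_fin_numE ?ltey// nneseries_ge0// => k _ _; rewrite lee_fin.
  move=> /fineK fE; exists (Num.bound (fine (\sum_(k <oo) ((b k)%:R%:E : \bar R))%E)) => n.
  rewrite -(ler_nat R); apply/ltW; apply: le_lt_trans (archi_boundP _); last first.
    by rewrite fine_ge0// nneseries_ge0// => k _ _; rewrite lee_fin.
  by rewrite -lee_fin fE -cE.
have cnd m n : (m <= n)%N -> (c m <= c n)%N.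
  by move=> /nds; rewrite !cE lee_fin ler_nat.
have [n0 n0max] : exists n0, forall n, (c n <= c n0)%N.
  have ex0 : exists m, `[< exists n, c n = m >] by exists (c 0%N); apply/asboolP; exists 0%N.
  have bd m : `[< exists n, c n = m >] -> (m <= M)%N by move=> /asboolP[n <-].
  case: (ex_maxnP ex0 bd) => m /asboolP[n0 n0m] mmax; exists n0 => n.
  by rewrite n0m; apply: mmax; apply/asboolP; exists n.
exists (c n0); apply/cvg_lim => //.
apply: cvg_near_cst; near=> n.
rewrite cE; congr (_%:R%:E); apply/eqP; rewrite eqn_leq n0max/=.
by apply: cnd; near: n; exists n0.
Unshelve. all: by end_near. Qed.

Lemma level_count_extended_nat k B w : extended_nat (level_count k B w).
Proof.
rewrite /level_count.
under eq_esum => u _ do rewrite indicE.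
exact: extended_nat_esum.
Qed.

Lemma count_extended_nat {I : countType} (N' : I -> Omega -> option (R * A)) B w :
  extended_nat (Defs.count N' B w).
Proof.
rewrite /Defs.count (_ : \esum_(u in _) _ = \esum_(u in [set: I])
    ((`[< exists2 p, N' u w = Some p & B p >])%:R%:E))%E; last first.
  by apply: eq_esum => u _; rewrite point_indic; case: asboolP.
exact: extended_nat_esum.
Qed.

End point_processes.

Lemma count_mean d (Omega : measurableType d) (R : realType) (P : probability Omega R)
    dA (A : measurableType dA) (N : seq nat -> Omega -> option (R * A)) B :
  (forall u, measurable (hits N u B)) ->
  (\int[P]_w Defs.count N B w = \esum_(u in [set: seq nat]) P (hits N u B))%E.
Proof.
move=> mH; transitivity (\int[P]_w \esum_(u in [set: seq nat]) (\1_(hits N u B) w)%:E)%E.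
  by apply: eq_integral => w _; apply: eq_esum => u _; rewrite -hits_indic.
rewrite integral_esum//; first by apply: eq_esum => u _; rewrite integral_indic ?setIT//.
by move=> u; apply/measurable_EFinP; exact: measurable_indic.
Qed.

(** * Laplace transform of a generation given the past *)

Section hawkes_laplace.
Context {d} {Omega : measurableType d} {R : realType} (P : probability Omega R).
Context {dA} {A : measurableType dA} (F : probability A R).
Variables (h : R * A -> R) (N : seq nat -> Omega -> option (R * A)).
Hypotheses (mh : measurable_fun [set p : R * A | 0 < p.1] h)
  (h0 : forall t a, 0 < t -> 0 <= h (t, a)).
Hypothesis mhits : forall u B, measurable B -> measurable (hits N u B).

Lemma history_measurable n E : history N n E -> measurable E.
Proof.
apply: smallest_sub; first exact: sigma_algebra_measurable.
by move=> _ [u [B [_ mB ->]]]; exact: mhits.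
Qed.

Lemma measurable_hits_indic u B : measurable B ->
  measurable_fun setT (fun w => (\1_(hits N u B) w)%:E : \bar R).
Proof. by move=> mB; apply/measurable_EFinP; apply: measurable_indic; exact: mhits. Qed.

Lemma measurable_level_count k B : measurable B ->
  measurable_fun setT (level_count N k B).
Proof. by move=> mB; apply: measurable_esum => // u; exact: measurable_hits_indic. Qed.

Lemma measurable_count_children u B : measurable B ->
  measurable_fun setT (Defs.count (fun j => N (rcons u j)) B).
Proof.
move=> mB; rewrite /Defs.count (_ : (fun w => _) = (fun w =>
    \esum_(j in [set: nat]) (\1_(hits N (rcons u j) B) w)%:E)%E); last first.
  by apply/funext => w; apply: eq_esum => j _; rewrite -hits_indic.
by apply: measurable_esum => // j; exact: measurable_hits_indic.
Qed.

Lemma measurable_at_label u (G : R * A -> \bar R) : measurable_fun setT G ->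
  measurable_fun setT (fun w => if N u w is Some p then G p else 0%E).
Proof.
move=> mG _ Y mY; rewrite setTI.
have mGY : measurable (G @^-1` Y) by rewrite -[X in measurable X]setTI; exact: mG.
rewrite (_ : _ @^-1` _ = hits N u (G @^-1` Y) `|`
   (if 0%E \in Y then ~` hits N u setT else set0)); last first.
  apply/seteqP; split => w /=; rewrite /hits/=.
    case E : (N u w) => [p|] H; first by left; exists p.
    by right; rewrite mem_set// => -[p]; rewrite E.
  case=> [[p -> //]|]; case: ifPn => // /set_mem Y0 /=.
  by case: (N u w) => // p; elim; exists p.
apply: measurableU; first exact: mhits.
by case: ifPn => // _; apply: measurableC; exact: mhits.
Qed.

Variables (I : set R) (C : set A).
Hypotheses (mI : measurable I) (mC : measurable C).

Let off u w := offspring_intensity F h (N u w) (I `*` C).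
Let cnt u := Defs.count (fun j => N (rcons u j)) (I `*` C).

Let mIC : measurable (I `*` C). Proof. exact: measurableX. Qed.

Lemma measurable_off u : measurable_fun setT (off u).
Proof.
rewrite (_ : off u = (fun w => if N u w is Some p
  then offspring_intensity F h (Some p) (I `*` C) else 0%E)); last first.
  by apply/funext => w; rewrite /off; case: (N u w).
by apply: measurable_at_label; exact: measurable_offspring_intensity.
Qed.

Let off0 u w : (0 <= off u w)%E. Proof. exact: offspring_intensity_ge0. Qed.

Let cnt0 u w : (0 <= cnt u w)%E.
Proof. by apply: esum_ge0 => j _; case: (N _ w) => // p; exact: measure_ge0. Qed.

Hypothesis cpo : conditionally_poisson_offspring P F h N.

Let prescribed (us : seq (seq nat)) (c : seq nat -> nat) : set Omega :=
  [set w | {in us, forall u, cnt u w = (c u)%:R%:E}].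

Let mprescribed us c : measurable (prescribed us c).
Proof.
rewrite /prescribed (_ : [set _ | _] = \big[setI/setT]_(u <- us)
    (cnt u @^-1` [set (c u)%:R%:E])); last first.
  elim: us => [|u us IH]; first by rewrite big_nil; apply/seteqP; split.
  rewrite big_cons -IH; apply/seteqP; split => w /=.
    by move=> H; split; [apply: H; rewrite mem_head|move=> v vus; apply: H; rewrite inE vus orbT].
  by move=> [Hu Hus] v; rewrite inE => /predU1P[->//|]; exact: Hus.
apply: big_ind => //; first exact: measurableI.
move=> u _; rewrite -[X in measurable X]setTI.
by apply: measurable_count_children => //; exact: emeasurable_set1.
Qed.

(** The hypothesis on the offspring prescribes their numbers; a label passes from the
    prescribed ones, [us2], to the Laplace-transformed ones, [us1], by a summation over
    its number of offspring. *)
Let laplace_labels n E t us1 us2 c : history N n E -> 0 < t -> uniq (us1 ++ us2) ->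
  {in us1 ++ us2, forall u, size u = n.+1} ->
  (\int[P]_(w in E) ((\prod_(u <- us1) nexp (t%:E * cnt u w)) * \1_(prescribed us2 c) w)%:E =
   \int[P]_(w in E) ((\prod_(u <- us1) nexp ((1 - expR (- t))%:E * off u w)) *
      \prod_(u <- us2) poisson_mass (off u w) (c u))%:E)%E.
Proof.
move=> HE t0; have mE := history_measurable HE.
have e0 : 0 <= 1 - expR (- t) by rewrite subr_ge0 expR_le1 oppr_le0 ltW.
elim: us1 us2 c => [|u us1 IH] us2 c.
  move=> us2u us2n.
  under eq_integral do rewrite big_nil mul1r.
  under [RHS]eq_integral do rewrite big_nil mul1r.
  rewrite integral_indic// setIC.
  have := @cpo n E us2 1%N (fun _ _ => I `*` C) (fun u _ => c u) HE us2u us2n.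
  move=> /(_ (fun _ _ => mIC)).
  have -> : [set w | {in us2, forall u (j : 'I_1), Defs.count (fun k => N (rcons u k)) (I `*` C) w
      = (c u)%:R%:E}] = prescribed us2 c.
    apply/seteqP; split => w /= H u ?; first exact: (H u _ ord0).
    by move=> _; exact: H.
  move=> H; apply: etrans (H _) _; first by move=> v i j _ _ _; rewrite (ord1 i) (ord1 j).
  by apply: eq_integral => w _; congr _%:E; apply: eq_bigr => v _; rewrite big_ord1.
move=> uniq_us us_n.
pose c' k v := if v == u then k else c v.
have u2 : u \notin us2.
  by move: uniq_us => /= /andP[]; rewrite mem_cat negb_or => /andP[].
have uniq' : uniq (us1 ++ u :: us2).
  by rewrite -[u :: us2]cat1s uniq_catCA.
have n' : {in us1 ++ u :: us2, forall v, size v = n.+1}.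
  move=> v; rewrite mem_cat inE => H; apply: us_n; rewrite inE mem_cat.
  by move: H; rewrite orbCA.
have mprodc s : measurable_fun setT (fun w => \prod_(v <- s) nexp (t%:E * cnt v w)).
  by apply: measurable_prod => v _; apply: measurable_nexpM; exact: measurable_count_children.
have mprodo s : measurable_fun setT (fun w => \prod_(v <- s) nexp ((1 - expR (- t))%:E * off v w)).
  by apply: measurable_prod => v _; apply: measurable_nexpM; exact: measurable_off.
have mpm s k : measurable_fun setT (fun w => \prod_(v <- s) poisson_mass (off v w) (c' k v)).
  apply: measurable_prod => v _.
  by apply: measurableT_comp (measurable_poisson_mass _) (measurable_off _).
transitivity (\int[P]_(w in E) (\sum_(k <oo) ((expR (- t * k%:R) *
   ((\prod_(v <- us1) nexp (t%:E * cnt v w)) * \1_(prescribed (u :: us2) (c' k)) w))%:E)))%E.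
  apply: eq_integral => w _; rewrite big_cons.
  transitivity ((((\prod_(v <- us1) nexp (t%:E * cnt v w)) * \1_(prescribed us2 c) w)%:E *
      (nexp (t%:E * cnt u w))%:E))%E.
    by rewrite -EFinM; congr _%:E; ring.
  rewrite -extended_nat_nexp//; last exact: count_extended_nat.
  rewrite -nneseriesZl; last by move=> k _; rewrite lee_fin mulr_ge0 ?expR_ge0.
  apply: eq_eseriesr => k _; rewrite -EFinM; congr _%:E.
  rewrite mulrCA; congr *%R; rewrite -mulrA; congr *%R.
  rewrite !indicE -natrM mulnb; congr (nat_of_bool _)%:R.
  apply/andP/idP => [[/set_mem Dw /eqP Cw]|/set_mem Dw].
    apply/mem_set => v; rewrite inE /c' => /predU1P[->|vus]; first by rewrite eqxx.
    by case: eqP => [->//|_]; exact: Dw.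
  split; last by rewrite (Dw u) ?mem_head// /c' eqxx.
  apply/mem_set => v vus; rewrite Dw ?inE ?vus ?orbT// /c'.
  by case: eqP vus => // ->; rewrite (negbTE u2).
rewrite integral_nneseries//; last 2 first.
- move=> k; apply: measurable_funTS; apply/measurable_EFinP.
  by apply: measurable_funM => //; apply: measurable_funM => //; exact: measurable_indic.
- move=> k w _; rewrite lee_fin mulr_ge0 ?expR_ge0// mulr_ge0// prodr_ge0// => v _.
  exact: nexp_ge0.
transitivity (\sum_(k <oo) \int[P]_(w in E) (expR (- t * k%:R) *
    ((\prod_(v <- us1) nexp ((1 - expR (- t))%:E * off v w)) *
      \prod_(v <- u :: us2) poisson_mass (off v w) (c' k v)))%:E)%E.
  apply: eq_eseriesr => k _.
  under eq_integral do rewrite EFinM.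
  under [RHS]eq_integral do rewrite EFinM.
  have ek : (0 <= (expR (- t * k%:R))%:E :> \bar R)%E by rewrite lee_fin expR_ge0.
  have mX : measurable_fun E (fun w => ((\prod_(v <- us1) nexp (t%:E * cnt v w)) *
      \1_(prescribed (u :: us2) (c' k)) w)%:E).
    apply: measurable_funTS; apply/measurable_EFinP.
    by apply: measurable_funM => //; exact: measurable_indic.
  have mY : measurable_fun E (fun w => ((\prod_(v <- us1) nexp ((1 - expR (- t))%:E * off v w)) *
      \prod_(v <- u :: us2) poisson_mass (off v w) (c' k v))%:E).
    by apply: measurable_funTS; apply/measurable_EFinP; apply: measurable_funM.
  rewrite (ge0_integralZl _ mE mX _ ek); last first.
    by move=> w _; rewrite lee_fin mulr_ge0// prodr_ge0// => v _; exact: nexp_ge0.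
  rewrite [RHS](ge0_integralZl _ mE mY _ ek); last first.
    move=> w _; rewrite lee_fin mulr_ge0// prodr_ge0// => v _; first exact: nexp_ge0.
    exact: poisson_mass_ge0.
  by rewrite IH.
rewrite -integral_nneseries//; last 2 first.
- move=> k; apply: measurable_funTS; apply/measurable_EFinP.
  by apply: measurable_funM => //; apply: measurable_funM.
- move=> k w _; rewrite lee_fin mulr_ge0 ?expR_ge0// mulr_ge0// prodr_ge0// => v _.
    exact: nexp_ge0.
  exact: poisson_mass_ge0.
apply: eq_integral => w _.
transitivity ((((\prod_(v <- us1) nexp ((1 - expR (- t))%:E * off v w)) *
     \prod_(v <- us2) poisson_mass (off v w) (c v))%:E *
    (nexp ((1 - expR (- t))%:E * off u w))%:E))%E; last first.
  by rewrite -EFinM big_cons; congr _%:E; ring.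
rewrite -poisson_laplace// -nneseriesZl; last first.
  by move=> k _; rewrite lee_fin mulr_ge0 ?expR_ge0// poisson_mass_ge0.
apply: eq_eseriesr => k _; rewrite -EFinM; congr _%:E.
rewrite big_cons {1}/c' eqxx.
have -> : \prod_(v <- us2) poisson_mass (off v w) (c' k v) =
    \prod_(v <- us2) poisson_mass (off v w) (c v).
  apply: eq_big_seq => v vus; rewrite /c'; case: eqP => // vu.
  by case/negP: u2; rewrite -vu.
by ring.
Qed.

Definition level_rate (k : nat) (B : set (R * A)) (w : Omega) : \bar R :=
  (\esum_(u in [set u | size u = k]) offspring_intensity F h (N u w) B)%E.

(** Given the past, the offspring of the events of a level are independent Poisson
    processes, so the Laplace transforms multiply and the intensities add up. The
    infinite family of labels is reached by bounded convergence. *)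
Lemma level_laplace n E (t : R) : history N n E -> 0 < t ->
  (\int[P]_(w in E) (nexp (t%:E * level_count N n.+2 (I `*` C) w))%:E =
   \int[P]_(w in E) (nexp ((1 - expR (- t))%:E * level_rate n.+1 (I `*` C) w))%:E)%E.
Proof.
move=> HE t0; have mE := history_measurable HE.
have e0 : 0 <= 1 - expR (- t) by rewrite subr_ge0 expR_le1 oppr_le0 ltW.
pose S := [set u : seq nat | size u = n.+1].
have cvg_labels (s : R) (a : seq nat -> Omega -> \bar R) : 0 <= s ->
    (forall u, measurable_fun setT (a u)) -> (forall u w, (0 <= a u w)%E) ->
    (\int[P]_(w in E) (\prod_(u <- enum_upto S K) nexp (s%:E * a u w))%:E @[K --> \oo] -->
     \int[P]_(w in E) (nexp (s%:E * \esum_(u in S) a u w))%:E)%E.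
  move=> s0 ma a0.
  have sa0 u w : (0 <= s%:E * a u w)%E by rewrite mule_ge0.
  have -> : (fun K => \int[P]_(w in E) (\prod_(u <- enum_upto S K) nexp (s%:E * a u w))%:E)%E
    = (fun K => \int[P]_(w in E) (nexp (s%:E * \sum_(u <- enum_upto S K) a u w))%:E)%E.
    apply/funext => K; apply: eq_integral => w _.
    by rewrite ge0_sume_distrr// nexp_sum.
  have ge0s K w : (0 <= \sum_(u <- enum_upto S K) a u w)%E by apply: sume_ge0.
  apply: bounded_convergence => //.
  - by move=> K; apply: measurable_nexpM; apply: emeasurable_sum.
  - by apply: measurable_nexpM; exact: measurable_esum.
  - by move=> K w; rewrite nexp_ge0 nexp_le1// mule_ge0.
  - move=> w; apply: nexp_cvg.
    + by move=> K; rewrite mule_ge0.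
    + by move=> m k mk; apply: lee_wpmul2l; rewrite ?lee_fin//; exact: enum_upto_sum_nd.
    + apply: cvgeZl => //; exact: enum_upto_sum_cvg.
have cL := cvg_labels t cnt (ltW t0) (fun u => measurable_count_children u mIC) cnt0.
have cR := cvg_labels _ off e0 measurable_off off0.
rewrite (_ : (fun w => _) = fun w => (nexp (t%:E * \esum_(u in S) cnt u w))%:E)%E; last first.
  by apply/funext => w; rewrite level_countS.
rewrite -(cvg_lim (@ereal_hausdorff R) cL) -(cvg_lim (@ereal_hausdorff R) cR).
apply/congr_lim/funext => K.
have := @laplace_labels n E t (enum_upto S K) [::] (fun=> 0%N) HE t0.
rewrite cats0 => /(_ (enum_upto_uniq _ _) (fun u => @enum_upto_sub _ _ _ u)).
have -> : prescribed [::] (fun=> 0%N) = setT by apply/seteqP; split.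
under eq_integral do rewrite indicT mulr1.
by under [RHS]eq_integral do rewrite big_nil mulr1.
Qed.

End hawkes_laplace.

(** * Immigrants *)

Section immigrants.
Context {d} {Omega : measurableType d} {R : realType} (P : probability Omega R).
Context {dA} {A : measurableType dA} (F : probability A R) (nu : R).
Variables (Gamma : nat -> Omega -> R) (A0 : nat -> Omega -> A).
Hypotheses (nu0 : 0 < nu) (imm : immigrants P F nu Gamma A0).

Definition immigrant_count (B : set (R * A)) : Omega -> \bar R :=
  Defs.count (fun i w => Some (Gamma i w, A0 i w)) B.

Lemma immigrant_intensity_ge0 B : (0 <= immigrant_intensity F nu B)%E.
Proof. by rewrite mule_ge0// lee_fin ltW. Qed.

Lemma immigrant_intensity_setX (I : set R) (C : set A) (T : R) : 0 <= T ->
  I `&` `[0, +oo[ = `[0, T]%classic -> measurable C ->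
  immigrant_intensity F nu (I `*` C) = ((nu * T)%:E * F C)%E.
Proof.
move=> T0 IT mC; rewrite /immigrant_intensity.
rewrite (_ : _ `&` _ = `[0, T]%classic `*` C); last first.
  rewrite -IT; apply/seteqP; split => -[s a] /=; first by move=> [[]]; tauto.
  by move=> [[]]; tauto.
rewrite product_measure1E//.
have lebT : @lebesgue_measure R `[0, T]%classic = T%:E.
  rewrite lebesgue_measure_itv/= lte_fin; have [->|T0'] := eqVneq T 0; first by rewrite ltxx.
  by rewrite lt_neqAle eq_sym T0' T0 sube0.
transitivity (nu%:E * (T%:E * F C))%E; last by rewrite muleA -EFinM.
by congr (_ * (_ * _))%E.
Qed.

Lemma immigrant_count_ge0 B w : (0 <= immigrant_count B w)%E.
Proof. by apply: esum_ge0. Qed.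

Lemma immigrant_countE B w : immigrant_count B w =
  (\esum_(i in [set: nat]) (\1_[set w | B (Gamma i w, A0 i w)] w)%:E)%E.
Proof.
apply: eq_esum => i _; rewrite diracE indicE; congr ((nat_of_bool _)%:R%:E).
Qed.

Lemma measurable_immigrant_event i B : measurable B ->
  measurable [set w | B (Gamma i w, A0 i w)].
Proof.
move=> mB; case: imm => mG mA _.
rewrite -[X in measurable X]setTI.
have : measurable_fun setT (fun w => (Gamma i w, A0 i w)).
  by apply/measurable_fun_pairP; split; [exact: mG|exact: mA].
by apply.
Qed.

Lemma measurable_immigrant_count B : measurable B ->
  measurable_fun setT (immigrant_count B).
Proof.
move=> mB; rewrite (funext (immigrant_countE B)).
apply: measurable_esum => // i; apply/measurable_EFinP; apply: measurable_indic.
exact: measurable_immigrant_event.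
Qed.

Lemma immigrant_count_law B c : measurable B ->
  P [set w | immigrant_count B w = c%:R%:E] =
  (poisson_mass (immigrant_intensity F nu B) c)%:E.
Proof.
move=> mB; case: imm => _ _ /(_ 1%N (fun=> B) (fun=> c)).
rewrite big_ord1 => <-//; last by move=> i j _ _ _; rewrite (ord1 i) (ord1 j).
by congr (P _); apply/seteqP; split => w //= /(_ ord0).
Qed.

Lemma measurable_immigrant_count_eq B c : measurable B ->
  measurable [set w | immigrant_count B w = c%:R%:E].
Proof.
move=> mB; rewrite -[X in measurable X]setTI.
exact: (measurable_immigrant_count mB measurableT (emeasurable_set1 _)).
Qed.

Lemma immigrant_laplace B (t : R) : measurable B -> 0 < t ->
  (\int[P]_w (nexp (t%:E * immigrant_count B w))%:E =
   \int[P]_w (nexp ((1 - expR (- t))%:E * immigrant_intensity F nu B))%:E)%E.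
Proof.
move=> mB t0; rewrite integral_cst//= probability_setT mule1.
rewrite -poisson_laplace ?immigrant_intensity_ge0//.
transitivity (\int[P]_w (\sum_(c <oo) (expR (- t * c%:R) *
    \1_[set w | immigrant_count B w = c%:R%:E] w)%:E))%E.
  apply: eq_integral => w _; rewrite -extended_nat_nexp//; last exact: count_extended_nat.
  apply: eq_eseriesr => c _; congr (_ * _)%:E; rewrite indicE.
  by congr ((nat_of_bool _)%:R); apply/eqP/idP => [?|/set_mem//]; exact/mem_set.
have mc c := measurable_immigrant_count_eq c mB.
have c0 (c : nat) : (0 <= (expR (- t * c%:R))%:E :> \bar R)%E by rewrite lee_fin expR_ge0.
have mi c : measurable_fun setT
    (fun w => (\1_[set w | immigrant_count B w = c%:R%:E] w)%:E : \bar R).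
  by apply/measurable_EFinP; exact: measurable_indic.
rewrite integral_nneseries//.
- apply: eq_eseriesr => c _; under eq_integral do rewrite EFinM.
  rewrite ge0_integralZl//.
  by rewrite integral_indic// setIT EFinM; congr *%E; exact: immigrant_count_law.
- by move=> c; under eq_fun do rewrite EFinM; exact: measurable_funeM.
Qed.

Lemma immigrant_mean B : measurable B ->
  (\int[P]_w immigrant_count B w = immigrant_intensity F nu B)%E.
Proof.
move=> mB; rewrite (@laplace_mean _ _ _ P setT _ (fun=> immigrant_intensity F nu B))//.
- by rewrite integral_cst//= probability_setT mule1.
- exact: measurable_immigrant_count.
- by move=> w; exact: immigrant_count_ge0.
- by move=> w; exact: immigrant_intensity_ge0.
- by move=> t t0; exact: immigrant_laplace.
Qed.

(** A second moment of the Poisson law, which bounds the number of pairs of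
    immigrants. The count is infinite on a null set, where the series is not its
    square. *)
Lemma immigrant_square B (r : R) : measurable B -> immigrant_intensity F nu B = r%:E ->
  (\int[P]_w (immigrant_count B w * immigrant_count B w) = (r + r ^+ 2)%:E)%E.
Proof.
move=> mB Br; have r0 : 0 <= r by rewrite -lee_fin -Br immigrant_intensity_ge0.
have mC := measurable_immigrant_count mB.
have C0 := immigrant_count_ge0 B.
have mc c := measurable_immigrant_count_eq c mB.
have Cint : P.-integrable setT (immigrant_count B).
  apply/integrableP; split => //.
  under eq_integral do rewrite gee0_abs//.
  by rewrite immigrant_mean// Br ltry.
rewrite -poisson_square// -Br.
have mi c : measurable_fun setT
    (fun w => (\1_[set w | immigrant_count B w = c%:R%:E] w)%:E : \bar R).
  by apply/measurable_EFinP; exact: measurable_indic.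
transitivity (\int[P]_w (\sum_(c <oo) ((c%:R ^+ 2)%:E *
    (\1_[set w | immigrant_count B w = c%:R%:E] w)%:E)))%E; last first.
  rewrite integral_nneseries//.
  - apply: eq_eseriesr => c _; rewrite ge0_integralZl//.
    by rewrite integral_indic// setIT [RHS]EFinM; congr *%E; exact: immigrant_count_law.
  - by move=> c; exact: measurable_funeM.
apply: ae_eq_integral => //.
- exact: emeasurable_funM.
- apply: ge0_emeasurable_sum => [c w _ _|c _]; first by rewrite mule_ge0// lee_fin.
  exact: measurable_funeM.
apply: filterS (integrable_ae measurableT Cint) => w /(_ I) Cfin _.
have [Cy|[c Cc]] := count_extended_nat (fun i w => Some (Gamma i w, A0 i w)) B w.
  by move: Cfin; rewrite /immigrant_count Cy.
have CcE : immigrant_count B w = c%:R%:E by [].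
rewrite (nneseriesD1 (n := c))//.
rewrite eseries0 ?adde0; last first.
  move=> i _ /= ic; rewrite indicE memNset ?mule0//; last by rewrite /= CcE => -[] /eqP; rewrite eqr_nat eq_sym (negbTE ic).
by rewrite indicE mem_set// mule1 CcE -EFinM expr2.
Qed.

End immigrants.

(** * Marks of the events of a generation *)

Section marks.
Context {d} {Omega : measurableType d} {R : realType} (P : probability Omega R).
Context {dA} {A : measurableType dA} (F : probability A R).
Variable N : seq nat -> Omega -> option (R * A).
Hypothesis mhits : forall u B, measurable B -> measurable (hits N u B).
Variables (J : set R) (k : nat) (c : \bar R).
Hypotheses (mJ : measurable J) (c0 : (0 <= c)%E).
Hypothesis level : forall C : set A, measurable C ->
  (\int[P]_w level_count N k (J `*` C) w = c * F C)%E.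

Let at_label (g : A -> \bar R) u w : \bar R :=
  (if N u w is Some p then g p.2 * (\1_J p.1)%:E else 0)%E.

Let mat (g : A -> \bar R) u : measurable_fun setT g -> measurable_fun setT (at_label g u).
Proof.
move=> mg; apply: (measurable_at_label mhits u (_ : measurable_fun setT (fun p => g p.2 * (\1_J p.1)%:E)%E)).
apply: emeasurable_funM.
  by apply: measurableT_comp.
apply/measurable_EFinP; apply: measurableT_comp; [exact: measurable_indic|exact: measurable_fst].
Qed.

Let at0 (g : A -> \bar R) u w : (forall a, 0 <= g a)%E -> (0 <= at_label g u w)%E.
Proof. by move=> g0; rewrite /at_label; case: (N u w) => // p; rewrite mule_ge0// lee_fin. Qed.

Let level_hits (C : set A) : measurable C ->
  (\esum_(u in [set u | size u = k]) P (hits N u (J `*` C)) = c * F C)%E.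
Proof.
move=> mC; rewrite -level// /level_count integral_esum//.
- apply: eq_esum => u _; rewrite integral_indic ?setIT//.
  by apply: mhits; exact: measurableX.
- by move=> u; apply: measurable_hits_indic => //; exact: measurableX.
Qed.

Import HBNNSimple.

Let level_nnsfun (g : {nnsfun A >-> R}) :
  (\esum_(u in [set u | size u = k]) \int[P]_w at_label (EFin \o g) u w =
   c * \int[F]_a (g a)%:E)%E.
Proof.
have mgy y : measurable (g @^-1` [set y]) by [].
have mJgy y : measurable (J `*` g @^-1` [set y]) by exact: measurableX.
pose r := fset_set (range g).
have r0 y : y \in r -> 0 <= y.
  by rewrite in_fset_set// => /set_mem[a _ <-].
have gneg y : y < 0 -> g @^-1` [set y] = set0.
  move=> y0; apply/seteqP; split => // a /= gay.
  by move: y0; rewrite -gay ltNge fun_ge0.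
have yF y : (0 <= y%:E * F (g @^-1` [set y]))%E.
  have [y0|y0] := leP 0 y; first by rewrite mule_ge0// lee_fin.
  by rewrite gneg// measure0 mule0.
have yP u y : (0 <= y%:E * P (hits N u (J `*` g @^-1` [set y])))%E.
  have [y0|y0] := leP 0 y; first by rewrite mule_ge0// lee_fin.
  rewrite gneg// setX0 (_ : hits N u set0 = set0) ?measure0 ?mule0//.
  by apply/seteqP; split => // w [].
rewrite (@eq_esum _ _ _ _ (fun u => \sum_(y <- r) y%:E * P (hits N u (J `*` g @^-1` [set y])))%E).
  rewrite esum_sum; last by move=> u y _ _; exact: yP.
  rewrite integral_nnsfun// patch_setT sintegralE fsbig_finite//= ge0_sume_distrr; last first.
    by move=> y _; exact: yF.
  rewrite big_seq [RHS]big_seq; apply: eq_bigr => y yr.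
  by rewrite esumZl ?r0// level_hits// muleCA.
move=> u _; rewrite (@eq_integral _ _ _ _ _ (fun w =>
  \sum_(y <- r) y%:E * (\1_(hits N u (J `*` g @^-1` [set y])) w)%:E)%E); last first.
  move=> w _; rewrite /at_label.
  case E : (N u w) => [p|]; last first.
    rewrite big1// => y _; rewrite indicE memNset ?mule0//.
    by rewrite /hits/= E => -[].
  rewrite /= -EFinM (fimfunE g) fsbig_finite//= mulr_suml -sumEFin.
  apply: eq_bigr => y _; rewrite -EFinM; congr _%:E; rewrite -mulrA; congr *%R.
  rewrite !indicE -natrM mulnb; congr (nat_of_bool _)%:R.
  apply/andP/idP => [[/set_mem gy /set_mem Jp]|/set_mem].
    by apply/mem_set; exists p.
  by rewrite /hits/= E => -[_ [<-] [Jp gy]]; split; exact/mem_set.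
have mh y : measurable_fun setT (fun w => (\1_(hits N u (J `*` g @^-1` [set y])) w)%:E : \bar R).
  exact: measurable_hits_indic.
have hP y w : (0 <= y%:E * (\1_(hits N u (J `*` g @^-1` [set y])) w)%:E :> \bar R)%E.
  have [y0|y0] := leP 0 y; first by rewrite mule_ge0// lee_fin.
  rewrite gneg// setX0 indicE memNset ?mule0//.
  by case.
rewrite ge0_integral_sum//; last by move=> y; exact: measurable_funeM.
rewrite big_seq [RHS]big_seq.
apply: eq_bigr => y yr; rewrite ge0_integralZl ?lee_fin ?r0//.
by rewrite integral_indic ?setIT//; exact: mhits.
Qed.

(** By the hypothesis on rectangles, a mark is independent of the time of its event, as
    far as means are concerned; finite combinations of rectangles give the simple
    functions [g], and monotone approximation the others. *)
Lemma mark_mean (g : A -> \bar R) : measurable_fun setT g -> (forall a, 0 <= g a)%E ->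
  (\int[P]_w (\esum_(u in [set u | size u = k])
     (if N u w is Some p then g p.2 * (\1_J p.1)%:E else 0)) <= c * \int[F]_a g a)%E.
Proof.
move=> mg g0; rewrite integral_esum//; last 2 first.
- by move=> u; exact: mat.
- by move=> u w; exact: at0.
pose gn := nnsfun_approx measurableT mg.
have gn_cvg a : (gn n a)%:E @[n --> \oo] --> g a by apply: cvg_nnsfun_approx => // ? _.
have gn_nd a m n : (m <= n)%N -> ((gn m a)%:E <= (gn n a)%:E)%E.
  by move=> mn; rewrite lee_fin; exact/lefP/nd_nnsfun_approx.
have mgn n : measurable_fun setT (EFin \o gn n) by exact/measurable_EFinP.
have at_cvg u : (\int[P]_w at_label (EFin \o gn n) u w)%E @[n --> \oo] -->
    (\int[P]_w at_label g u w)%E.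
  rewrite (_ : (\int[P]_w at_label g u w)%E =
     (\int[P]_w limn (fun n => at_label (EFin \o gn n) u w))%E); last first.
    apply: eq_integral => w _; apply/esym/cvg_lim => //.
    rewrite /at_label; case: (N u w) => [p|]; last exact: cvg_cst.
    by apply: cvgeZr => //; exact: gn_cvg.
  apply: cvg_monotone_convergence => //.
  - by move=> n; exact: mat.
  - by move=> n w _; apply: at0 => a; rewrite lee_fin.
  - move=> w _ m n mn; rewrite /at_label; case: (N u w) => // p.
    by apply: lee_wpmul2r; [rewrite lee_fin|exact: gn_nd].
have at_ge0 f u : (forall a, 0 <= f a)%E -> (0 <= \int[P]_w at_label f u w)%E.
  by move=> f0; apply: integral_ge0 => w _; exact: at0.
have cL := enum_upto_sum_cvg (S := [set u | size u = k]) (fun u => at_ge0 g u g0).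
rewrite -(cvg_lim (@ereal_hausdorff R) cL); apply: lime_le; first exact: (cvgP _ cL).
apply: nearW => K.
have cK : (\sum_(u <- enum_upto [set u | size u = k] K) \int[P]_w at_label (EFin \o gn n) u w)%E
    @[n --> \oo] --> (\sum_(u <- enum_upto [set u | size u = k] K) \int[P]_w at_label g u w)%E.
  apply: cvg_nnesum => [u _|u _]; last exact: at_cvg.
  by apply: nearW => n; apply: at_ge0 => a; rewrite lee_fin.
rewrite -(cvg_lim (@ereal_hausdorff R) cK); apply: lime_le; first exact: (cvgP _ cK).
apply: nearW => n.
apply: (@le_trans _ _ (c * \int[F]_a (gn n a)%:E)%E); last first.
  apply: lee_wpmul2l => //; apply: ge0_le_integral => //.
  - by move=> a _; rewrite lee_fin; exact: fun_ge0.
  - exact: mgn.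
  - move=> a _; have nd : nondecreasing_seq (fun n => (gn n a)%:E) by move=> ? ?; exact: gn_nd.
    rewrite -(cvg_lim (@ereal_hausdorff R) (gn_cvg a)).
    rewrite (cvg_lim _ (ereal_nondecreasing_cvgn nd))//.
    by apply: ereal_sup_ubound; exists n.
rewrite -level_nnsfun.
have gn0 u : (0 <= \int[P]_w at_label (EFin \o gn n) u w)%E.
  by apply: at_ge0 => a; rewrite lee_fin.
have cn := enum_upto_sum_cvg (S := [set u | size u = k]) gn0.
rewrite -(cvg_lim (@ereal_hausdorff R) cn) (cvg_lim _ (ereal_nondecreasing_cvgn _))//.
  by apply: ereal_sup_ubound; exists K.
exact: enum_upto_sum_nd.
Qed.

End marks.

(** * Uniform integrability through Laplace transforms *)

Section uniformly_linear.
Context {d} {Omega : measurableType d} {R : realType} (P : probability Omega R).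
Implicit Types Y : R -> Omega -> \bar R.

(** A form of the uniform integrability of [Y T / T]. The defect
    [y - (1 - exp (- y))] at [y = th * Y T] is quadratic in [y], hence negligible compared
    with [th * T], as long as [Y T] is of order [T] and [th * T] is small; only the large
    values of [Y T / T] could make its mean comparable with [th * T]. *)
Definition uniformly_linear Y := forall e : R, 0 < e -> exists2 del : R, 0 < del &
  forall T th : R, 1 <= T -> 0 < th -> th * T <= del ->
  (th%:E * \int[P]_w Y T w <=
   \int[P]_w (1 - nexp (th%:E * Y T w))%:E + (e * (th * T))%:E)%E.

Lemma measurable_one_sub_nexpM (c : R) (Y : Omega -> \bar R) : measurable_fun setT Y ->
  measurable_fun setT (fun w => (1 - nexp (c%:E * Y w))%:E).
Proof.
move=> mY; apply/measurable_EFinP; apply: measurable_funB => //; exact: measurable_nexpM.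
Qed.

Lemma one_sub_nexpM_ge0 (c : R) (y : \bar R) : 0 <= c -> (0 <= y)%E ->
  (0 <= (1 - nexp (c%:E * y))%:E :> \bar R)%E.
Proof. by move=> c0 y0; rewrite lee_fin subr_ge0 nexp_le1// mule_ge0. Qed.

Lemma integral_one_sub_nexpM_fin (D : set Omega) (c : R) (Y : Omega -> \bar R) :
  measurable D -> 0 <= c -> measurable_fun setT Y -> (forall w, 0 <= Y w)%E ->
  (\int[P]_(w in D) (1 - nexp (c%:E * Y w))%:E)%E \is a fin_num.
Proof.
move=> mD c0 mY Y0; have i0 := one_sub_nexpM_ge0 c0.
rewrite ge0_fin_numE; last by apply: integral_ge0 => w _; exact: i0.
apply: (@le_lt_trans _ _ (\int[P]_(w in D) (cst 1 w))%E).
  apply: ge0_le_integral => //.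
  - by move=> w _; exact: i0.
  - by apply: measurable_funTS; exact: measurable_one_sub_nexpM.
  - by move=> w _; rewrite lee_fin gerBl nexp_ge0.
rewrite integral_cst//= mul1e; apply: le_lt_trans (probability_le1 P mD) _; exact: ltry.
Qed.

(** The defect [y - (1 - exp (- y))] is monotone and 1-Lipschitz
    ([le_sub_one_sub_nexp]): the one of [Y'] is at most that of [K * Y] plus the small
    mean of [S]. *)
Lemma uniformly_linear_le Y Y' :
  (forall T, measurable_fun setT (Y T)) -> (forall T w, 0 <= Y T w)%E ->
  (forall T, measurable_fun setT (Y' T)) -> (forall T w, 0 <= Y' T w)%E ->
  (forall e : R, 0 < e -> exists (K : R) (S : R -> Omega -> \bar R),
    [/\ 0 < K, forall T, measurable_fun setT (S T), forall T w, (0 <= S T w)%E,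
      forall T, 1 <= T -> (\int[P]_w S T w <= (e * T)%:E)%E
    & forall T w, 1 <= T -> (Y' T w <= K%:E * Y T w + S T w)%E]) ->
  uniformly_linear Y -> uniformly_linear Y'.
Proof.
move=> mY Y0 mY' Y'0 dom UY e e0.
have e20 : 0 < e / 2 by rewrite divr_gt0.
have [K [S [K0 mS S0 ES YKS]]] := dom _ e20.
have eK0 : 0 < e / 2 / K by rewrite divr_gt0.
have [del del0 Hdel] := UY _ eK0; exists (del / K); first by rewrite divr_gt0.
move=> T th T1 th0 thT.
have T0 : 0 < T by lra.
have thK0 : 0 < th * K by rewrite mulr_gt0.
have HY : ((th * K)%:E * \int[P]_w Y T w <=
   \int[P]_w (1 - nexp ((th * K)%:E * Y T w))%:E + (e / 2 * (th * T))%:E)%E.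
  have -> : e / 2 * (th * T) = e / 2 / K * (th * K * T).
    by field; rewrite gt_eqF.
  by apply: Hdel => //; rewrite mulrAC -ler_pdivlMr.
have A_fin := integral_one_sub_nexpM_fin measurableT (ltW thK0) (mY T) (Y0 T).
have m1 : measurable_fun setT (fun w => th%:E * Y' T w)%E by exact: measurable_funeM.
have m2 : measurable_fun setT (fun w => (th * K)%:E * Y T w)%E by exact: measurable_funeM.
have m3 : measurable_fun setT (fun w => th%:E * S T w)%E by exact: measurable_funeM.
have m4 := measurable_one_sub_nexpM (th * K) (mY T).
have m5 := measurable_one_sub_nexpM th (mY' T).
have th0' : (0 <= th%:E :> \bar R)%E by rewrite lee_fin ltW.
have thK0' : (0 <= (th * K)%:E :> \bar R)%E by rewrite lee_fin ltW.
have p1 w : (0 <= th%:E * Y' T w)%E by rewrite mule_ge0.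
have p2 w : (0 <= (th * K)%:E * Y T w)%E by rewrite mule_ge0.
have p3 w : (0 <= th%:E * S T w)%E by rewrite mule_ge0.
have p4 w := one_sub_nexpM_ge0 (ltW thK0) (Y0 T w).
have p5 w := one_sub_nexpM_ge0 (ltW th0) (Y'0 T w).
have int_sum : (\int[P]_w (th%:E * Y' T w + (1 - nexp ((th * K)%:E * Y T w))%:E) <=
    \int[P]_w ((th * K)%:E * Y T w + th%:E * S T w + (1 - nexp (th%:E * Y' T w))%:E))%E.
  apply: ge0_le_integral => //.
  - by move=> w _; rewrite adde_ge0.
  - exact: emeasurable_funD.
  - by apply: emeasurable_funD => //; exact: emeasurable_funD.
  - move=> w _; apply: le_sub_one_sub_nexp => //.
    rewrite EFinM -muleA -ge0_muleDr//; last by rewrite mule_ge0// lee_fin ltW.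
    by apply: (lee_wpmul2l th0'); exact: (YKS T w T1).
have E1 : (\int[P]_w (th%:E * Y' T w + (1 - nexp ((th * K)%:E * Y T w))%:E) =
    th%:E * \int[P]_w Y' T w + \int[P]_w (1 - nexp ((th * K)%:E * Y T w))%:E)%E.
  by rewrite ge0_integralD// ge0_integralZl.
have E2 : (\int[P]_w ((th * K)%:E * Y T w + th%:E * S T w + (1 - nexp (th%:E * Y' T w))%:E) =
    (th * K)%:E * \int[P]_w Y T w + th%:E * \int[P]_w S T w +
    \int[P]_w (1 - nexp (th%:E * Y' T w))%:E)%E.
  rewrite ge0_integralD//; last 2 first.
  - by move=> w _; rewrite adde_ge0.
  - exact: emeasurable_funD.
  by rewrite ge0_integralD// !ge0_integralZl.
rewrite E1 E2 in int_sum.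
have B_fin := integral_one_sub_nexpM_fin measurableT (ltW th0) (mY' T) (Y'0 T).
set A := (\int[P]_w (1 - nexp ((th * K)%:E * Y T w))%:E)%E in A_fin int_sum HY E1.
set B := (\int[P]_w (1 - nexp (th%:E * Y' T w))%:E)%E in B_fin int_sum E2 *.
have HS : (th%:E * \int[P]_w S T w <= (e / 2 * (th * T))%:E)%E.
  apply: (@le_trans _ _ (th%:E * (e / 2 * T)%:E)%E); first by apply: lee_wpmul2l => //; exact: ES.
  by rewrite -EFinM lee_fin mulrCA.
rewrite -(leeD2rE _ _ A_fin).
apply: (le_trans int_sum).
apply: (@le_trans _ _ ((A + (e / 2 * (th * T))%:E) + (e / 2 * (th * T))%:E + B)%E).
  by apply: leeD => //; apply: leeD.
rewrite -(fineK A_fin) -(fineK B_fin) -!EFinD lee_fin.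
lra.
Qed.

End uniformly_linear.

(** * Conditional means of the generations of a Hawkes process *)

Section hawkes_levels.
Context {d} {Omega : measurableType d} {R : realType} (P : probability Omega R).
Context {dA} {A : measurableType dA} (F : probability A R) (nu : R).
Variables (h : R * A -> R) (N : seq nat -> Omega -> option (R * A)).
Hypotheses (nu0 : 0 < nu) (hawkesN : hawkes P F nu h N).
Hypothesis subcritical : (\int[F]_a kappa h a < 1)%E.

Let mh : measurable_fun [set p : R * A | 0 < p.1] h. Proof. by case: hawkesN => -[]. Qed.
Let h0 t a : 0 < t -> 0 <= h (t, a). Proof. by case: hawkesN => -[_ + _ _ _ _]; apply. Qed.
Let mhits u B : measurable B -> measurable (hits N u B).
Proof. by case: hawkesN => _ _ + _ _; apply. Qed.
Let N0 w : N [::] w = None. Proof. by case: hawkesN. Qed.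
Let cpo : conditionally_poisson_offspring P F h N. Proof. by case: hawkesN. Qed.

(** The mean measure of level [k.+1] given the levels up to [k]; the immigrants
    are treated as the offspring of a fictitious level [0]. *)
Definition rate (k : nat) (B : set (R * A)) (w : Omega) : \bar R :=
  if k is 0%N then immigrant_intensity F nu B else level_rate F h N k B w.

Definition past (k : nat) : set_system Omega :=
  if k is n.+1 then history N n else [set setT].

Lemma past_measurable k E : past k E -> measurable E.
Proof. by case: k => [->//|n]; exact: (history_measurable mhits). Qed.

Lemma rate_ge0 k I C w : measurable I -> measurable C -> (0 <= rate k (I `*` C) w)%E.
Proof.
move=> mI mC; case: k => [|k]; first exact: immigrant_intensity_ge0.
by apply: esum_ge0 => u _; exact: offspring_intensity_ge0.
Qed.

Lemma measurable_rate k I C : measurable I -> measurable C ->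
  measurable_fun setT (rate k (I `*` C)).
Proof.
move=> mI mC; case: k => [|k]; first exact: measurable_cst.
apply: measurable_esum => [u|u w]; first exact: measurable_off.
exact: offspring_intensity_ge0.
Qed.

Lemma level_count1E Gamma A0 : (forall i w, N [:: i] w = Some (Gamma i w, A0 i w)) ->
  forall B w, level_count N 1 B w = immigrant_count Gamma A0 B w.
Proof.
move=> NE B w; rewrite level_countS.
rewrite (_ : [set u : seq nat | size u = 0%N] = [set [::]]); last first.
  by apply/seteqP; split => [[]|u ->].
rewrite esum_set1; last by apply: esum_ge0 => j _; case: (N _ w) => // p; exact: measure_ge0.
by apply: eq_esum => j _; rewrite NE.
Qed.

Lemma past_laplace k E (t : R) I C : past k E -> 0 < t -> measurable I -> measurable C ->
  (\int[P]_(w in E) (nexp (t%:E * level_count N k.+1 (I `*` C) w))%:E =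
   \int[P]_(w in E) (nexp ((1 - expR (- t))%:E * rate k (I `*` C) w))%:E)%E.
Proof.
move=> + t0 mI mC; case: k => [->|k HE]; last exact: level_laplace.
case: hawkesN => _ _ _ [Gamma [A0 [imm NE]]] _.
rewrite -(immigrant_laplace nu0 imm)//; last exact: measurableX.
by apply: eq_integral => w _; rewrite (level_count1E NE).
Qed.

Lemma past_setT k : past k setT.
Proof.
case: k => [//|k]; rewrite -[setT]setC0 -setTD.
have [_ H _] := @smallest_sigma_algebra _ (@setT Omega)
  [set E | exists u B, [/\ (size u <= k.+1)%N, measurable B & E = hits N u B]].
by apply: H; case: (@smallest_sigma_algebra _ (@setT Omega) 
  [set E | exists u B, [/\ (size u <= k.+1)%N, measurable B & E = hits N u B]]).
Qed.

Lemma level_mean k I C : measurable I -> measurable C ->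
  (\int[P]_w level_count N k.+1 (I `*` C) w = \int[P]_w rate k (I `*` C) w)%E.
Proof.
move=> mI mC; apply: laplace_mean => //.
- by apply: measurable_level_count => //; exact: measurableX.
- exact: measurable_rate.
- by move=> w; exact: level_count_ge0.
- by move=> w; exact: rate_ge0.
- by move=> t t0; apply: past_laplace => //; exact: past_setT.
Qed.

Lemma level_void k E I C : past k E -> measurable I -> measurable C ->
  P (E `&` [set w | level_count N k.+1 (I `*` C) w = 0%E]) =
  (\int[P]_(w in E) (nexp (rate k (I `*` C) w))%:E)%E.
Proof.
move=> HE mI mC; apply: laplace_void => //.
- exact: past_measurable HE.
- by apply: measurable_level_count => //; exact: measurableX.
- exact: measurable_rate.
- by move=> w; exact: level_count_ge0.
- by move=> w; exact: rate_ge0.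
- by move=> t t0; exact: past_laplace.
- move=> w; have [->|[c ->]] := level_count_extended_nat N k.+1 (I `*` C) w.
    by right; exact: leey.
  by case: c => [|c]; [left|right; rewrite lee_fin ler1n].
Qed.

Lemma rate_setX k (I : set R) C w (T : R) : 0 <= T -> measurable I ->
  I `&` `[0, +oo[ = `[0, T]%classic -> measurable C ->
  (rate k (I `*` C) w = (fine (F C))%:E * rate k (I `*` setT) w)%E.
Proof.
move=> T0 mI IT mC; rewrite fineK ?fin_num_measure//.
case: k => [|k] /=; first by rewrite !(immigrant_intensity_setX F nu T0 IT)//
  probability_setT mule1 muleC.
rewrite /level_rate -[F C]fineK ?fin_num_measure// -esumZl//.
- by apply: eq_esum => u _; rewrite offspring_intensity_setX// fineK ?fin_num_measure// muleC.
- by rewrite fine_ge0.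
- by move=> u; exact: offspring_intensity_ge0.
Qed.

Let m := fine (\int[F]_a kappa h a)%E.

Let kappa_fin : (\int[F]_a kappa h a)%E = m%:E.
Proof.
rewrite /m fineK// ge0_fin_numE; first by rewrite (lt_trans subcritical)// ltry.
by apply: integral_ge0 => a _; exact: kappa_ge0.
Qed.

Lemma m_ge0 : 0 <= m.
Proof. by apply: fine_ge0; apply: integral_ge0 => a _; exact: kappa_ge0. Qed.

Lemma m_lt1 : m < 1. Proof. by rewrite -lte_fin -kappa_fin. Qed.

(** Half lines instead of [0, T]: the parent of an event before [T] is before [T],
    without any exceptional null set. *)
Definition before (T : R) : set R := `]-oo, T]%classic.

Let mbefore T : measurable (before T). Proof. exact: measurable_itv. Qed.

Let before_window T : 0 <= T -> before T `&` `[0, +oo[ = `[0, T]%classic.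
Proof.
by move=> T0; apply/seteqP; split => t; rewrite /before/= !in_itv/= andbT;
  [move=> [-> ->]|move=> /andP[-> ->]].
Qed.

Let outer_rate k T := rate k (before T `*` [set: A]).
Let outer_count k T := level_count N k.+1 (before T `*` [set: A]).

(** For [g := kappa h] this dominates the rate of the next level. *)
Let mark_sum (g : A -> \bar R) k T w : \bar R :=
  (\esum_(u in [set u | size u = k.+1])
     (if N u w is Some p then g p.2 * (\1_(before T) p.1)%:E else 0))%E.

Let mark_sum_mean (g : A -> \bar R) k T : 0 <= T -> measurable_fun setT g ->
  (forall a, 0 <= g a)%E ->
  (\int[P]_w mark_sum g k T w <= \int[P]_w outer_rate k T w * \int[F]_a g a)%E.
Proof.
move=> T0 mg g0; apply: mark_mean => //.
- by apply: integral_ge0 => w _; exact: rate_ge0.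
- move=> C mC; rewrite level_mean//.
  under eq_integral => w _ do rewrite (rate_setX k w T0 (mbefore T) (before_window T0) mC).
  rewrite ge0_integralZl//; last 3 first.
  + exact: measurable_rate.
  + by move=> w _; exact: rate_ge0.
  + by rewrite lee_fin fine_ge0.
  by rewrite fineK ?fin_num_measure// muleC.
Qed.

Let rate_le_mark_sum k T w : (outer_rate k.+1 T w <= mark_sum (kappa h) k T w)%E.
Proof.
apply: le_esum => u _; case: (N u w) => [[t a]|]//.
exact: offspring_intensity_le_kappa.
Qed.

Let measurable_mark_sum g k T : measurable_fun setT g -> (forall a, 0 <= g a)%E ->
  measurable_fun setT (mark_sum g k T).
Proof.
move=> mg g0; apply: measurable_esum => [u|u w]; last first.
  by case: (N u w) => // p; rewrite mule_ge0// lee_fin.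
apply: (measurable_at_label mhits u (_ : measurable_fun setT
  (fun p => g p.2 * (\1_(before T) p.1)%:E)%E)).
apply: emeasurable_funM; first by apply: measurableT_comp.
by apply/measurable_EFinP; apply: measurableT_comp; [exact: measurable_indic|exact: measurable_fst].
Qed.

Let mark_sum_ge0 (g : A -> \bar R) k T w : (forall a, 0 <= g a)%E -> (0 <= mark_sum g k T w)%E.
Proof.
by move=> g0; apply: esum_ge0 => u _; case: (N u w) => // p; rewrite mule_ge0// lee_fin.
Qed.

(** An event has [m] offspring on average, independently of its time. *)
Lemma outer_rate_mean k T : 0 <= T ->
  (\int[P]_w outer_rate k T w <= (nu * T * m ^+ k)%:E)%E.
Proof.
move=> T0; elim: k => [|k IH].
  rewrite expr0 mulr1 /outer_rate /rate.
  have E := immigrant_intensity_setX F nu T0 (before_window T0) (@measurableT _ A).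
  under eq_integral do rewrite E.
  by rewrite integral_cst//= !probability_setT !mule1.
apply: (@le_trans _ _ (\int[P]_w mark_sum (kappa h) k T w)%E).
  apply: ge0_le_integral => //.
  - by move=> w _; exact: rate_ge0.
  - exact: measurable_rate.
  - apply: measurable_mark_sum; [exact: measurable_kappa|exact: kappa_ge0].
apply: le_trans (mark_sum_mean _ T0 _ _) _; [exact: measurable_kappa|exact: kappa_ge0|].
rewrite kappa_fin exprSr mulrA EFinM; apply: lee_wpmul2r => //.
by rewrite lee_fin m_ge0.
Qed.

Let outer_rate_ge0 k T w : (0 <= outer_rate k T w)%E. Proof. exact: rate_ge0. Qed.

Let measurable_outer_rate k T : measurable_fun setT (outer_rate k T).
Proof. exact: measurable_rate. Qed.

Let outer_count_ge0 k T w : (0 <= outer_count k T w)%E. Proof. exact: level_count_ge0. Qed.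

Let measurable_outer_count k T : measurable_fun setT (outer_count k T).
Proof. by apply: measurable_level_count => //; exact: measurableX. Qed.

Let outer_rate_fin k T : 0 <= T -> exists2 l : R, 0 <= l <= nu * T &
  (\int[P]_w outer_rate k T w = l%:E)%E.
Proof.
move=> T0; have le := outer_rate_mean k T0.
have ge : (0 <= \int[P]_w outer_rate k T w)%E by exact: integral_ge0.
exists (fine (\int[P]_w outer_rate k T w)); last first.
  by rewrite fineK// ge0_fin_numE// (le_lt_trans le)// ltry.
have fi : (\int[P]_w outer_rate k T w)%E \is a fin_num.
  by rewrite ge0_fin_numE// (le_lt_trans le)// ltry.
rewrite fine_ge0//= -lee_fin fineK//; apply: le_trans le _.
rewrite lee_fin -[leRHS]mulr1; apply: ler_wpM2l; first by rewrite mulr_ge0// ltW.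
by apply: exprn_ile1; [exact: m_ge0|exact/ltW/m_lt1].
Qed.

Lemma sub_one_sub_expR_le (x : R) : 0 <= x -> x - (1 - expR (- x)) <= x ^+ 2.
Proof.
move=> x0; have := one_sub_expR_ge x0.
rewrite ler_pdivrMr; last by lra.
have : expR (- x) <= 1 by rewrite expR_le1 oppr_le0.
have := expR_ge0 (- x); nra.
Qed.

Let uniformly_linear_immigrants : uniformly_linear P (outer_rate 0).
Proof.
move=> e e0; have n20 : 0 < nu ^+ 2 by rewrite exprn_gt0.
exists (e / nu ^+ 2); first by rewrite divr_gt0.
move=> T th T1 th0 thT; have T0 : 0 <= T by lra.
have E := immigrant_intensity_setX F nu T0 (before_window T0) (@measurableT _ A).
rewrite /outer_rate /rate; under eq_integral do rewrite E probability_setT mule1.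
under [X in (_ <= X + _)%E]eq_integral do rewrite E probability_setT mule1.
rewrite !integral_cst//= !probability_setT !mule1 -EFinM lee_fin.
have nT0 : 0 <= th * (nu * T) by rewrite !mulr_ge0// ltW.
have := sub_one_sub_expR_le nT0.
have : (th * (nu * T)) ^+ 2 <= e * (th * T); last by lra.
have -> : (th * (nu * T)) ^+ 2 = nu ^+ 2 * (th * T) * (th * T) by ring.
apply: ler_wpM2r; first by rewrite mulr_ge0// ltW.
by rewrite mulrC -ler_pdivlMr.
Qed.

(** By [laplace_one_sub], the defect of the count at [th] is that of its conditional
    mean at [1 - exp (- th)], up to [th - (1 - exp (- th))] times the mean. This is of
    order [th ^ 2 * T], and [th] is small because [T >= 1]. *)
Let uniformly_linear_count k : uniformly_linear P (outer_rate k) ->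
  uniformly_linear P (outer_count k).
Proof.
move=> UL e e0; have e20 : 0 < e / 2 by rewrite divr_gt0.
have [del del0 Hdel] := UL _ e20.
have en0 : 0 < e / (2 * nu) by rewrite divr_gt0// mulr_gt0.
exists (Num.min del (e / (2 * nu))); first by rewrite lt_min del0 en0.
move=> T th T1 th0; rewrite le_min => /andP[thd then_].
have T0 : 0 <= T by lra.
have e10 : 0 < 1 - expR (- th) by rewrite subr_gt0 expR_lt1 oppr_lt0.
have e1th : 1 - expR (- th) <= th by have := expR_ge1Dx (- th); lra.
have := Hdel T (1 - expR (- th)) T1 e10; move=> /(_ _).
have -> : ((1 - expR (- th)) * T <= del) = true.
  by apply/idP; apply: le_trans thd; exact: ler_wpM2r.
move=> /(_ isT).
have -> : (\int[P]_w outer_count k T w = \int[P]_w outer_rate k T w)%E by exact: level_mean.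
rewrite -(laplace_one_sub (N := outer_count k T))//; last first.
  by move=> t t0; apply: past_laplace => //; exact: past_setT.
have [l /andP[l0 lT] ->] := outer_rate_fin k T0.
have fA := integral_one_sub_nexpM_fin P measurableT (ltW th0) (measurable_outer_count k T)
  (outer_count_ge0 k T).
rewrite -(fineK fA) -!EFinM -!EFinD !lee_fin.
set a := fine _ => HL.
have sq := sub_one_sub_expR_le (ltW th0).
have thT : 0 <= th * T by rewrite mulr_ge0// ltW.
have h1 : (th - (1 - expR (- th))) * l <= th ^+ 2 * (nu * T).
  by apply: ler_pM => //; rewrite subr_ge0.
have h2 : th ^+ 2 * (nu * T) <= e / 2 * (th * T).
  have -> : th ^+ 2 * (nu * T) = (th * nu) * (th * T) by ring.
  apply: ler_wpM2r => //; rewrite -ler_pdivlMr//.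
  have -> : e / 2 / nu = e / (2 * nu) by field; rewrite gt_eqF.
  by apply: le_trans then_; rewrite ler_peMr// ltW.
have h3 : e / 2 * ((1 - expR (- th)) * T) <= e / 2 * (th * T).
  by apply: ler_wpM2l; [exact: ltW|exact: ler_wpM2r].
lra.
Qed.

Let large_kappa (K : R) a : \bar R := (kappa h a * (\1_[set a | K%:E < kappa h a]%E a)%:E)%E.

Let measurable_large (K : R) : measurable [set a | K%:E < kappa h a]%E.
Proof.
by rewrite -[X in measurable X]setTI; apply: emeasurable_fun_o_infty => //; exact: measurable_kappa.
Qed.

Let measurable_large_kappa K : measurable_fun setT (large_kappa K).
Proof.
apply: emeasurable_funM; first exact: measurable_kappa.
by apply/measurable_EFinP; exact: measurable_indic.
Qed.

Let large_kappa_ge0 K a : (0 <= large_kappa K a)%E.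
Proof. by rewrite mule_ge0// ?kappa_ge0// lee_fin. Qed.

Let large_kappa_small (e : R) : 0 < e ->
  exists2 K : R, 0 < K & (\int[F]_a large_kappa K a <= e%:E)%E.
Proof.
move=> e0.
have ik : F.-integrable setT (kappa h).
  apply/integrableP; split; first exact: measurable_kappa.
  under eq_integral => a _ do rewrite gee0_abs ?kappa_ge0//.
  by rewrite kappa_fin ltry.
have [] := @dominated_convergence _ _ _ F setT measurableT
  (fun n => large_kappa n.+1%:R) (cst 0%E) (kappa h) _ _ _ ik _ => //.
- apply: filterS (integrable_ae measurableT ik) => a /(_ I) kfin _.
  apply: cvg_near_cst; near=> n.
  rewrite /large_kappa indicE memNset ?mule0//=; apply/negP; rewrite -leNgt.
  rewrite -(fineK kfin) lee_fin; apply: (@le_trans _ _ n%:R); last by rewrite ler_nat.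
  by near: n; exact: nbhs_infty_ger.
- apply: aeW => a n _; rewrite gee0_abs ?large_kappa_ge0// /large_kappa.
  by rewrite indicE; case: (a \in _); rewrite ?mule1 ?mule0// kappa_ge0.
move=> _ _; rewrite integral0.
move=> /fine_cvgP[finI] /cvgrPdist_lt/(_ _ e0) Hn.
have [n _ Hn'] : \forall n \near \oo, (\int[F]_a large_kappa n.+1%:R a)%E \is a fin_num /\
    `|0 - fine (\int[F]_a large_kappa n.+1%:R a)%E| < e.
  by near=> n; split; near: n.
have [fn ln] := Hn' n (leqnn n).
exists n.+1%:R => //; rewrite -(fineK fn) lee_fin ltW//.
by move: ln; rewrite sub0r normrN ger0_norm// fine_ge0// integral_ge0.
Unshelve. all: by end_near. Qed.

(** Parents with a large [kappa] contribute a small mean; the others produce a rate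
    bounded by a multiple of their number. *)
Let uniformly_linear_rate k : uniformly_linear P (outer_count k) ->
  uniformly_linear P (outer_rate k.+1).
Proof.
apply: uniformly_linear_le => // e e0.
have en0 : 0 < e / nu by rewrite divr_gt0.
have [K K0 Ksmall] := large_kappa_small en0.
exists K, (mark_sum (large_kappa K) k); split => //.
- by move=> T; apply: measurable_mark_sum.
- by move=> T w; apply: mark_sum_ge0.
- move=> T T1; have T0 : 0 <= T by lra.
  apply: le_trans (mark_sum_mean _ T0 _ _) _ => //.
  have [l /andP[l0 lT] ->] := outer_rate_fin k T0.
  apply: (@le_trans _ _ ((nu * T)%:E * (e / nu)%:E)%E); last first.
    by rewrite -EFinM lee_fin [leLHS](_ : _ = e * T)//; field; rewrite gt_eqF.
  by apply: lee_pmul => //; exact: integral_ge0.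
- move=> T w _; apply: le_trans (rate_le_mark_sum k T w) _.
  rewrite /outer_count /level_count -esumZl//; last exact: ltW.
  rewrite -esumD//; last 2 first.
  + by move=> u _; rewrite mule_ge0// lee_fin// ltW.
  + by move=> u _; case: (N u w) => // p; rewrite mule_ge0// lee_fin.
  apply: le_esum => u _.
  rewrite indicE; case E : (N u w) => [[t a]|]; last first.
    by rewrite adde0 mule_ge0// lee_fin ltW.
  rewrite /= indicE; case: (boolP (t \in before T)) => [/set_mem tT|_]; last first.
    by rewrite !mule0 adde0 mule_ge0// lee_fin ltW.
  rewrite mem_set; last by exists (t, a).
  rewrite !mule1 /large_kappa indicE.
  have [Kk|kK] := ltP K%:E (kappa h a).
    by rewrite mem_set// mule1 leeDr// lee_fin ltW.
  by rewrite memNset ?mule0 ?adde0//= ltNge kK.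
Qed.

Lemma uniformly_linear_outer_rate k : uniformly_linear P (outer_rate k).
Proof.
elim: k => [|k IH]; first exact: uniformly_linear_immigrants.
by apply: uniformly_linear_rate; exact: uniformly_linear_count.
Qed.

End hawkes_levels.

(** * Large marks in a Hawkes process *)

Section hawkes_bounds.
Context {d} {Omega : measurableType d} {R : realType} (P : probability Omega R).
Context {dA} {A : measurableType dA} (F : probability A R) (nu : R).
Variables (h : R * A -> R) (N : seq nat -> Omega -> option (R * A)).
Hypotheses (nu0 : 0 < nu) (hawkesN : hawkes P F nu h N).
Hypothesis subcritical : (\int[F]_a kappa h a < 1)%E.

Let mh : measurable_fun [set p : R * A | 0 < p.1] h. Proof. by case: hawkesN => -[]. Qed.
Let h0 t a : 0 < t -> 0 <= h (t, a). Proof. by case: hawkesN => -[_ + _ _ _ _]; apply. Qed.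
Let mhits u B : measurable B -> measurable (hits N u B).
Proof. by case: hawkesN => _ _ + _ _; apply. Qed.
Let N0 w : N [::] w = None. Proof. by case: hawkesN. Qed.

Let m := fine (\int[F]_a kappa h a)%E.
Let m0 : 0 <= m := m_ge0 hawkesN.
Let m1 : m < 1 := m_lt1 hawkesN subcritical.

Let window (T : R) : set R := `[0, T]%classic.
Let mwindow T : measurable (window T). Proof. exact: measurable_itv. Qed.
Let window_window T : 0 <= T -> window T `&` `[0, +oo[ = `[0, T]%classic.
Proof.
by move=> T0; apply/seteqP; split => t; rewrite /window/= !in_itv/= andbT;
  [move=> [/andP[-> ->]]|move=> /andP[-> ->]].
Qed.

Let inner k T := rate F nu h N k (window T `*` [set: A]).

Let inner_ge0 k T w : (0 <= inner k T w)%E.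
Proof. exact: (rate_ge0 nu0 hawkesN). Qed.

Let measurable_inner k T : measurable_fun setT (inner k T).
Proof. exact: (measurable_rate hawkesN). Qed.

Let inner_le_outer k T w : 0 <= T ->
  (inner k T w <= rate F nu h N k (before T `*` [set: A]) w)%E.
Proof.
move=> T0; case: k => [|k]; rewrite /inner/rate.
  have bT : before T `&` `[0, +oo[ = `[0, T]%classic.
    by apply/seteqP; split => t; rewrite /before/= !in_itv/= andbT;
      [move=> [-> ->]|move=> /andP[-> ->]].
  by rewrite (immigrant_intensity_setX F nu T0 (window_window T0))//
    (immigrant_intensity_setX F nu T0 bT).
apply: le_esum => u _; apply: le_offspring_intensity => //.
  exact: measurable_itv.
by move=> t; rewrite /window/before/= !in_itv/= => /andP[].
Qed.

Let inner_mean_le k T : 0 <= T -> (\int[P]_w inner k T w <= (nu * T * m ^+ k)%:E)%E.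
Proof.
move=> T0; apply: le_trans (outer_rate_mean nu0 hawkesN subcritical k T0).
apply: ge0_le_integral => //.
  apply: (measurable_rate hawkesN) => //; exact: measurable_itv.
by move=> w _; exact: inner_le_outer.
Qed.

Let uniformly_linear_inner k : uniformly_linear P (inner k).
Proof.
apply: (uniformly_linear_le (Y := fun T => rate F nu h N k (before T `*` [set: A]))).
- by move=> T; apply: (measurable_rate hawkesN) => //; exact: measurable_itv.
- by move=> T w; apply: (rate_ge0 nu0 hawkesN) => //; exact: measurable_itv.
- by [].
- by [].
- move=> e e0; exists 1, (fun _ _ => 0%E); split => //.
  + by move=> T T1; rewrite integral0 lee_fin mulr_ge0 ?ltW//; lra.
  + by move=> T w T1; rewrite adde0 mul1e; apply: inner_le_outer; lra.
- exact: (uniformly_linear_outer_rate nu0 hawkesN subcritical).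
Qed.

Let e k T := fine (\int[P]_w inner k T w)%E.

Let innerE k T : 0 <= T -> (\int[P]_w inner k T w = (e k T)%:E)%E.
Proof.
move=> T0; rewrite /e fineK// ge0_fin_numE ?integral_ge0//.
by apply: le_lt_trans (inner_mean_le k T0) _; exact: ltry.
Qed.

Let e_ge0 k T : 0 <= e k T.
Proof. by apply: fine_ge0; exact: integral_ge0. Qed.

Let e_le k T : 0 <= T -> e k T <= nu * T * m ^+ k.
Proof. by move=> T0; rewrite -lee_fin -innerE//; exact: inner_mean_le. Qed.

Let countE B w : (Defs.count N B w = \sum_(k <oo) level_count N k.+1 B w)%E.
Proof.
rewrite /Defs.count (_ : \esum_(u in _) _ = \esum_(u in [set: seq nat])
    (\1_(hits N u B) w)%:E)%E; last by apply: eq_esum => u _; rewrite -hits_indic.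
rewrite (_ : [set: seq nat] = \bigcup_(k in [set: nat]) [set u | size u = k]); last first.
  by apply/seteqP; split => // u _; exists (size u).
rewrite esum_bigcupT//; last first.
  by move=> i j _ _ [u [/= <- <-]].
rewrite -nneseries_esumT; last by move=> k; exact: level_count_ge0.
rewrite nneseries_recl//; last by move=> k _; exact: level_count_ge0.
rewrite (_ : \esum_(j in _) _ = 0)%E; last first.
  apply: esum1 => u /= /size0nil ->; rewrite indicE memNset// => -[p].
  by rewrite N0.
rewrite add0e -nneseries_addn; last by move=> k; exact: level_count_ge0.
by apply: eq_eseriesr => k _; rewrite addn1.
Qed.

Let mean_count T C : 0 <= T -> measurable C ->
  (\int[P]_w Defs.count N (window T `*` C) w =
   F C * \sum_(k <oo) (e k T)%:E)%E.
Proof.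
move=> T0 mC; have mTC : measurable (window T `*` C) by exact: measurableX.
under eq_integral do rewrite countE.
rewrite integral_nneseries//; last 2 first.
- by move=> k; exact: measurable_level_count.
- by move=> k w _; exact: level_count_ge0.
rewrite -[F C]fineK ?fin_num_measure// -nneseriesZl; last by move=> k _; rewrite lee_fin.
apply: eq_eseriesr => k _; rewrite (level_mean nu0 hawkesN)//.
under eq_integral => w _ do rewrite (rate_setX hawkesN k w T0 (mwindow T) (window_window T0) mC).
rewrite ge0_integralZl//; last 3 first.
- exact: measurable_inner.
- by move=> w _; exact: inner_ge0.
- by rewrite lee_fin fine_ge0.
by rewrite innerE.
Qed.

Lemma hawkes_mean T : 0 <= T ->
  (\int[P]_w nb_events N T w = \sum_(k <oo) (e k T)%:E)%E.
Proof.
by move=> T0; rewrite /nb_events mean_count// probability_setT mul1e.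
Qed.

Let tail_le T n : 0 <= T ->
  (\sum_(n <= k <oo) (e k T)%:E <= (nu * T * m ^+ n / (1 - m))%:E)%E.
Proof.
move=> T0; apply: lime_le.
  by apply: is_cvg_nneseries => k _ _; rewrite lee_fin.
apply: nearW => K; rewrite sumEFin lee_fin.
have [nK|Kn] := leqP n K; last first.
  rewrite big_geq ?(ltnW Kn)//; apply: divr_ge0; last by rewrite subr_ge0; exact: ltW.
  by apply: mulr_ge0; [apply: mulr_ge0 => //; exact: ltW|exact: exprn_ge0].
apply: (@le_trans _ _ (\sum_(n <= k < K) nu * T * m ^+ k)).
  by apply: ler_sum => k _; exact: e_le.
rewrite -mulr_sumr -!mulrA; apply: ler_wpM2l; first exact: ltW.
apply: ler_wpM2l => //; rewrite ler_pdivlMr ?subr_gt0//.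
have : (\sum_(n <= k < K) m ^+ k) * (1 - m) = m ^+ n - m ^+ K.
  rewrite mulr_suml (eq_bigr (fun k => - (m ^+ k.+1 - m ^+ k))).
    by rewrite sumrN telescope_sumr// opprB.
  by move=> k _; rewrite exprS; ring.
by move=> ->; rewrite gerBl exprn_ge0.
Qed.

Lemma hawkes_mean_finite T : 0 <= T -> (\int[P]_w nb_events N T w < +oo)%E.
Proof.
by move=> T0; rewrite hawkes_mean//; apply: le_lt_trans (tail_le 0 T0) _; exact: ltry.
Qed.

Let e0E T : 0 <= T -> e 0 T = nu * T.
Proof.
move=> T0; rewrite /e /inner/rate.
have E := immigrant_intensity_setX F nu T0 (window_window T0) (@measurableT _ A).
under eq_integral do rewrite E probability_setT mule1.
by rewrite integral_cst//= probability_setT mule1.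
Qed.

Lemma hawkes_mean_ge T : 0 <= T -> ((nu * T)%:E <= \int[P]_w nb_events N T w)%E.
Proof.
move=> T0; rewrite hawkes_mean// nneseries_recl//; last by move=> k _; rewrite lee_fin.
rewrite e0E// leeDl//; apply: nneseries_ge0 => k _ _; by rewrite lee_fin.
Qed.

Section large_marks.
Variables (T : R) (C : set A).
Hypotheses (T0 : 0 <= T) (mC : measurable C).

Let B := window T `*` C.
Let mB : measurable B. Proof. exact: measurableX. Qed.
Let p := fine (F C).
Let p0 : 0 <= p. Proof. exact: fine_ge0. Qed.
Let pE : F C = p%:E. Proof. by rewrite fineK// fin_num_measure. Qed.

Definition hit_event : set Omega := \bigcup_u hits N u (window T `*` C).

Let mM : measurable hit_event.
Proof. by apply: measurable_bigcup => u; exact: mhits. Qed.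

Lemma hawkes_upper : (P hit_event <= \int[P]_w nb_events N T w * F C)%E.
Proof.
rewrite hawkes_mean// muleC -mean_count// count_mean; last by move=> u; exact: mhits.
by apply: union_bound => u; exact: mhits.
Qed.

Definition no_hit (k : nat) : set Omega :=
  \bigcap_(u in [set u | (size u <= k)%N]) ~` hits N u (window T `*` C).

Let past_no_hit k : past N k (no_hit k).
Proof.
case: k => [|k].
  apply/seteqP; split => // w _ u /=; rewrite leqn0 => /nilP ->.
  by rewrite /hits/= N0 => -[].
rewrite /past /history; set G := (X in <<s X >>).
have mG X : G X -> <<s G >> X by exact: sub_gen_smallest.
have -> : no_hit k.+1 = ~` (\bigcup_(u in [set u | (size u <= k.+1)%N]) hits N u B).
  by rewrite setC_bigcup.
have := @countable_bigcupT_measurable _ (g_sigma_algebraType G) (seq nat)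
  (fun u => if (size u <= k.+1)%N then hits N u B else set0).
move=> /(_ (countableP _)) H.
have := @measurableC _ (g_sigma_algebraType G).
rewrite bigcup_mkcond => HC; apply: HC.
rewrite (_ : (fun i => _) = (fun u => if (size u <= k.+1)%N then hits N u B else set0)).
  apply: H => u; case: ifPn => uk; last exact: measurable0.
  by apply: mG; exists u, B.
apply/funext => u; case: ifPn => [/set_mem/= ->//|].
by rewrite notin_setE/= => /negP/negbTE ->.
Qed.

Let no_hitS k : no_hit k.+1 = no_hit k `&` [set w | level_count N k.+1 B w = 0%E].
Proof.
apply/seteqP; split => w /=.
  move=> H; split; first by move=> u /= uk; apply: H; exact: leqW.
  apply: esum1 => u /= uk; rewrite indicE memNset//.
  by apply: (H u); rewrite /= uk.
move=> [H L0] u /=; rewrite leq_eqVlt => /predU1P[uk|]; last exact: H.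
move=> Hu; move: L0; rewrite /level_count (esumID [set u])//.
rewrite (_ : _ `&` [set u] = [set u]); last first.
  by apply/seteqP; split => [v []|v ->].
rewrite esum_set1// indicE mem_set//.
move=> /eqP; rewrite padde_eq0//; last by apply: esum_ge0.
by move=> /andP[]; rewrite eqe oner_eq0.
Qed.

Let mno_hit k : measurable (no_hit k).
Proof. exact: (past_measurable hawkesN (past_no_hit k)). Qed.

Let q k := fine (P (no_hit k)).
Let qE k : P (no_hit k) = (q k)%:E. Proof. by rewrite fineK// fin_num_measure. Qed.

Let measurable_pinner k : measurable_fun setT (fun w => (1 - nexp (p%:E * inner k T w))%:E).
Proof. exact: measurable_one_sub_nexpM. Qed.

(** Given the past, level [k.+1] has no mark in [C] with probability
    [exp (- p * inner k T)]; the right-hand side is the probability that the first mark in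
    [C] appears at this level. *)
Let int_no_hit k : (\int[P]_(w in no_hit k) (1 - nexp (p%:E * inner k T w))%:E =
  (q k - q k.+1)%:E)%E.
Proof.
rewrite integral_one_sub_nexp// EFinB -!qE; congr (_ - _)%E.
rewrite no_hitS (level_void nu0 hawkesN (past_no_hit k))//.
by apply: eq_integral => w _; rewrite (rate_setX hawkesN k w T0 (mwindow T) (window_window T0) mC).
Qed.

Lemma no_hit_le k : q k.+1 <= q k.
Proof.
rewrite -subr_ge0 -lee_fin -int_no_hit; apply: integral_ge0 => w _.
exact: one_sub_nexpM_ge0.
Qed.

Lemma hit_ge k : 1 - q k <= fine (P hit_event).
Proof.
have : (1 <= P hit_event + P (no_hit k))%E.
  rewrite -(probability_setT P) (_ : setT = hit_event `|` no_hit k).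
    exact: measureU2.
  apply/seteqP; split => // w _; have [Hw|Hw] := pselect (hit_event w); [by left|right].
  by move=> u _ Hu; apply: Hw; exists u.
rewrite qE -(fineK (fin_num_measure P hit_event mM)) -EFinD lee_fin; lra.
Qed.

(** There are two losses with respect to [p * e k T]. The defect of the exponential at
    [p] is controlled by uniform integrability. So is the conditional mean carried by the
    event of an earlier hit, of probability at most [p * nu * T / (1 - m)], but at the
    larger parameter [th = del0 / T]: there [1 - exp (- th * inner k T)] is at most [1] on
    this event, and at most [th * inner k T] elsewhere. *)
Lemma hit_level_lower k (eps del0 : R) : 0 < eps -> 0 < del0 -> 1 <= T ->
  (forall th : R, 0 < th -> th * T <= del0 ->
  (th%:E * \int[P]_w inner k T w <=
   \int[P]_w (1 - nexp (th%:E * inner k T w))%:E + (eps * (th * T))%:E)%E) ->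
  p * T <= del0 -> p * T * nu <= eps * del0 * (1 - m) ->
  p * e k T <= q k - q k.+1 + 3 * eps * (p * T).
Proof.
move=> eps0 del00 T1 HU pT1 pT2.
have Tp : 0 < T by lra.
have [p00|pn0] := eqVneq p 0.
  by rewrite p00 !mul0r mulr0 addr0 subr_ge0 no_hit_le.
have pp : 0 < p by rewrite lt_neqAle eq_sym pn0.
have D := mno_hit k.
have mDc : measurable (~` no_hit k) by exact: measurableC.
pose th := del0 / T; have th0 : 0 < th by rewrite divr_gt0.
have thT : th * T = del0 by rewrite /th divfK// gt_eqF.
have f1 := integral_one_sub_nexpM_fin P measurableT p0 (measurable_inner k T) (inner_ge0 k T).
have f2 := integral_one_sub_nexpM_fin P mDc p0 (measurable_inner k T) (inner_ge0 k T).
have f3 := integral_one_sub_nexpM_fin P measurableT (ltW th0) (measurable_inner k T) (inner_ge0 k T).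
have H1 := HU p pp pT1.
have H2 : (th%:E * \int[P]_w inner k T w <=
   \int[P]_w (1 - nexp (th%:E * inner k T w))%:E + (eps * (th * T))%:E)%E.
  by apply: HU => //; rewrite thT.
(* the integral in [H1] splits according to the occurrence of an earlier hit *)
have S1 : (\int[P]_w (1 - nexp (p%:E * inner k T w))%:E =
   (q k - q k.+1)%:E + \int[P]_(w in ~` no_hit k) (1 - nexp (p%:E * inner k T w))%:E)%E.
  rewrite -int_no_hit -ge0_integral_setU//.
  - by rewrite setUv.
  - exact: measurable_funTS.
  - by move=> w _; exact: one_sub_nexpM_ge0.
  - by rewrite disj_set2E setICr.
have i_fin : (\int[P]_(w in ~` no_hit k) inner k T w)%E \is a fin_num.
  rewrite ge0_fin_numE; last by apply: integral_ge0 => w _; exact: inner_ge0.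
  apply: (@le_lt_trans _ _ (\int[P]_w inner k T w)%E); last by rewrite innerE// ltry.
  by apply: ge0_subset_integral.
have S2 := le_integral_one_sub_nexp P mDc p0 (measurable_inner k T) (inner_ge0 k T).
have S3 : (th%:E * \int[P]_(w in ~` no_hit k) inner k T w +
    \int[P]_w (1 - nexp (th%:E * inner k T w))%:E <=
    th%:E * \int[P]_w inner k T w + P (~` no_hit k))%E.
  have mI : measurable_fun setT (fun w => (\1_(~` no_hit k) w)%:E : \bar R).
    by apply/measurable_EFinP; exact: measurable_indic.
  have mti : measurable_fun setT (fun w => th%:E * inner k T w)%E by exact: measurable_funeM.
  have mn := measurable_one_sub_nexpM th (measurable_inner k T).
  have ti0 w : (0 <= th%:E * inner k T w)%E by rewrite mule_ge0// lee_fin ltW.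
  have n0 w := one_sub_nexpM_ge0 (ltW th0) (inner_ge0 k T w).
  have ind0 w : (0 <= (\1_(~` no_hit k) w)%:E :> \bar R)%E by rewrite lee_fin.
  have mtiI : measurable_fun setT
      (fun w => th%:E * inner k T w * (\1_(~` no_hit k) w)%:E)%E by exact: emeasurable_funM.
  have -> : (th%:E * \int[P]_(w in ~` no_hit k) inner k T w =
      \int[P]_w (th%:E * inner k T w * (\1_(~` no_hit k) w)%:E))%E.
    have <- : (\int[P]_(w in ~` no_hit k) (th%:E * inner k T w) =
        th%:E * \int[P]_(w in ~` no_hit k) inner k T w)%E.
      rewrite ge0_integralZl ?lee_fin ?(ltW th0)//; exact: measurable_funTS.
    rewrite [LHS]integral_mkcond; apply: eq_integral => w _.
    by rewrite patchE indicE; case: ifP => _; rewrite ?mule1 ?mule0.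
  have -> : P (~` no_hit k) = (\int[P]_w (\1_(~` no_hit k) w)%:E)%E.
    by rewrite integral_indic// setIT.
  have <- : (\int[P]_w (th%:E * inner k T w) = th%:E * \int[P]_w inner k T w)%E.
    by rewrite ge0_integralZl ?lee_fin ?(ltW th0).
  have tiI0 w : (0 <= th%:E * inner k T w * (\1_(~` no_hit k) w)%:E)%E by rewrite mule_ge0.
  rewrite -!ge0_integralD//.
  apply: ge0_le_integral => //.
  - by move=> w _; rewrite adde_ge0// mule_ge0.
  - exact: emeasurable_funD.
  - exact: emeasurable_funD.
  - move=> w _; rewrite indicE; case: (w \in _); rewrite ?mule1 ?mule0 ?add0e ?adde0.
      by apply: leeD => //; rewrite lee_fin gerBl nexp_ge0.
    exact: one_sub_nexp_le.
have S4 : (P (~` no_hit k) <= (p * (nu * T / (1 - m)))%:E)%E.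
  apply: (@le_trans _ _ (P hit_event)).
    apply: le_measure; rewrite ?inE// => w Hw.
    apply: contrapT => nM; apply: Hw => u _ Hu; apply: nM; by exists u.
  apply: le_trans hawkes_upper _; rewrite hawkes_mean// pE muleC EFinM.
  apply: lee_wpmul2l; first by rewrite lee_fin.
  by apply: le_trans (tail_le 0 T0) _; rewrite expr0 mulr1.
move: H1 H2 S1 S2 S3 S4; rewrite !innerE// -(fineK f1) -(fineK f2) -(fineK f3) -(fineK i_fin).
rewrite -(fineK (fin_num_measure P _ mDc)) -!EFinM -!EFinD !lee_fin => H1 H2 [S1] S2 S3 S4.
have c0 : 0 < 1 - m by rewrite subr_gt0.
(* [H2] and [S3] leave little room for the conditional mean carried by earlier hits *)
have S5 : th * fine (\int[P]_(w in ~` no_hit k) inner k T w) <=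
    eps * (th * T) + p * (nu * T / (1 - m)) by lra.
have S6 : fine (\int[P]_(w in ~` no_hit k) inner k T w) <= 2 * eps * T.
  rewrite -(ler_pM2l th0); apply: (le_trans S5).
  have : p * (nu * T / (1 - m)) <= eps * (th * T); last by lra.
  rewrite thT !mulrA ler_pdivrMr//.
  by move: pT2; rewrite -!mulrA [nu * T]mulrC.
have := ler_wpM2l p0 S6; lra.
Qed.

End large_marks.

(** The bounds of [hit_level_lower] telescope over the first [n] levels. *)
Lemma hawkes_lower_levels n (eps : R) : 0 < eps -> exists2 del : R, 0 < del &
  forall T C, 1 <= T -> measurable C -> fine (F C) * T <= del ->
  fine (F C) * \sum_(k < n) e k T <= 1 - fine (P (no_hit T C n)) + eps * (fine (F C) * T).
Proof.
elim: n eps => [|n IH] eps eps0.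
  exists 1 => // T C T1 mC _; rewrite big_ord0 mulr0.
  have -> : no_hit T C 0 = setT.
    apply/seteqP; split => // w _ u /=; rewrite leqn0 => /nilP ->.
    by rewrite /hits/= N0 => -[].
  rewrite probability_setT/= subrr add0r !mulr_ge0 ?fine_ge0//; lra.
have [del1 del10 H1] := IH _ (divr_gt0 eps0 (ltr0n R 2)).
have e60 : 0 < eps / 6 by rewrite divr_gt0.
have [del2 del20 H2] := uniformly_linear_inner n e60.
have c0 : 0 < 1 - m by rewrite subr_gt0.
pose del3 := eps / 6 * del2 * (1 - m) / nu.
exists (Num.min del1 (Num.min del2 del3)).
  by rewrite !lt_min del10 del20/= divr_gt0// !mulr_gt0.
move=> T C T1 mC; rewrite !le_min => /andP[pd1 /andP[pd2 pd3]].
have T0 : 0 <= T by lra.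
rewrite big_ord_recr/= mulrDr.
have := H1 T C T1 mC pd1.
have := hit_level_lower T0 mC e60 del20 T1 (fun th => H2 T th T1) pd2.
rewrite -ler_pdivlMr// => /(_ pd3); lra.
Qed.

(** The levels beyond [n] contain few events on average: their means are summable,
    being dominated by [nu * T * m ^+ k]. *)
Lemma hawkes_lower (eps : R) : 0 < eps -> exists2 del : R, 0 < del &
  forall T C, 1 <= T -> measurable C -> fine (F C) * T <= del ->
  fine (F C) * fine (\int[P]_w nb_events N T w)%E <=
    fine (P (hit_event T C)) + eps * (fine (F C) * T).
Proof.
move=> eps0; have c0 : 0 < 1 - m by rewrite subr_gt0.
have [n mn] : exists n, nu * m ^+ n / (1 - m) <= eps / 2.
  have : m ^+ n @[n --> \oo] --> 0 by apply: cvg_expr; rewrite ger0_norm.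
  have e20 : 0 < eps / 2 * (1 - m) / nu by rewrite !mulr_gt0// invr_gt0.
  move=> /cvgrPdist_le/(_ _ e20)[n _ /(_ n (leqnn n))].
  rewrite sub0r normrN ger0_norm ?exprn_ge0// => Hn; exists n.
  by rewrite ler_pdivrMr// mulrC -ler_pdivlMr.
have [del del0 H] := hawkes_lower_levels n (divr_gt0 eps0 (ltr0n R 2)).
exists del => // T C T1 mC pT; have T0 : 0 <= T by lra.
have := H T C T1 mC pT; have := hit_ge T mC n.
set p := fine (F C) => Hq HH; have p0 : 0 <= p by exact: fine_ge0.
have : fine (\int[P]_w nb_events N T w)%E <= \sum_(k < n) e k T + eps / 2 * T.
  rewrite -lee_fin fineK; last first.
    rewrite ge0_fin_numE ?hawkes_mean_finite//.
    by apply: le_trans (hawkes_mean_ge T0); rewrite lee_fin mulr_ge0// ltW.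
  rewrite hawkes_mean// (@nneseries_split _ _ 0 n) ?add0n; last by move=> k _; rewrite lee_fin.
  rewrite sumEFin big_mkord EFinD; apply: leeD => //.
  apply: le_trans (tail_le n T0) _; rewrite lee_fin.
  have -> : nu * T * m ^+ n / (1 - m) = nu * m ^+ n / (1 - m) * T by ring.
  exact: ler_wpM2r.
move=> /(ler_wpM2l p0); lra.
Qed.

End hawkes_bounds.

(** * Norms of the plane *)

Section norm2.
Context {R : realType}.
Implicit Types nrm : R * R -> R.

Lemma norm2_0 nrm : is_norm2 nrm -> nrm (0, 0) = 0.
Proof. by case=> _ /(_ 0 (0, 0)) + _; rewrite /= !mul0r normr0 mul0r. Qed.

Lemma norm2N nrm z : is_norm2 nrm -> nrm (- z.1, - z.2) = nrm z.
Proof. by case=> _ /(_ (-1) z) + _; rewrite !mulN1r normrN normr1 mul1r. Qed.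

Lemma norm2_ge0 nrm z : is_norm2 nrm -> 0 <= nrm z.
Proof.
move=> H; have N0 := norm2_0 H; have Nz := norm2N z H; case: H => _ _ /(_ z (- z.1, - z.2)).
by rewrite /= !subrr N0 Nz; lra.
Qed.

Lemma norm2_swap nrm : is_norm2 nrm -> is_norm2 (fun z => nrm (z.2, z.1)).
Proof.
case=> H0 HM HD; split => [[a b] /H0 []/= -> ->//|c z|y z].
- exact: (HM c (z.2, z.1)).
- exact: (HD (y.2, y.1) (z.2, z.1)).
Qed.

Lemma norm2_le nrm : is_norm2 nrm ->
  exists2 K : R, 0 < K & forall z, nrm z <= K * (`|z.1| + `|z.2|).
Proof.
move=> H; have n1 := norm2_ge0 (1, 0) H; have n2 := norm2_ge0 (0, 1) H.
exists (nrm (1, 0) + nrm (0, 1) + 1); first by lra.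
move=> [a b]; case: H => _ HM HD /=.
have := HD (a, 0) (0, b); rewrite /= addr0 add0r => /le_trans; apply.
have := HM a (1, 0); have := HM b (0, 1); rewrite /= !mulr0 !mulr1 => -> ->.
have := normr_ge0 a; have := normr_ge0 b; nra.
Qed.

Lemma norm2_lipschitz nrm (K : R) : is_norm2 nrm ->
  (forall z, nrm z <= K * (`|z.1| + `|z.2|)) ->
  forall y z, nrm y <= nrm z + K * (`|y.1 - z.1| + `|y.2 - z.2|).
Proof.
move=> [_ _ HD] HK y z; have := HD z (y.1 - z.1, y.2 - z.2); rewrite /= !subrKC.
rewrite -surjective_pairing => /le_trans; apply.
by rewrite lerD2l; exact: HK.
Qed.

(** On the line [x = 1] the norm is continuous, positive and tends to infinity, hence
    bounded below by compactness of a segment; the rest follows by homogeneity. *)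
Lemma norm2_ge1 nrm : is_norm2 nrm ->
  exists2 c : R, 0 < c & forall z, c * `|z.1| <= nrm z.
Proof.
move=> H; have [K K0 HK] := norm2_le H; have Lip := norm2_lipschitz H HK.
pose phi t := nrm (1, t).
have phi_cont : continuous phi.
  move=> t; apply/cvgrPdist_le => e e0; near=> s.
  have d : `|t - s| <= e / K.
    by near: s; apply: cvgr_dist_le; [exact: cvg_id|rewrite divr_gt0].
  have := Lip (1, t) (1, s); have := Lip (1, s) (1, t); rewrite /= !subrr normr0 !add0r.
  rewrite (distrC s t) => L1 L2.
  have KK : K * `|t - s| <= e by rewrite mulrC -ler_pdivlMr.
  rewrite ler_norml /phi; lra.
have [Hz _ _] := H.
have n01 : 0 < nrm (0, 1).
  rewrite lt_neqAle norm2_ge0// andbT eq_sym; apply/eqP => /Hz[] /eqP.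
  by rewrite oner_eq0.
have phi_gt0 t : 0 < phi t.
  rewrite lt_neqAle norm2_ge0// andbT eq_sym; apply/eqP => /Hz[] /eqP.
  by rewrite oner_eq0.
have phi_far t : `|t| * nrm (0, 1) <= phi t + nrm (1, 0).
  case: H => _ HM HD; have := HD (1, t) (-1, 0); rewrite /= subrr addr0.
  have := HM t (0, 1); rewrite /= mulr0 mulr1 => ->.
  by have := HM (-1) (1, 0); rewrite /= mulr0 mulr1 normrN normr1 mul1r => ->.
pose B := (nrm (1, 0) + 1) / nrm (0, 1).
have n10 := norm2_ge0 (1, 0) H.
have B0 : 0 <= B by rewrite divr_ge0// ?norm2_ge0//; lra.
have BB : - B <= B by lra.
have [t0 _ Ht0] : exists2 c, c \in `[- B, B]%R & forall t, t \in `[- B, B]%R -> phi c <= phi t.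
  by apply: EVT_min => //; apply: continuous_subspaceT.
have phi_min t : Num.min 1 (phi t0) <= phi t.
  rewrite ge_min; have [tB|tB] := leP `|t| B.
    by apply/orP; right; apply: Ht0; rewrite in_itv/= -ler_norml.
  apply/orP; left; have := phi_far t.
  have : nrm (1, 0) + 1 <= `|t| * nrm (0, 1) by rewrite -ler_pdivrMr// ltW.
  lra.
exists (Num.min 1 (phi t0)); first by rewrite lt_min ltr01 phi_gt0.
move=> [a b] /=; have [->|a0] := eqVneq a 0.
  by rewrite normr0 mulr0 norm2_ge0.
case: H => _ HM _; have := HM a (1, b / a); rewrite /= mulr1 mulrC divfK// => ->.
by rewrite mulrC; apply: ler_wpM2l => //; exact: phi_min.
Unshelve. all: by end_near. Qed.

Lemma norm2_ge2 nrm : is_norm2 nrm ->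
  exists2 c : R, 0 < c & forall z, c * `|z.2| <= nrm z.
Proof.
move=> /norm2_swap/norm2_ge1[c c0 H]; exists c => // z.
by have := H (z.2, z.1); rewrite -surjective_pairing.
Qed.

(** A norm is Lipschitz, so its strict superlevel sets are countable unions of balls
    centred at rational points. *)
Lemma measurable_norm2_gt d (Omega : measurableType d) nrm (Z1 Z2 : Omega -> R) (x : R) :
  is_norm2 nrm -> measurable_fun setT Z1 -> measurable_fun setT Z2 ->
  measurable [set w | x < nrm (Z1 w, Z2 w)].
Proof.
move=> H m1 m2; have [K K0 HK] := norm2_le H; have Lip := norm2_lipschitz H HK.
rewrite (_ : [set w | _] = \bigcup_(p in [set: rat * rat])
   [set w | K * (`|ratr p.1 - Z1 w| + `|ratr p.2 - Z2 w|) < nrm (ratr p.1, ratr p.2) - x]).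
  apply: measurable_bigcup => p; rewrite -[X in measurable X]setTI.
  have mg : measurable_fun setT (fun w => K * (`|ratr p.1 - Z1 w| + `|ratr p.2 - Z2 w|)).
    apply: measurable_funM => //; apply: measurable_funD.
      by apply: measurableT_comp => //; exact: measurable_funB.
    by apply: measurableT_comp => //; exact: measurable_funB.
  exact: (measurable_fun_ltr mg (measurable_cst _) measurableT (Y := [set true])).
apply/seteqP; split => w /=.
  move=> xw; pose e := (nrm (Z1 w, Z2 w) - x) / (4 * K).
  have e0 : 0 < e by rewrite divr_gt0 ?subr_gt0// mulr_gt0.
  have [q1] := @rat_in_itvoo R (Z1 w) (Z1 w + e) (ltac:(lra)).
  have [q2] := @rat_in_itvoo R (Z2 w) (Z2 w + e) (ltac:(lra)).
  rewrite !in_itv/= => /andP[a1 a2] /andP[b1 b2].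
  exists (q1, q2) => //=.
  have := Lip (Z1 w, Z2 w) (ratr q1, ratr q2); rewrite /= (distrC (Z1 w)) (distrC (Z2 w)).
  have d1 : `|ratr q1 - Z1 w| < e by rewrite gtr0_norm; lra.
  have d2 : `|ratr q2 - Z2 w| < e by rewrite gtr0_norm; lra.
  have : 4 * (K * e) = nrm (Z1 w, Z2 w) - x by rewrite /e; field; rewrite gt_eqF.
  nra.
move=> [[q1 q2] _ /=]; have := Lip (ratr q1, ratr q2) (Z1 w, Z2 w) => /=; lra.
Qed.

End norm2.

(** * Tails of regularly varying vectors *)

Section tail.
Context {R : realType} (U L : R -> R) (alpha : R).
Hypotheses (U01 : forall x, 0 <= U x <= 1) (Und : forall x y, x <= y -> U y <= U x).
Hypotheses (alpha1 : 1 < alpha) (svL : slowly_varying L)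
  (UL : forall x, 0 < x -> U x = x `^ (- alpha) * L x).

Lemma tail_positive x : 0 < U x.
Proof.
have [_ L0 _] := svL; have [y [_ Ly]] := L0.
pose z := Num.max 1 (Num.max x (y + 1)).
apply: (@lt_le_trans _ _ (U z)); last by apply: Und; rewrite /z !le_max lexx !orbT.
have z0 : 0 < z by rewrite /z lt_max ltr01.
rewrite UL// mulr_gt0 ?powR_gt0//; apply: Ly.
by rewrite /z !lt_max [y < y + 1]ltrDl ltr01 !orbT.
Qed.

(** As [alpha > 1], doubling the argument eventually divides the tail by more than 2. *)
Lemma tail_doubling : exists th x0 : R, [/\ 0 <= th, 2 * th < 1, 0 < x0 &
  forall x, x0 <= x -> U (2 * x) <= th * U x].
Proof.
have [_ L0 Lc] := svL.
pose r := (2 : R) `^ (- alpha).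
have r0 : 0 < r by rewrite powR_gt0.
have r2 : 2 * r < 1.
  have : r < 2^-1.
    rewrite /r /powR pnatr_eq0/= -[ltRHS]lnK ?posrE// ltr_expR lnV ?posrE//.
    by rewrite mulNr ltrN2 ltr_pMl// ln_gt0// ltr1n.
  lra.
pose th := (r + 2^-1) / 2.
have thr : 1 < th / r by rewrite ltr_pdivlMr// /th; lra.
have := Lc 2 (ltr0n R 2) => /cvgrPdist_lt /(_ (th / r - 1)).
rewrite subr_gt0 => /(_ thr) near1.
have [x0 [_ Hx0]] : \forall x \near +oo, 0 < L x /\ `|1 - L (2 * x) / L x| < th / r - 1.
  by near=> x; split; near: x.
exists th, (Num.max 1 (x0 + 1)); split; [by rewrite /th; lra|by rewrite /th; lra|by rewrite lt_max ltr01|].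
move=> x; rewrite ge_max => /andP[x1 x01].
have xx : x0 < x by lra.
have [Lx] := Hx0 x xx; rewrite ltr_norml => /andP[HL _].
have x_gt0 : 0 < x by lra.
rewrite !UL ?mulr_gt0// powRM//; last by lra.
have : L (2 * x) <= th / r * L x by rewrite -ler_pdivrMr//; lra.
rewrite -/r => HH; have xa : 0 <= x `^ (- alpha) by rewrite powR_ge0.
have -> : th * (x `^ (- alpha) * L x) = r * x `^ (- alpha) * (th / r * L x).
  by field; rewrite gt_eqF.
by apply: ler_wpM2l => //; rewrite mulr_ge0// ltW.
Unshelve. all: by end_near. Qed.

(** Once [x] is large, doubling it multiplies [x * U x] by at most [2 * th < 1]. *)
Lemma tail_little_o (e : R) : 0 < e -> exists X, forall x, X <= x -> x * U x <= e.
Proof.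
move=> e0; have [th [x0 [th0 th1 x00 Hd]]] := tail_doubling.
have halve y K : 2 * x0 <= y -> y / 2 * U (y / 2) <= K -> y * U y <= 2 * th * K.
  move=> y2 HK; have yy : x0 <= y / 2 by lra.
  have := Hd (y / 2) yy; rewrite [2 * _]mulrC divfK// => Hy.
  have y0 : 0 <= y by lra.
  have := ler_wpM2l y0 Hy; nra.
have bounded n y : x0 <= y -> y < 2 ^+ n.+1 * x0 -> y * U y <= 2 * x0.
  elim: n y => [|n IH] y xy yn.
    have /andP[u0 u1] := U01 y; rewrite expr1 in yn; nra.
  have [y2|y2] := ltP y (2 * x0); first by have /andP[u0 u1] := U01 y; nra.
  have yn2 : y / 2 < 2 ^+ n.+1 * x0 by rewrite ltr_pdivrMr// mulrC mulrA -exprS.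
  have yy : x0 <= y / 2 by lra.
  have := halve y _ y2 (IH _ yy yn2); nra.
have decay n y : 2 ^+ n * x0 <= y -> y * U y <= (2 * th) ^+ n * (2 * x0).
  elim: n y => [|n IH] y yn.
    rewrite expr0 mul1r; rewrite expr0 mul1r in yn.
    apply: (bounded (Num.bound (y / x0))) => //.
    rewrite -ltr_pdivrMr//; apply: lt_trans (archi_boundP _) _.
      by rewrite divr_ge0//; lra.
    by rewrite -natrX ltr_nat; apply: ltn_trans (ltn_expl _ (ltnSn 1)) _; rewrite ltn_exp2l.
  have p1 : 1 <= 2 ^+ n :> R by rewrite exprn_ege1// ler1n.
  have y2 : 2 * x0 <= y by move: yn; rewrite exprS; nra.
  have yn2 : 2 ^+ n * x0 <= y / 2 by rewrite ler_pdivlMr// mulrC mulrA -exprS.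
  by rewrite exprS -mulrA; apply: halve y2 (IH _ yn2).
have : (2 * th) ^+ n * (2 * x0) @[n --> \oo] --> 0 * (2 * x0).
  apply: cvgM; last exact: cvg_cst.
  by apply: cvg_expr; rewrite ger0_norm//; lra.
rewrite mul0r => /cvgrPdist_le/(_ _ e0)[n _ /(_ n (leqnn n))].
rewrite sub0r normrN => Hn; exists (2 ^+ n * x0) => x /decay/le_trans; apply.
by apply: le_trans Hn; exact: ler_norm.
Qed.

(** The sum of the first [2 * n] terms is at most [2 * th < 1] times the sum of the
    first [n] ones, up to a constant. *)
Lemma tail_summable (c : R) : 0 < c -> (\sum_(k <oo) (U (c * k%:R))%:E < +oo)%E.
Proof.
move=> c0; have [th [x0 [th0 th1 x00 Hd]]] := tail_doubling.
pose f k := U (c * k%:R); pose S n := \sum_(k < n) f k.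
pose j0 := Num.bound (x0 / c).
have j0P j : (j0 <= j)%N -> x0 <= c * j%:R.
  move=> jj; rewrite mulrC -ler_pdivrMr//; apply/ltW; apply: lt_le_trans (archi_boundP _) _.
    by rewrite divr_ge0// ltW.
  by rewrite ler_nat.
have f0 j : 0 <= f j by case/andP: (U01 (c * j%:R)).
have f1 j : f j <= 1 by case/andP: (U01 (c * j%:R)).
have fpair j : f j.*2 + f j.*2.+1 <= 2 * th * f j + 2 * (j < j0)%:R.
  case: ltnP => [_|jj]; rewrite ?mulr1 ?mulr0 ?addr0.
    have := f1 j.*2; have := f1 j.*2.+1; have : 0 <= 2 * th * f j by rewrite !mulr_ge0.
    lra.
  have h1 : f j.*2.+1 <= f j.*2 by apply: Und; rewrite ler_pM2l// ler_nat.
  have : f j.*2 <= th * f j.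
    have := Hd _ (j0P _ jj); rewrite /f -mul2n natrM.
    by rewrite (_ : c * (2%:R * j%:R) = 2 * (c * j%:R)); [|ring].
  lra.
have Sdouble n : S n.*2 <= 2 * th * S n + 2 * j0%:R.
  have -> : S n.*2 = \sum_(j < n) (f j.*2 + f j.*2.+1).
    elim: n => [|n IH]; first by rewrite /S !big_ord0.
    by rewrite /S doubleS !big_ord_recr/= -IH addrA.
  apply: (@le_trans _ _ (\sum_(j < n) (2 * th * f j + 2 * (j < j0)%:R))).
    by apply: ler_sum => j _; exact: fpair.
  rewrite big_split/= -mulr_sumr lerD2l -mulr_sumr ler_wpM2l//.
  rewrite -natr_sum ler_nat; elim: n => [|n IH]; first by rewrite big_ord0.
  rewrite big_ord_recr/=; case: (ltnP n j0) => nj; last by rewrite addn0.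
  apply: leq_trans nj; rewrite addn1 ltnS -[leqRHS]card_ord -sum1_card.
  by apply: leq_sum => i _; exact: leq_b1.
have Snd n k : (n <= k)%N -> S n <= S k.
  move=> nk; rewrite /S -!(big_mkord xpredT f) (@big_cat_nat _ _ _ n 0 k)//= lerDl.
  by apply: sumr_ge0.
pose B := 2 * j0%:R / (1 - 2 * th).
have SB n : S n <= B.
  apply: (@le_trans _ _ (S n.*2)); first by apply: Snd; rewrite -addnn leq_addr.
  rewrite ler_pdivlMr; last by rewrite subr_gt0.
  have := Sdouble n; have : S n <= S n.*2 by apply: Snd; rewrite -addnn leq_addr.
  nra.
apply: (@le_lt_trans _ _ B%:E); last exact: ltry.
apply: lime_le; first by apply: is_cvg_nneseries => k _ _; rewrite lee_fin f0.
by apply: nearW => n; rewrite big_mkord sumEFin lee_fin; exact: SB.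
Qed.

End tail.

Section regular_variation.
Context d (Omega : measurableType d) (R : realType) (P : probability Omega R).
Variables (Z1 Z2 : Omega -> R) (alpha : R) (mu : {measure set (R * R) -> \bar R}).
Hypotheses (mZ1 : measurable_fun setT Z1) (mZ2 : measurable_fun setT Z2).
Hypotheses (alpha1 : 1 < alpha)
  (rv : regularly_varying2 P (fun w => (Z1 w, Z2 w)) alpha mu).

Let mgt (Z : Omega -> R) x : measurable_fun setT Z -> measurable [set w | x < Z w].
Proof.
move=> mZ; rewrite -[X in measurable X]setTI.
exact: (measurable_fun_ltr (measurable_cst x) mZ measurableT (Y := [set true])).
Qed.

Let norm_tail (nrm : R * R -> R) : is_norm2 nrm ->
  regularly_varying P (nrm \o (fun w => (Z1 w, Z2 w))) alpha -> exists (U L : R -> R),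
  [/\ forall x, P [set w | x < nrm (Z1 w, Z2 w)] = (U x)%:E,
  forall x, 0 <= U x <= 1, forall x y, x <= y -> U y <= U x &
  slowly_varying L /\ forall x, 0 < x -> U x = x `^ (- alpha) * L x].
Proof.
move=> Hn [_ [L svL UL]].
have mn x : measurable [set w | x < nrm (Z1 w, Z2 w)] by exact: measurable_norm2_gt.
pose U x := fine (P [set w | x < nrm (Z1 w, Z2 w)]).
have UE x : P [set w | x < nrm (Z1 w, Z2 w)] = (U x)%:E by rewrite fineK// fin_num_measure.
exists U, L; split => //.
- by move=> x; rewrite -!lee_fin -UE measure_ge0 probability_le1.
- move=> x y xy; rewrite -lee_fin -!UE; apply: le_measure; rewrite ?inE//.
  by move=> w /=; exact: le_lt_trans.
- by split => // x x0; have := UL x x0; rewrite /comp/= UE => -[].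
Qed.

(** A coordinate is at most a multiple of the norm, whose tail is [o (1 / x)]. *)
Lemma rv2_tail1_little_o (b e : R) : 0 < b -> 0 < e ->
  exists T0, forall T, T0 <= T -> T * fine (P [set w | b * T < Z1 w]) <= e.
Proof.
move=> b0 e0; have [_ _ [nrm [Hn rvn _]]] := rv.
have [U [L [UE U01 Und [svL UL]]]] := norm_tail Hn rvn.
have [c c0 Hc] := norm2_ge1 Hn; have cb0 : 0 < c * b by rewrite mulr_gt0.
have ecb : 0 < e * (c * b) by rewrite mulr_gt0.
have [X HX] := tail_little_o U01 alpha1 svL UL ecb.
exists (Num.max 0 (X / (c * b))) => T; rewrite ge_max => /andP[T0 TX].
have le1 : fine (P [set w | b * T < Z1 w]) <= U (c * b * T).
  rewrite -lee_fin -UE fineK ?fin_num_measure//; last exact: mgt.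
  apply: le_measure; rewrite ?inE; [exact: mgt|exact: measurable_norm2_gt|].
  move=> w /= bT; apply: lt_le_trans (Hc (Z1 w, Z2 w)); rewrite /= -mulrA ltr_pM2l//.
  exact: lt_le_trans bT (ler_norm _).
apply: le_trans (ler_wpM2l T0 le1) _.
rewrite -(ler_pM2r cb0); apply: le_trans (HX (c * b * T) _); last first.
  by rewrite mulrC -ler_pdivrMr.
by rewrite [leRHS](_ : _ = T * U (c * b * T) * (c * b))//; ring.
Qed.

(** For an integer-valued [Z2], the finiteness of its mean. *)
Lemma rv2_tail2_summable : (\sum_(k <oo) P [set w | (k%:R < Z2 w)%R] < +oo)%E.
Proof.
have [_ _ [nrm [Hn rvn _]]] := rv.
have [U [L [UE U01 Und [svL UL]]]] := norm_tail Hn rvn.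
have [c c0 Hc] := norm2_ge2 Hn.
apply: le_lt_trans (tail_summable U01 Und alpha1 svL UL c0).
apply: lee_nneseries => [k _ _|k _]; first exact: measure_ge0.
rewrite -UE; apply: le_measure; rewrite ?inE; [exact: mgt|exact: measurable_norm2_gt|].
move=> w /= kZ; apply: lt_le_trans (Hc (Z1 w, Z2 w)); rewrite /= ltr_pM2l//.
exact: lt_le_trans kZ (ler_norm _).
Qed.

(** If [Z1 <= x] almost surely, the rescaled vectors eventually avoid the half plane
    [1 / 2 < z.1]; a test function supported there then has a vanishing limit, although
    its integral with respect to [mu] is positive. *)
Lemma rv2_tail1_positive (x : R) :
  (0 < mu [set z : R * R | ([/\ 0 <= z.1, 0 <= z.2, z <> (0, 0) & 1 < z.1])%R])%E ->
  (0 < P [set w | (x < Z1 w)%R])%E.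
Proof.
set S := [set z | _] => muS.
rewrite lt0e measure_ge0 andbT; apply/eqP => Px0.
have [_ _ [nrm [Hn rvn [a [na vague]]]]] := rv.
have [U [L [UE U01 Und [svL UL]]]] := norm_tail Hn rvn.
have [K K0 HK] := norm2_le Hn.
(* the normalizing sequence tends to infinity *)
have a_big B : \forall n \near \oo, B < a n.
  have UB := tail_positive Und svL UL B.
  move: na => /fine_cvgP[nfin /cvgrPdist_lt/(_ 1 ltr01) n1].
  near=> n; rewrite ltNge; apply/negP => anB.
  have nU : 2 < n%:R * U B.
    rewrite -ltr_pdivrMr//; near: n; exact: nbhs_infty_gtr.
  have : `|1 - fine (n%:R%:E * P [set w | (a n < nrm (Z1 w, Z2 w))%R])%E| < 1.
    by near: n; exact: n1.
  rewrite UE/= ltr_norml => /andP[+ _].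
  have := ler_wpM2l (ler0n R n) (Und _ _ anB); lra.
(* vanishes where [z.1 <= 1 / 2] and equals [1] where [1 <= z.1] *)
pose g (z : R * R) : R := Num.min 1 (Num.max 0 (2 * z.1 - 1)).
have g0 z : 0 <= g z by rewrite /g le_min ler01 le_max lexx.
have g1 z : g z <= 1 by rewrite /g ge_min lexx.
have cont_g : continuous g.
  have cz : continuous (fun z : R * R => 2 * z.1 - 1 : R^o).
    move=> z; apply: cvgB; last exact: cvg_cst.
    by apply: cvgM; [exact: cvg_cst|exact: cvg_fst].
  have cm : continuous ((fun=> 0 : R^o) \max (fun z : R * R => 2 * z.1 - 1 : R^o)).
    by move=> z; apply: continuous_max; [exact: cst_continuous|exact: cz].
  have := fun z => continuous_min (@cst_continuous (R * R)%type R^o 1 z) (cm z).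
  by apply.
have lim_g := vague g cont_g.
have gb : exists M, forall z, `|g z| <= M by exists 1 => z; rewrite ger0_norm.
have gz : exists2 e : R, 0 < e & forall z, `|z| < e -> g z = 0.
  exists 2^-1 => // -[z1 z2]; rewrite /g/= => zlt.
  have : `|z1| < 2^-1 by apply: le_lt_trans zlt; rewrite le_max lexx.
  rewrite ltr_norml => /andP[_ z1lt].
  by rewrite max_l ?min_r//; lra.
have := lim_g gb gz => {lim_g} lim_g.
have mS : measurable S.
  rewrite (_ : S = (`]1, +oo[%classic `*` `[0, +oo[%classic)); last first.
    apply/seteqP; split => -[z1 z2]; rewrite /S/= !in_itv/= !andbT; first by case.
    by move=> [z1gt z2ge]; split => //; [lra|move=> [z10]; lra].
  by apply: measurableX; exact: measurable_itv.
have mg : measurable_fun setT g.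
  apply: measurable_minr => //; apply: measurable_maxr => //.
  by apply: measurable_funB => //; apply: measurable_funM.
have mu_g : (0 < \int[mu]_z (g z)%:E)%E.
  apply: (lt_le_trans muS); rewrite -[S]setIT -integral_indic//.
  apply: ge0_le_integral => //.
  - by apply/measurable_EFinP; exact: measurable_indic.
  - exact/measurable_EFinP.
  - move=> z _; rewrite lee_fin indicE; case: (boolP (z \in S)) => [/set_mem[_ _ _ z1]|_] //=.
    by rewrite /g min_l// le_max; apply/orP; right; lra.
have int0 : \forall n \near \oo, (n%:R%:E *
    \int[P]_w (g ((a n)^-1 * Z1 w, (a n)^-1 * Z2 w)%R)%:E)%E = 0%E.
  near=> n.
  have an0 : 0 < a n by near: n; exact: a_big.
  have anx : 2 * x < a n by near: n; exact: a_big.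
  have mgn : measurable_fun setT (fun w => (g ((a n)^-1 * Z1 w, (a n)^-1 * Z2 w))%:E).
    apply/measurable_EFinP; apply: (measurableT_comp mg).
    by apply/measurable_fun_pairP; split; apply: measurable_funM.
  suff -> : (\int[P]_w (g ((a n)^-1 * Z1 w, (a n)^-1 * Z2 w)%R)%:E = 0)%E by rewrite mule0.
  apply/eqP; rewrite eq_le integral_ge0 ?andbT; last by move=> w _; rewrite lee_fin.
  rewrite -Px0 -[X in (_ <= P X)%E]setIT -integral_indic//; last exact: mgt.
  apply: ge0_le_integral => //.
  - by move=> w _; rewrite lee_fin.
  - by apply/measurable_EFinP; apply: measurable_indic; exact: mgt.
  - move=> w _; rewrite lee_fin indicE; case: (boolP (w \in _)) => [_|]; first exact: g1.
    rewrite notin_setE /= => /negP; rewrite -leNgt => Zx.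
    have : 2 * ((a n)^-1 * Z1 w) <= 1.
      rewrite mulrCA ler_pdivrMl// mulr1; lra.
    by move=> ?; rewrite /g max_l ?min_r//=; lra.
have lim0 : (n%:R%:E * \int[P]_w (g ((a n)^-1 * Z1 w, (a n)^-1 * Z2 w)%R)%:E)%E
    @[n --> \oo] --> (0 : \bar R)%E by exact: cvg_near_cst.
by move: mu_g; rewrite -(cvg_lim (@ereal_hausdorff R) lim_g)
  (cvg_lim (@ereal_hausdorff R) lim0) ltxx.
Unshelve. all: by end_near. Qed.

End regular_variation.

(** * Large marks in a renewal cluster process *)

(** Dynkin's lemma. The time of an offspring involves the arrivals and the cluster of
    the immigrant together, whereas independence from its mark is known on products of
    events of both kinds. *)
Lemma independent_generated d (T : measurableType d) (R : realType) (P : probability T R)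
    (G : set_system T) (D : set T) : setI_closed G -> G setT -> (forall E, G E -> measurable E) ->
  measurable D -> (forall E, G E -> P (E `&` D) = (P E * P D)%E) ->
  forall E, <<s G >> E -> P (E `&` D) = (P E * P D)%E.
Proof.
move=> GI GT Gm mD HG.
have sm E : <<s G >> E -> measurable E.
  by apply: smallest_sub; [exact: sigma_algebra_measurable|exact: Gm].
apply: (@dynkin_induction _ (g_sigma_algebraType G) G
  (fun E => P (E `&` D) = (P E * P D)%E)) => //.
- exact: HG.
- move=> E' /sm mE' ED'; pose E : set T := E'.
  have mE : @measurable _ T E by exact: mE'.
  have ED : P (E `&` D) = (P E * P D)%E by exact: ED'.
  have mED : @measurable _ T (E `&` D) by exact: (@measurableI _ T).
  change (P (~` E `&` D) = (P (~` E) * P D)%E).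
  rewrite probability_setC//.
  transitivity (P D - P (E `&` D))%E.
    rewrite (_ : ~` E `&` D = D `\` (E `&` D)); last first.
      by apply/seteqP; split => w /=; [move=> [nE Dw]; split => // -[]|
        move=> [Dw nED]; split => // Ew; apply: nED].
    have mP : (P D < +oo)%E by rewrite ltey_eq fin_num_measure.
    apply: etrans (measureD mD mED mP) _.
    by rewrite (_ : D `&` (E `&` D) = E `&` D)// setICA setIid.
  rewrite ED -(fineK (fin_num_measure P E mE)) -(fineK (fin_num_measure P D mD)).
  by rewrite -EFinM -!EFinB -EFinM mulrBl mul1r.
- move=> E' mE' tE HE'; pose E : nat -> set T := E'.
  have mE n : @measurable _ T (E n) by exact: sm (mE' n).
  have HE n : P (E n `&` D) = (P (E n) * P D)%E by exact: HE'.
  change (P (\bigcup_k E k `&` D) = (P (\bigcup_k E k) * P D)%E).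
  have mED n : @measurable _ T (E n `&` D) by exact: (@measurableI _ T).
  rewrite setI_bigcupl.
  transitivity (\sum_(k <oo | k \in [set: nat]) P (E k `&` D))%E.
    by apply: measure_bigcup => //; exact: trivIset_setIr.
  transitivity (P D * \sum_(k <oo | k \in [set: nat]) P (E k))%E; last first.
    by rewrite muleC; congr (_ * _)%E; apply/esym/measure_bigcup.
  rewrite -(fineK (fin_num_measure P D mD)) -nneseriesZl//.
  by apply: eq_eseriesr => n _; rewrite HE muleC fineK ?fin_num_measure.
Qed.



Section renewal.
Context {d} {Omega : measurableType d} {R : realType} (P : probability Omega R).
Context {dA} {A : measurableType dA} (F : probability A R) (nu : R).
Variables (Gamma : nat -> Omega -> R) (K : nat -> Omega -> nat).
Variables (W : nat -> nat -> Omega -> R) (M : nat -> nat -> Omega -> A).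
Hypotheses (nu0 : 0 < nu) (ren : renewal_cluster P F nu Gamma K W M).

Let imm : immigrants P F nu Gamma (fun i => M i 0%N). Proof. by case: ren. Qed.
Let mGamma i : measurable_fun setT (Gamma i). Proof. by case: imm. Qed.
Let mK i : measurable_fun setT (K i). Proof. by case: ren => _ []. Qed.
Let mW i j : measurable_fun setT (W i j). Proof. by case: ren => _ []. Qed.
Let mM i j : measurable_fun setT (M i j). Proof. by case: ren => _ []. Qed.
Let W0 i j w : 0 <= W i j w. Proof. by case: ren => _ []. Qed.

Let preim {d'} {V : measurableType d'} (X : Omega -> V) B : measurable B ->
  measurable_fun setT X -> measurable (X @^-1` B).
Proof. by move=> mB mX; rewrite -[X in measurable X]setTI; exact: mX. Qed.

Let gen_preim {d'} {V : measurableType d'} (X : Omega -> V) B : measurable B ->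
  g_sigma_algebra_preimage X (X @^-1` B).
Proof. by move=> mB; exists B => //; rewrite setTI. Qed.

Let gen_measurable {d'} {V : measurableType d'} (X : Omega -> V) E :
  measurable_fun setT X -> g_sigma_algebra_preimage X E -> measurable E.
Proof. by move=> mX [B mB <-]; exact: mX. Qed.

Let sGamma : set_system Omega := sigma_Gamma Gamma.
Let sImm i : set_system Omega := sigma_immigrant K W M i.
Let sOff i : set_system Omega := sigma_offspring_marks M i.
Let sClu i : set_system Omega := sigma_cluster K W M i.

Let sGamma_sub i B : measurable B -> sGamma (Gamma i @^-1` B).
Proof. by move=> mB; apply: sub_gen_smallest; exists i => //; exact: gen_preim. Qed.

Let sImm_mark i B : measurable B -> sImm i (M i 0%N @^-1` B).
Proof. by move=> mB; apply: sub_gen_smallest; left; left; exact: gen_preim. Qed.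

Let sImm_K i B : measurable B -> sImm i (K i @^-1` B).
Proof. by move=> mB; apply: sub_gen_smallest; left; right; exact: gen_preim. Qed.

Let sImm_W i j B : measurable B -> sImm i (W i j @^-1` B).
Proof.
move=> mB; apply: sub_gen_smallest; right; apply: sub_gen_smallest.
by exists j => //; exact: gen_preim.
Qed.

Let sOff_mark i j B : measurable B -> sOff i (M i j.+1 @^-1` B).
Proof. by move=> mB; apply: sub_gen_smallest; exists j => //; exact: gen_preim. Qed.

Let sImm_clu i E : sImm i E -> sClu i E.
Proof. by move=> H; apply: sub_gen_smallest; left. Qed.

Let sOff_clu i E : sOff i E -> sClu i E.
Proof. by move=> H; apply: sub_gen_smallest; right. Qed.

Let sClu_mark i j B : measurable B -> sClu i (M i j @^-1` B).
Proof.
by case: j => [|j] mB; [apply: sImm_clu; exact: sImm_mark|apply: sOff_clu; exact: sOff_mark].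
Qed.

Let sClu_join i E : sClu i E -> sigma_join (fun i => sClu i) E.
Proof. by move=> H; apply: sub_gen_smallest; exists i. Qed.

Let genI (G : set_system Omega) E1 E2 : <<s G >> E1 -> <<s G >> E2 -> <<s G >> (E1 `&` E2).
Proof. by move=> H1 H2; exact: (@measurableI _ (g_sigma_algebraType G)). Qed.

Let genT (G : set_system Omega) : <<s G >> setT.
Proof. exact: (@measurableT _ (g_sigma_algebraType G)). Qed.

Let gen_sub (G : set_system Omega) : (forall E, G E -> measurable E) ->
  forall E, <<s G >> E -> measurable E.
Proof. by move=> H E; apply: smallest_sub; [exact: sigma_algebra_measurable|exact: H]. Qed.

Let sGamma_measurable E : sGamma E -> measurable E.
Proof. by apply: gen_sub => E' [i _]; exact: gen_measurable. Qed.

Let sImm_measurable i E : sImm i E -> measurable E.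
Proof.
apply: gen_sub => E' [[|]|]; [exact: gen_measurable|exact: gen_measurable|].
by apply: gen_sub => E'' [j _]; exact: gen_measurable.
Qed.

Let indepGamma E1 E2 : sGamma E1 -> sigma_join (fun i => sClu i) E2 ->
  P (E1 `&` E2) = (P E1 * P E2)%E.
Proof. by case: ren => _ _ [_ _ H] _; exact: H. Qed.

Let mark_law i j B : measurable B -> P (M i j @^-1` B) = F B.
Proof. by case: ren => _ _ _ [_ H _]; exact: H. Qed.

(** The mark of an immigrant may depend on its number of offspring and on their delays,
    but not on its arrival time; the mark of an offspring depends neither on the arrivals
    nor on the variables of its immigrant. *)
Let indep_mark i j C E : measurable C ->
  (if j is j'.+1 then <<s [set X `&` Y | X in sGamma & Y in sImm i] >> E else sGamma E) ->
  P (E `&` M i j @^-1` C) = (P E * F C)%E.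
Proof.
move=> mC; case: j => [|j] HE.
  rewrite indepGamma//; first by rewrite mark_law.
  by apply: (@sClu_join i); exact: sClu_mark.
rewrite -(@mark_law i j.+1 C mC); move: E HE; apply: independent_generated.
- move=> _ _ [X1 HX1 [Y1 HY1 <-]] [X2 HX2 [Y2 HY2 <-]].
  exists (X1 `&` X2); first exact: genI.
  exists (Y1 `&` Y2); first exact: genI.
  by rewrite setIACA.
- by exists setT; [exact: genT|exists setT; [exact: genT|rewrite setIT]].
- move=> _ [X HX [Y HY <-]]; apply: measurableI; first exact: sGamma_measurable.
  exact: sImm_measurable HY.
- by apply: preim.
- move=> _ [X HX [Y HY <-]].
  have HM := @sOff_mark i j C mC.
  have YM : P (Y `&` M i j.+1 @^-1` C) = (P Y * P (M i j.+1 @^-1` C))%E.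
    case: ren => _ _ _ [_ _ H]; by rewrite setIC muleC (H i _ _ HM HY).
  rewrite -setIA indepGamma//; last first.
    by apply: (@sClu_join i); apply: genI; [exact: sImm_clu|exact: sOff_clu].
  rewrite YM muleA; congr (_ * _)%E.
  by rewrite indepGamma//; apply: (@sClu_join i); exact: sImm_clu.
Qed.

Let N := renewal_events Gamma K W M.

(** [(i, 0)] stands for immigrant [i] and [(i, j.+1)] for its offspring number [j]. *)
Definition label (p : nat * nat) : seq nat := if p.2 is j.+1 then [:: p.1; j] else [:: p.1].

Lemma label_inj : injective label.
Proof. by move=> [i [|j]] [i' [|j']] //= [-> //] ->. Qed.

Let time_event (T : R) (p : nat * nat) : set Omega :=
  if p.2 is j.+1 then [set w | (j < K p.1 w)%N] `&`
      (fun w => Gamma p.1 w + \sum_(l < j.+1) W p.1 l w) @^-1` `[0, T]%classic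
  else Gamma p.1 @^-1` `[0, T]%classic.

Let hits_label T C p : hits N (label p) (`[0, T]%classic `*` C) =
  time_event T p `&` M p.1 p.2 @^-1` C.
Proof.
case: p => i [|j]; rewrite /label/hits/N/time_event/=; apply/seteqP; split => w /=.
- by move=> [[t a] [<- <-] []].
- by move=> [Gi MC]; exists (Gamma i w, M i 0%N w).
- by case: ifP => jK [[t a] //= [<- <-] []].
- by move=> [[-> tw] MC]; exists (Gamma i w + \sum_(l < j.+1) W i l w, M i j.+1 w).
Qed.

Let hits_nolabel u B : ~ range label u -> hits N u B = set0.
Proof.
move=> nou; apply/seteqP; split => // w [q]; case: u nou => [|i [|j [|l u]]] //= nou.
- by case: nou; exists (i, 0%N).
- by case: nou; exists (i, j.+1).
Qed.

Let time_event_gen T p :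
  if p.2 is j'.+1 then <<s [set X `&` Y | X in sGamma & Y in sImm p.1] >> (time_event T p)
  else sGamma (time_event T p).
Proof.
case: p => i [|j] /=; first by apply: sGamma_sub; exact: measurable_itv.
set G := [set X `&` Y | X in _ & Y in _].
pose V : measurableType _ := g_sigma_algebraType G.
have GX X : sGamma X -> @measurable _ V X.
  move=> HX; apply: sub_gen_smallest; exists X => //; exists setT; first exact: genT.
  by rewrite setIT.
have GY Y : sImm i Y -> @measurable _ V Y.
  move=> HY; apply: sub_gen_smallest; exists setT; first exact: genT.
  by exists Y => //; rewrite setTI.
have mG : measurable_fun setT (Gamma i : V -> R).
  by move=> _ B mB; rewrite setTI; apply: GX; exact: sGamma_sub.
have mWl l : measurable_fun setT (W i l : V -> R).
  by move=> _ B mB; rewrite setTI; apply: GY; exact: sImm_W.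
apply: (@measurableI _ V); first by apply: GY; apply: (@sImm_K i [set k | (j < k)%N]).
have mS : measurable_fun setT ((fun w => Gamma i w + \sum_(l < j.+1) W i l w) : V -> R).
  by apply: measurable_funD => //; exact: measurable_sum.
rewrite -[X in @measurable _ V X]setTI; apply: mS => //; exact: measurable_itv.
Qed.

Let mtime_event T p : measurable (time_event T p).
Proof.
have := time_event_gen T p; case: p => i [|j] /=; first exact: sGamma_measurable.
apply: gen_sub => _ [X HX [Y HY <-]]; apply: measurableI; first exact: sGamma_measurable.
exact: sImm_measurable HY.
Qed.

Let prob_hit T C p : measurable C ->
  P (time_event T p `&` M p.1 p.2 @^-1` C) = (P (time_event T p) * F C)%E.
Proof. by move=> mC; apply: indep_mark => //; exact: time_event_gen. Qed.

Let arrived (T : R) i : set Omega := Gamma i @^-1` `]-oo, T]%classic.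

Let arrived_sGamma T i : sGamma (arrived T i).
Proof. by apply: sGamma_sub; exact: measurable_itv. Qed.

Let time_arrived T p : time_event T p `<=` arrived T p.1.
Proof.
case: p => i [|j] w; rewrite /time_event/arrived/= ?in_itv/=.
  by move=> /andP[].
move=> [_] /andP[_]; apply: le_trans; rewrite lerDl; exact: sumr_ge0.
Qed.

(** Two distinct marks are independent of each other and of the arrival times. The
    existence of offspring is not independent of the mark of their immigrant, and is
    therefore bounded by the arrival of the immigrant. *)
Let pair_bound T C p q : measurable C -> p <> q ->
  (P ((time_event T p `&` M p.1 p.2 @^-1` C) `&` (time_event T q `&` M q.1 q.2 @^-1` C)) <=
   P (arrived T p.1 `&` arrived T q.1) * (F C * F C))%E.
Proof.
move=> mC pq.
have mMC i j : measurable (M i j @^-1` C) by exact: preim.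
have mArr i : measurable (arrived T i) by exact: sGamma_measurable.
apply: (@le_trans _ _ (P ((arrived T p.1 `&` arrived T q.1) `&`
    (M p.1 p.2 @^-1` C `&` M q.1 q.2 @^-1` C)))).
  apply: le_measure; rewrite ?inE.
  - by do ?[apply: measurableI => //].
  - by do ?[apply: measurableI => //].
  - by rewrite setIACA; apply: setSI; apply: setISS; exact: time_arrived.
have arr2 : sGamma (arrived T p.1 `&` arrived T q.1) by apply: genI; exact: arrived_sGamma.
have E2 : sigma_join (fun i => sClu i) (M p.1 p.2 @^-1` C `&` M q.1 q.2 @^-1` C).
  by apply: genI; [apply: (@sClu_join p.1)|apply: (@sClu_join q.1)]; exact: sClu_mark.
rewrite indepGamma// [X in (_ * X <= _)%E](_ : _ = F C * F C)%E//.
case: p q pq {arr2 E2} => [i j] [i' j'] /= pq.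
have [ii|ii] := eqVneq i i'.
  rewrite -ii in pq *; have jj : j != j' by apply: contra_notN pq => /eqP ->.
  case: ren => _ _ _ [H _ _].
  have := H i [:: j; j'] (fun l => M i l @^-1` C); rewrite /= inE jj/= => /(_ isT).
  rewrite !big_cons big_nil mule1 !mark_law// => <-; last by move=> l _; exact: gen_preim.
  by congr (P _); apply/seteqP; split => w /=;
    [move=> [a b] l /=; rewrite !inE => /orP[] /eqP ->|move=> H'; split; apply: H'; rewrite /= !inE eqxx ?orbT].
case: ren => _ _ [H _ _] _.
have := H [:: i; i'] (fun l => if l == i then M i j @^-1` C else M i' j' @^-1` C).
rewrite /= inE ii/= => /(_ isT).
rewrite !big_cons big_nil mule1 eqxx eq_sym (negbTE ii) !mark_law// => <-; last first.
  move=> l; rewrite !inE; case: ifP => [/eqP -> _|li /orP[/eqP le|/eqP ->]].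
  - exact: sClu_mark.
  - by [].
  - exact: sClu_mark.
congr (P _); apply/seteqP; split => w /=.
  move=> [a b] l /=; rewrite !inE => /orP[] /eqP ->; first by rewrite eqxx.
  by rewrite eq_sym (negbTE ii).
move=> H'; split.
  by have := H' i; rewrite /= !inE eqxx; apply.
by have := H' i'; rewrite /= !inE eqxx orbT eq_sym (negbTE ii); apply.
Qed.

Let esum_Gamma (I : set R) T : 0 <= T -> measurable I ->
  I `&` `[0, +oo[ = `[0, T]%classic ->
  (\esum_(i in [set: nat]) P (Gamma i @^-1` I) = (nu * T)%:E)%E.
Proof.
move=> T0 mI IT; have mIA : measurable (I `*` [set: A]) by exact: measurableX.
transitivity (immigrant_intensity F nu (I `*` [set: A])); last first.
  by rewrite (immigrant_intensity_setX F nu T0 IT)// probability_setT mule1.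
rewrite -(immigrant_mean nu0 imm)//.
under [RHS]eq_integral do rewrite immigrant_countE.
have E i : [set w | (I `*` [set: A]) (Gamma i w, M i 0%N w)] = Gamma i @^-1` I.
  by apply/seteqP; split => w //= -[].
have mE i : measurable (Gamma i @^-1` I) by exact: preim.
rewrite integral_esum//.
- by apply: eq_esum => i _; rewrite integral_indic// ?setIT E.
- by move=> i; apply/measurable_EFinP; rewrite E; exact: measurable_indic.
Qed.

Let early (T : R) : `]-oo, T]%classic `&` `[0, +oo[%classic = `[0, T]%classic.
Proof.
by apply/seteqP; split => x /=; rewrite !in_itv/= andbT; [move=> [-> ->]|move=> /andP[-> ->]].
Qed.

Let esum_arrived T : 0 <= T ->
  (\esum_(i in [set: nat]) P (arrived T i) = (nu * T)%:E)%E.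
Proof.
by move=> T0; apply: esum_Gamma => //; exact: early.
Qed.

(** The mean number of ordered pairs of arrivals is a second moment of a Poisson law. *)
Let esum_arrived_pairs T : 0 <= T ->
  (\esum_(i in [set: nat]) \esum_(i' in [set: nat]) P (arrived T i `&` arrived T i') <=
   (nu * T + (nu * T) ^+ 2)%:E)%E.
Proof.
move=> T0; have mI : measurable (`]-oo, T]%classic : set R) by exact: measurable_itv.
set I := `]-oo, T]%classic : set R in mI *.
set B := I `*` [set: A]; have mB : measurable B by exact: measurableX.
have BE : immigrant_intensity F nu B = (nu * T)%:E.
  by rewrite (immigrant_intensity_setX F nu T0 (early T))// probability_setT mule1.
rewrite -(immigrant_square nu0 imm mB BE).
have E i : [set w | B (Gamma i w, M i 0%N w)] = arrived T i.
  by apply/seteqP; split => w //= -[].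
have mE i : measurable (arrived T i) by exact: sGamma_measurable.
pose c (w : Omega) : \bar R := (\esum_(i in [set: nat]) (\1_(arrived T i) w)%:E)%E.
have m1 i : measurable_fun setT (fun w => (\1_(arrived T i) w)%:E : \bar R).
  by apply/measurable_EFinP; exact: measurable_indic.
have cE w : immigrant_count Gamma (fun i => M i 0%N) B w = c w.
  by rewrite immigrant_countE; apply: eq_esum => i _; rewrite E.
have c0 w : (0 <= c w)%E by exact: esum_ge0.
have mc : measurable_fun setT c by exact: measurable_esum.
under [leRHS]eq_integral do rewrite cE.
have -> : (\esum_(i in [set: nat]) \esum_(i' in [set: nat]) P (arrived T i `&` arrived T i') =
    \int[P]_w \esum_(i in [set: nat]) ((\1_(arrived T i) w)%:E * c w))%E.
  rewrite integral_esum//.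
  - apply: eq_esum => i _; under eq_integral do rewrite -esumZl//.
    rewrite integral_esum//.
    + apply: eq_esum => i' _; rewrite -[arrived T i `&` arrived T i']setIT -integral_indic//.
        by apply: eq_integral => w _; rewrite indicI EFinM.
      exact: measurableI.
    + by move=> *; exact: emeasurable_funM.
  - by move=> *; exact: emeasurable_funM.
  - by move=> i w; apply: mule_ge0.
apply: ge0_le_integral => //.
- by move=> w _; apply: esum_ge0 => i _; exact: mule_ge0.
- apply: measurable_esum => [i|i w]; [exact: emeasurable_funM|exact: mule_ge0].
- exact: emeasurable_funM.
- move=> w _; have [cy|cf] := eqVneq (c w) +oo%E.
    by rewrite cy mulyy leey.
  have {}cf : c w = (fine (c w))%:E by rewrite fineK// ge0_fin_numE// lt_neqAle cf leey.
  rewrite {1}cf; under eq_esum do rewrite muleC.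
  by rewrite esumZl ?fine_ge0// -/(c w) -cf.
Qed.

Let q j : \bar R := P [set w | (j < K 0%N w)%N].

Let K_law i j : P [set w | (j < K i w)%N] = q j.
Proof.
case: ren => _ _ [_ H _] _.
have := H i [set k | (j < k)%N] (fun=> setT) (fun=> setT) (fun=> measurableT) (fun=> measurableT).
rewrite /cluster_cylinder/q.
rewrite (_ : [set w | [/\ [set k | (j < k)%N] (K i w), _ & _]] = [set w | (j < K i w)%N]).
  by move=> ->; congr (P _); apply/seteqP; split => w //= -[].
by apply/seteqP; split => w //= -[].
Qed.

Let mK_gt i j : measurable [set w | (j < K i w)%N].
Proof. exact: (@preim _ _ (K i) [set k | (j < k)%N]). Qed.

Let offspring_le T i j : (P (time_event T (i, j.+1)) <= P (arrived T i) * q j)%E.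
Proof.
rewrite -(K_law i j) -indepGamma//.
- apply: le_measure; rewrite ?inE; first exact: mtime_event.
    by apply: measurableI => //; exact: sGamma_measurable.
  move=> w Hw; split; first exact: (time_arrived Hw).
  by case: Hw.
- apply: (@sClu_join i); apply: sImm_clu; exact: (@sImm_K i [set k | (j < k)%N]).
Qed.

Let mhits T C u : measurable C -> measurable (hits N u (`[0%R, T]%classic `*` C)).
Proof.
move=> mC; have [[p _ <-]|nou] := pselect (range label u).
  by rewrite hits_label; apply: measurableI; [exact: mtime_event|exact: preim].
by rewrite hits_nolabel.
Qed.

Let esum_labels (T : R) (C : set A) : measurable C ->
  (\esum_(u in [set: seq nat]) P (hits N u (`[0%R, T]%classic `*` C)) =
   \esum_(p in [set: nat * nat]) P (time_event T p `&` M p.1 p.2 @^-1` C))%E.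
Proof.
move=> mC; rewrite (esumID (range label))// !setTI.
rewrite [X in (_ + X)%E]esum1 ?adde0; last by move=> u nou; rewrite hits_nolabel.
rewrite esum_image; last by move=> p p' _ _; exact: label_inj.
by apply: eq_esum => p _; rewrite hits_label.
Qed.

Let meanE (T : R) : (\int[P]_w nb_events N T w = \esum_(p in [set: nat * nat]) P (time_event T p))%E.
Proof.
rewrite /nb_events count_mean; last by move=> u; exact: mhits.
rewrite esum_labels//; apply: eq_esum => p _.
by rewrite preimage_setT setIT.
Qed.

Let early_le T k : 0 <= T ->
  (\esum_(p in [set p | (p.2 <= k)%N]) P (time_event T p) <= (k.+1%:R * (nu * T))%:E)%E.
Proof.
move=> T0; rewrite EFinM -(esum_arrived T0) -esum_strip//; apply: le_esum => p _.
by apply: le_measure; rewrite ?inE; [exact: mtime_event|exact: sGamma_measurable|exact: time_arrived].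
Qed.

Let late_le T k : 0 <= T ->
  (\esum_(p in [set p | (k < p.2)%N]) P (time_event T p) <=
   (nu * T)%:E * \sum_(k <= j <oo) q j)%E.
Proof.
move=> T0; have r0 : 0 <= nu * T by rewrite mulr_ge0// ltW.
rewrite (@reindex_esum _ _ _ ([set j | (k <= j)%N] `*`` (fun=> [set: nat])) _
  (fun p : nat * nat => (p.2, p.1.+1))); last first.
  split.
  - by move=> [j i] [].
  - by move=> [j i] [j' i'] _ _ [-> ->].
  - by move=> [i [|j]] //= jk; exists (j, i).
have qf j : (fine (q j))%:E = q j by rewrite fineK// fin_num_measure.
apply: (@le_trans _ _ (\esum_(p in [set j | (k <= j)%N] `*`` (fun=> [set: nat]))
    ((fine (q p.1))%:E * P (arrived T p.2)))%E).
  by apply: le_esum => p _; rewrite qf muleC; exact: offspring_le.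
rewrite -(esum_esum (a := fun j i => (fine (q j))%:E * P (arrived T i))%E)//; last first.
  by move=> j i _ _; rewrite qf mule_ge0.
rewrite (@eq_esum _ _ _ _ (fun j => (nu * T)%:E * q j)%E); last first.
  by move=> j _; rewrite esumZl ?fine_ge0// esum_arrived// qf muleC.
rewrite esumZl// lee_wpmul2l//.
by rewrite -nneseries_esum// [leRHS]eseries_cond.
Qed.

Lemma renewal_mean_ge T : 0 <= T -> ((nu * T)%:E <= \int[P]_w nb_events N T w)%E.
Proof.
move=> T0; rewrite meanE.
apply: le_trans (le_esum_subset (S1 := [set p | (p.2 <= 0)%N]) _ _) => //.
rewrite (@eq_esum _ _ _ _ (fun p => P (Gamma p.1 @^-1` `[0%R, T]%classic))); last first.
  by move=> [i [|j]].
rewrite (esum_strip 0 (b := fun i => P (Gamma i @^-1` `[0%R, T]%classic)))// mul1e (@esum_Gamma _ T)//.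
by apply/seteqP; split => x /=; rewrite !in_itv/= andbT; [case|move=> /andP[-> ->]].
Qed.

Lemma renewal_upper (T : R) (C : set A) : measurable C ->
  (P (\bigcup_u hits N u (`[0%R, T]%classic `*` C)) <= \int[P]_w nb_events N T w * F C)%E.
Proof.
move=> mC; apply: le_trans (union_bound _ _ _) _; first by move=> u; exact: mhits.
rewrite esum_labels// meanE (@eq_esum _ _ _ _ (fun p => (fine (F C))%:E * P (time_event T p))%E).
  by rewrite esumZl ?fine_ge0// fineK ?fin_num_measure// muleC.
by move=> p _; rewrite prob_hit// fineK ?fin_num_measure// muleC.
Qed.

Hypothesis K_summable : (\sum_(k <oo) q k < +oo)%E.

Lemma renewal_mean_finite T : 0 <= T -> (\int[P]_w nb_events N T w < +oo)%E.
Proof.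
move=> T0; rewrite meanE (esumID [set p | (p.2 <= 0)%N])// !setTI.
rewrite (_ : ~` _ = [set p | (0 < p.2)%N]); last first.
  by apply/seteqP; split => p /=; rewrite ltnNge => /negP.
apply: le_lt_trans (leeD (early_le 0 T0) (late_le 0 T0)) _.
have S0 : (0 <= \sum_(0 <= k <oo) q k)%E by exact: nneseries_ge0.
by rewrite -(@fineK _ (\sum_(0 <= k <oo) q k)%E) ?ge0_fin_numE// -EFinM -EFinD ltry.
Qed.

Let pairs_le T C k : 0 <= T -> measurable C ->
  (\esum_(p in [set p : (nat * nat) * (nat * nat) |
       [/\ (p.1.2 <= k)%N, (p.2.2 <= k)%N & p.1 <> p.2]])
     P ((time_event T p.1 `&` M p.1.1 p.1.2 @^-1` C) `&`
        (time_event T p.2 `&` M p.2.1 p.2.2 @^-1` C)) <=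
   (fine (F C) ^+ 2 * (k.+1%:R ^+ 2 * (nu * T + (nu * T) ^+ 2)))%:E)%E.
Proof.
move=> T0 mC; set S := [set q : nat * nat | (q.2 <= k)%N].
set c := fine (F C) ^+ 2.
have cE : (c%:E = F C * F C)%E by rewrite /c expr2 EFinM fineK ?fin_num_measure.
have c0 : 0 <= c by exact: sqr_ge0.
clearbody c.
apply: (@le_trans _ _ (\esum_(p in S `*`` (fun=> S))
    (c%:E * P (arrived T p.1.1 `&` arrived T p.2.1)))%E).
  apply: (@le_trans _ _ (\esum_(p in [set p : (nat * nat) * (nat * nat) |
       [/\ (p.1.2 <= k)%N, (p.2.2 <= k)%N & p.1 <> p.2]])
    (c%:E * P (arrived T p.1.1 `&` arrived T p.2.1)))%E).
    by apply: le_esum => p [_ _ pq]; rewrite cE muleC; exact: pair_bound.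
  apply: le_esum_subset; first by move=> p [].
  by move=> p; rewrite mule_ge0.
rewrite esumZl// EFinM lee_wpmul2l//.
rewrite -(esum_esum (a := fun p q => P (arrived T p.1 `&` arrived T q.1)))//.
rewrite (@eq_esum _ _ _ _ (fun p => k.+1%:R%:E *
    \esum_(i' in [set: nat]) P (arrived T p.1 `&` arrived T i'))%E); last first.
  by move=> p _; rewrite (esum_strip k (b := fun i' => P (arrived T p.1 `&` arrived T i'))).
rewrite esumZl//; last by move=> p; exact: esum_ge0.
rewrite (esum_strip k (b := fun i => \esum_(i' in [set: nat]) P (arrived T i `&` arrived T i'))%E);
  last by move=> i; exact: esum_ge0.
rewrite expr2 -mulrA !EFinM lee_wpmul2l// lee_wpmul2l//.
exact: esum_arrived_pairs.
Qed.

(** When only the first [k] offspring of each immigrant are kept, Bonferroni's inequality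
    loses a second moment of the number of arrivals, and the discarded offspring lose a
    tail of the mean of [K]. *)
Let truncated_lower (T : R) (C : set A) k : 0 <= T -> measurable C ->
  fine (F C) * fine (\int[P]_w nb_events N T w)%E <=
    fine (P (\bigcup_u hits N u (`[0%R, T]%classic `*` C))) +
    fine (F C) ^+ 2 * (k.+1%:R ^+ 2 * (nu * T + (nu * T) ^+ 2)) +
    fine (F C) * (nu * T * fine (\sum_(k <= j <oo) q j)%E).
Proof.
move=> T0 mC; set p := fine (F C); set U := \bigcup_u _; set S := [set l : nat * nat | (l.2 <= k)%N].
have pE : F C = p%:E by rewrite fineK// fin_num_measure.
have p0 : 0 <= p by exact: fine_ge0.
clearbody p.
have mU : measurable U by apply: measurable_bigcup => u; exact: mhits.
have mH (l : nat * nat) : measurable (time_event T l `&` M l.1 l.2 @^-1` C).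
  by apply: measurableI; [exact: mtime_event|exact: preim].
have B : (p%:E * (\esum_(l in S) P (time_event T l)) <=
    P U + (p ^+ 2 * (k.+1%:R ^+ 2 * (nu * T + (nu * T) ^+ 2)))%:E)%E.
  rewrite -esumZl// (@eq_esum _ _ _ _ (fun l => P (time_event T l `&` M l.1 l.2 @^-1` C))); last first.
    by move=> l _; rewrite prob_hit// muleC pE.
  apply: le_trans (bonferroni P S mH) _; apply: leeD; last by have := pairs_le k T0 mC; rewrite pE.
  apply: le_measure; rewrite ?inE//; first exact: measurable_bigcup.
  by move=> w [l _ Hl]; exists (label l) => //; rewrite hits_label.
have Lt : (\sum_(k <= j <oo) q j < +oo)%E.
  apply: le_lt_trans K_summable; rewrite [leRHS](@nneseries_split _ _ 0 k)// add0n leeDr//.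
  exact: sume_ge0.
have L0 : (0 <= \sum_(k <= j <oo) q j)%E by exact: nneseries_ge0.
have Ef := renewal_mean_finite T0.
have E0 : (0 <= \int[P]_w nb_events N T w)%E.
  by apply: le_trans (renewal_mean_ge T0); rewrite lee_fin mulr_ge0// ltW.
rewrite -lee_fin EFinM fineK ?ge0_fin_numE//.
rewrite meanE (esumID S)// !setTI (_ : ~` S = [set l | (k < l.2)%N]); last first.
  by apply/seteqP; split => l /=; rewrite /S/= ltnNge => /negP.
rewrite ge0_muleDr ?esum_ge0// !EFinD fineK ?fin_num_measure//.
apply: leeD => //; rewrite EFinM lee_wpmul2l//.
by rewrite EFinM fineK ?ge0_fin_numE//; exact: late_le.
Qed.

(** The truncation level [k] is chosen first, to make the discarded mean small compared
    with [T]; then [del], as the pairs cost [(p * T) ^ 2] up to a factor depending on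
    [k]. *)
Lemma renewal_lower (eps : R) : 0 < eps ->
  exists2 del : R, 0 < del & forall (T : R) (C : set A), 1 <= T -> measurable C ->
  fine (F C) * T <= del ->
  fine (F C) * fine (\int[P]_w nb_events N T w)%E <=
    fine (P (\bigcup_u hits N u (`[0%R, T]%classic `*` C))) + eps * (fine (F C) * T).
Proof.
move=> eps0.
have [k Hk] : exists k, nu * fine (\sum_(k <= j <oo) q j)%E <= eps / 2.
  have := nneseries_tail_cvg K_summable (fun k _ => measure_ge0 P [set w | (k < K 0%N w)%N]).
  move=> /fine_cvgP[_] /cvgrPdist_le/(_ (eps / 2 / nu)).
  rewrite divr_gt0 ?divr_gt0// => /(_ isT)[k _ /(_ k (leqnn k))] /=.
  rewrite sub0r normrN => H; exists k; rewrite mulrC -ler_pdivlMr//.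
  exact: le_trans (ler_norm _) H.
have a0 : 0 < k.+1%:R ^+ 2 * nu * (1 + nu) by rewrite !mulr_gt0// ?exprn_gt0// addr_gt0.
exists (eps / 2 / (k.+1%:R ^+ 2 * nu * (1 + nu))); first by rewrite !divr_gt0.
move=> T C T1 mC; have T0 : 0 <= T by lra.
rewrite ler_pdivlMr// => HT; apply: le_trans (truncated_lower k T0 mC) _.
have p0 : 0 <= fine (F C) by exact: fine_ge0.
move: HT Hk; set p := fine (F C) in p0 *; set s := fine (\sum_(k <= j <oo) q j)%E.
set a := k.+1%:R ^+ 2; have a1 : 0 <= a by exact: sqr_ge0.
move=> HT Hk; rewrite -addrA lerD2l.
have pT : 0 <= p * T by exact: mulr_ge0.
have H1 : p * (nu * T * s) <= eps / 2 * (p * T).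
  by rewrite (_ : p * _ = nu * s * (p * T)); [exact: ler_wpM2r|ring].
have H2 : p ^+ 2 * (a * (nu * T + (nu * T) ^+ 2)) <= eps / 2 * (p * T).
  apply: (@le_trans _ _ (p * T * (a * nu * (1 + nu)) * (p * T))); last exact: ler_wpM2r.
  rewrite (_ : p * T * _ * _ = p ^+ 2 * (a * (nu * T ^+ 2 + (nu * T) ^+ 2))); last by ring.
  rewrite ler_wpM2l ?sqr_ge0// ler_wpM2l// lerD2r ler_pM2l// expr2; exact: ler_peMr.
lra.
Qed.

End renewal.

(** * Uniform convergence of the ratio *)

Lemma max_mark_hits {d} {Omega : measurableType d} {R : realType} {dA} {A : measurableType dA}
    (N : seq nat -> Omega -> option (R * A)) (f : A -> R) (T x : R) :
  [set w | (x%:E < max_mark N f T w)%E] =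
  \bigcup_u hits N u (`[0, T]%classic `*` [set a | x < f a]).
Proof.
apply/seteqP; split => w /=.
  move=> /ereal_sup_gt[_ [p [u Nu pT] <-]]; rewrite lte_fin => xf.
  by exists u => //; exists p => //; split => //=; rewrite in_itv.
move=> [u _ [p Nu [/= pT xf]]]; apply: (@lt_le_trans _ _ (f p.2)%:E); first by rewrite lte_fin.
apply: ereal_sup_ubound; exists p => //; exists u => //.
Qed.

(** As [EN T >= nu * T], an error [e * (tail x * T)] is a relative error of at most
    [e / nu]; and [tail x * T] is small, uniformly in [x >= gamma * nu * T], as soon as it
    is at the left end of this range. *)
Lemma uniform_ratio (R : realType) (M : R -> R -> R) (EN tail : R -> R) (nu gamma : R) :
  0 < nu -> 0 < gamma -> (forall x, 0 < tail x) ->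
  (forall x y, x <= y -> tail y <= tail x) ->
  (forall e, 0 < e -> exists T0, forall T, T0 <= T -> T * tail (gamma * nu * T) <= e) ->
  (forall T, 0 <= T -> nu * T <= EN T) ->
  (forall T x, 0 <= T -> M T x <= EN T * tail x) ->
  (forall e, 0 < e -> exists2 del, 0 < del & forall T x, 1 <= T -> tail x * T <= del ->
     tail x * EN T <= M T x + e * (tail x * T)) ->
  ereal_sup [set `| M T x / (EN T * tail x) - 1 |%:E
     | x in [set x : R | gamma * nu * T <= x]] @[T --> +oo] --> (0 : \bar R)%E.
Proof.
move=> nu0 g0 tail0 tailnd tailo ENge upper lower.
set S := fun T => ereal_sup _.
have near_small e : 0 < e -> \forall T \near +oo, (0 <= S T <= e%:E)%E.
  move=> e0; have [del del0 Hdel] := lower _ (mulr_gt0 e0 nu0).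
  have [T0 HT0] := tailo _ del0.
  near=> T; have T1 : 1 <= T by near: T; exact: nbhs_pinfty_ge (num_real _).
  have TT0 : T0 <= T by near: T; exact: nbhs_pinfty_ge (num_real _).
  have Tpos : 0 <= T by lra.
  apply/andP; split.
    apply: (@le_trans _ _ `|M T (gamma * nu * T) / (EN T * tail (gamma * nu * T)) - 1|%:E).
      by rewrite lee_fin.
    by apply: ereal_sup_ubound; exists (gamma * nu * T) => //=.
  apply: ge_ereal_sup => _ [x /= xT <-]; rewrite lee_fin.
  have t0 := tail0 x.
  have EN0 : 0 < EN T by apply: lt_le_trans (ENge _ Tpos); apply: mulr_gt0 => //; lra.
  have D0 : 0 < EN T * tail x by rewrite mulr_gt0.
  have up := upper T x Tpos.
  have tx : tail x * T <= del.
    apply: le_trans (HT0 _ TT0); rewrite mulrC; apply: ler_wpM2l => //; exact: tailnd.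
  have lo := Hdel T x T1 tx.
  have r1 : M T x / (EN T * tail x) <= 1 by rewrite ler_pdivrMr// mul1r.
  rewrite ler0_norm ?subr_le0// opprB lerBlDr -lerBlDl ler_pdivlMr//.
  have := ler_wpM2l (ltW (mulr_gt0 e0 t0)) (ENge _ Tpos).
  nra.
apply/fine_cvgP; split.
  near=> T; have /andP[S0 S1] : (0 <= S T <= 1%:E)%E by near: T; exact: near_small.
  by rewrite ge0_fin_numE// (le_lt_trans S1)// ltry.
apply/cvgrPdist_le => e e0; near=> T.
have /andP[S0 S1] : (0 <= S T <= e%:E)%E by near: T; exact: near_small.
rewrite sub0r normrN ger0_norm /= ?fine_ge0//.
by rewrite -lee_fin fineK// ge0_fin_numE// (le_lt_trans S1)// ltry.
Unshelve. all: by end_near. Qed.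

(** Both cluster processes enter through the mean number of their events and through
    an upper and a lower bound for the probability of a mark in a set. *)
Lemma uniform_max_ratio d (Omega : measurableType d) (R : realType) (P : probability Omega R)
    dA (A : measurableType dA) (F : probability A R)
    (N : seq nat -> Omega -> option (R * A)) (f : A -> R) (nu gamma : R) :
  measurable_fun setT f -> 0 < nu -> 0 < gamma ->
  (forall x : R, 0 < F [set a | (x < f a)%R])%E ->
  (forall e, 0 < e -> exists T0, forall T, T0 <= T ->
     T * fine (F [set a | gamma * nu * T < f a]) <= e) ->
  (forall T, 0 <= T -> ((nu * T)%:E <= \int[P]_w nb_events N T w)%E) ->
  (forall T, 0 <= T -> (\int[P]_w nb_events N T w < +oo)%E) ->
  (forall (T : R) C, 0 <= T -> measurable C ->
     (P (\bigcup_u hits N u (`[0%R, T]%classic `*` C)) <= \int[P]_w nb_events N T w * F C)%E) ->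
  (forall eps : R, 0 < eps -> exists2 del : R, 0 < del &
     forall (T : R) C, 1 <= T -> measurable C -> fine (F C) * T <= del ->
     fine (F C) * fine (\int[P]_w nb_events N T w)%E <=
       fine (P (\bigcup_u hits N u (`[0, T]%classic `*` C))) + eps * (fine (F C) * T)) ->
  ereal_sup [set `| fine (P [set w | (x%:E < max_mark N f T w)%E])
                      / (fine (\int[P]_w nb_events N T w)%E
                         * fine (F [set a | x < f a])) - 1 |%:E
              | x in [set x : R | gamma * nu * T <= x]]
      @[T --> +oo] --> (0 : \bar R)%E.
Proof.
move=> mf nu0 g0 tail0 tailo meang meanf upper lower.
have mC x : measurable [set a | x < f a].
  rewrite -[X in measurable X]setTI.
  exact: (measurable_fun_ltr (measurable_cst x) mf measurableT (Y := [set true])).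
apply: (@uniform_ratio _ (fun T x => fine (P [set w | (x%:E < max_mark N f T w)%E]))
  (fun T => fine (\int[P]_w nb_events N T w)%E) (fun x => fine (F [set a | x < f a]))
  nu gamma) => //.
- by move=> x; rewrite -lte_fin fineK ?fin_num_measure.
- move=> x y xy; apply: fine_le; rewrite ?fin_num_measure//; apply: le_measure; rewrite ?inE//.
  by move=> a; apply: le_lt_trans.
- move=> T T0; rewrite -lee_fin fineK; first exact: meang.
  by rewrite ge0_fin_numE ?meanf//; apply: le_trans (meang _ T0); rewrite lee_fin mulr_ge0 ?(ltW nu0).
- move=> T x T0; rewrite max_mark_hits.
  have Efin : (\int[P]_w nb_events N T w)%E \is a fin_num.
    by rewrite ge0_fin_numE ?meanf//; apply: le_trans (meang _ T0); rewrite lee_fin mulr_ge0 ?(ltW nu0).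
  have up := upper T _ T0 (mC x).
  have Ff : F [set a | x < f a] \is a fin_num by rewrite fin_num_measure.
  rewrite -lee_fin EFinM (fineK Efin) (fineK Ff) fineK// ge0_fin_numE//.
  by apply: le_lt_trans up _; rewrite -(fineK Efin) -(fineK Ff) -EFinM ltry.
- move=> e e0; have [del del0 H] := lower _ e0; exists del => // T x T1 Hx.
  by rewrite max_mark_hits; exact: H.
Qed.

Unset Implicit Arguments.

Theorem proposition8p1 (R : realType) (dO dA : measure_display)
    (Omega : measurableType dO) (A : measurableType dA)
    (P : probability Omega R) (F : probability A R)
    (f : A -> R) (nu alpha : R) (mu : {measure set (R * R) -> \bar R})
    (N : seq nat -> Omega -> option (R * A)) :
  measurable_fun setT f -> (forall a, 0 <= f a) -> 0 < nu -> 1 < alpha ->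
  (exists (Gamma : nat -> Omega -> R) (K : nat -> Omega -> nat)
          (W : nat -> nat -> Omega -> R) (M : nat -> nat -> Omega -> A),
      [/\ renewal_cluster P F nu Gamma K W M,
          N = renewal_events Gamma K W M
        & regularly_varying2 P (fun w => (f (M 0%N 0%N w), (K 0%N w)%:R))
            alpha mu])
  \/
  (exists h : R * A -> R,
      [/\ hawkes P F nu h N,
          (\int[F]_a kappa h a < 1)%E
        & regularly_varying2 F (fun a => (f a, fine (kappa h a))) alpha mu]) ->
  (0 < mu [set z : R * R |
      ([/\ 0 <= z.1, 0 <= z.2, z <> (0, 0) & 1 < z.1])%R])%E ->
  forall gamma : R, 0 < gamma ->
    ereal_sup [set `| fine (P [set w | (x%:E < max_mark N f T w)%E])
                      / (fine (\int[P]_w nb_events N T w)%E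
                         * fine (F [set a | x < f a])) - 1 |%:E
              | x in [set x : R | gamma * nu * T <= x]]
      @[T --> +oo] --> (0 : \bar R)%E.
Proof.
move=> mf _ nu0 alpha1 [[Gamma [K [W [M [ren -> rv]]]]]|[h [hawkesN sub rv]]] mu0 gamma g0.
- have mM : measurable_fun setT (M 0%N 0%N) by case: ren => _ [].
  have mK : measurable_fun setT (K 0%N) by case: ren => _ [].
  have mZ1 : measurable_fun setT (f \o M 0%N 0%N) by exact: measurableT_comp.
  have mZ2 : measurable_fun setT (fun w => (K 0%N w)%:R : R).
    exact: (measurableT_comp (f := fun k : nat => k%:R : R)).
  have law x : P [set w | x < (f \o M 0%N 0%N) w] = F [set a | x < f a].
    case: ren => _ _ _ [_ H _]; rewrite -(H 0%N 0%N)//.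
    rewrite -[X in measurable X]setTI.
    exact: (measurable_fun_ltr (measurable_cst x) mf measurableT (Y := [set true])).
  have Ksum : (\sum_(k <oo) P [set w | (k < K 0%N w)%N] < +oo)%E.
    have := rv2_tail2_summable mZ1 mZ2 alpha1 rv.
    by under eq_eseriesr => k _ do under eq_set do rewrite ltr_nat.
  apply: (uniform_max_ratio mf nu0 g0).
  + by move=> x; rewrite -law; exact: (rv2_tail1_positive mZ1 mZ2 rv).
  + move=> e e0; have [T0 H] := rv2_tail1_little_o mZ1 mZ2 alpha1 rv (mulr_gt0 g0 nu0) e0.
    by exists T0 => T TT0; rewrite -law; exact: H.
  + by move=> T; exact: (renewal_mean_ge nu0 ren).
  + by move=> T; exact: (renewal_mean_finite nu0 ren Ksum).
  + by move=> T C _; exact: (renewal_upper ren).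
  + by move=> eps; exact: (renewal_lower nu0 ren Ksum).
- have mh : measurable_fun [set p : R * A | 0 < p.1] h by case: hawkesN => -[].
  have h0 t a : 0 < t -> 0 <= h (t, a) by case: hawkesN => -[_ + _ _ _ _]; apply.
  have mZ2 : measurable_fun setT (fun a => fine (kappa h a)).
    by apply: measurableT_comp => //; exact: measurable_kappa.
  apply: (uniform_max_ratio mf nu0 g0).
  + by move=> x; exact: (rv2_tail1_positive mf mZ2 rv).
  + by move=> e e0; exact: (rv2_tail1_little_o mf mZ2 alpha1 rv (mulr_gt0 g0 nu0) e0).
  + by move=> T; exact: (hawkes_mean_ge nu0 hawkesN sub).
  + by move=> T; exact: (hawkes_mean_finite nu0 hawkesN sub).
  + by move=> T C; exact: (hawkes_upper nu0 hawkesN sub).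
  + by move=> eps; exact: (hawkes_lower nu0 hawkesN sub).
Qed.
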